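(* (1) Let $f:\Omega\to\mathbb A^{n+1}$ be a non-degenerate graph immersion satisfying $\nabla K=0$, and let $y\in\Omega$. Let $(A,\gamma)$ be the metrised commutative algebra on $A=T_y\Omega$ with product $u\bullet v=K(u,v)$ ($K$ the difference tensor at $y$) and $\gamma=h_y$. Then $A$ is associative and $f$ has, locally around $y$, the representing function $$F(x)=\sum_{k=2}^{\infty}\frac{(-2)^{k-2}}{k!}\gamma(x,x^{k-1}).$$ (2) Conversely, let $(A,\gamma)$ be a metrised associative, commutative algebra. Then the graph of the function $F(x)=\sum_{k=2}^{\infty}\frac{(-2)^{k-2}}{k!}\gamma(x,x^{k-1})$ on $A$ satisfies $\nabla K=0$, and at $x=\mathbf 0$ the difference tensor $K$ consists of the structure coefficients of $A$. (3) Every connected non-degenerate graph immersion satisfying $\nabla K=0$ can be extended to a hypersurface embedding with $\nabla K=0$, given globally by the graph of a function $F:\mathbb R^n\to\mathbb R$. (4) The graph immersion is an improper affine hypersphere if and only if $\det\gamma=\pm1$ and $A$ is nilpotent.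
   Context: A graph immersion $f:\Omega\to\mathbb A^{n+1}$ is a smooth hypersurface immersion of an $n$-manifold into real affine space equipped with a constant transversal vector field $\xi$. With $D$ the flat connection of $\mathbb A^{n+1}$, $D_X f_*Y=f_*(\nabla_XY)+h(X,Y)\xi$ defines the induced flat connection $\nabla$ and the affine fundamental form $h$; non-degenerate means $h$ non-degenerate. Then $\hat\nabla$ is the Levi-Civita connection of $h$ and $K=\nabla-\hat\nabla$ is the difference tensor. For a graph $x\mapsto(x,F(x))$ with $\xi=(\mathbf 0,1)$: $h=F''$ and $K^\gamma_{\alpha\beta}=-\frac12F_{,\alpha\beta\delta}F^{,\gamma\delta}$ (partial derivatives of $F$; $F^{,\gamma\delta}$ the inverse Hessian). ''Representing function $F$ locally around $y$'' is meant with respect to the identification of $T_y\Omega\times\mathbb R$ with $\mathbb A^{n+1}$ by $(v,\alpha)\mapsto f(y)+f_*(v)+\alpha\xi$: near $y$, $f$ is the graph of $F$ over a neighbourhood of $\mathbf 0\in T_y\Omega$ (so $F(\mathbf 0)=0$, $F'(\mathbf 0)=0$). ''Algebra'' means finite-dimensional real algebra; $(A,\gamma)$ is metrised if $\gamma$ is a non-degenerate symmetric bilinear form with $\gamma(u\bullet v,w)=\gamma(u,v\bullet w)$. Powers: $x^{k+1}=x\bullet x^k$. $A$ is nilpotent if for some $m$ all products of $m$ elements vanish. ''Improper affine hypersphere'' means that $\xi$ is the affine normal, i.e. in coordinates of $\mathbb A^{n+1}\cong\mathbb R^{n+1}$ with standard volume form $\det F''\equiv\pm1$; $\det\gamma$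 is computed in the same coordinates.
   Formalization: In (4) Ω is assumed connected, since the algebra at y says nothing about other components; in (3) Ω is nonempty and ''can be extended'' means that f factors through a local diffeomorphism into the global graph, as a non-injective f cannot literally extend to an embedding. *)

(* Defs.v *)
From HB Require Import structures.
From mathcomp Require Import all_boot all_order all_algebra.
From mathcomp Require Import all_classical all_reals all_analysis.

Set Implicit Arguments.
Unset Strict Implicit.
Unset Printing Implicit Defensive.

Import Order.TTheory GRing.Theory Num.Theory.
Import numFieldNormedType.Exports.

Local Open Scope classical_set_scope.
Local Open Scope ring_scope.

(* [U] is meant to be open, so that derivatives at points of [U] only depend
   on the restriction of [f] to [U]. *)
Fixpoint Ck_on (R : realType) (V W : normedModType R) (k : nat)
    (U : set V) (f : V -> W) : Prop :=
  match k with
  | 0%N => forall x, U x -> {for x, continuous f}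
  | k'.+1 => (forall x, U x -> differentiable f x) /\
             (forall v, Ck_on k' U ('D_v f))
  end.

Definition smooth_on (R : realType) (V W : normedModType R)
    (U : set V) (f : V -> W) : Prop :=
  forall k, Ck_on k U f.

(* A chart is a partial homeomorphism from [chart_dom] onto the open set
   [chart_img]; the values of [chart_map] and [chart_inv] outside of these sets
   are irrelevant. *)
Record chart (R : realType) (M : topologicalType) (n : nat) := Chart {
  chart_dom : set M;
  chart_map : M -> 'rV[R]_n;
  chart_inv : 'rV[R]_n -> M }.

Section Manifolds.
Variables (R : realType) (M : topologicalType) (n : nat).
Implicit Types (c : chart R M n) (atlas : set (chart R M n)).

Definition chart_img c : set 'rV[R]_n := chart_map c @` chart_dom c.

Definition is_chart c : Prop :=
  [/\ open (chart_dom c), open (chart_img c),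
      {within chart_dom c, continuous (chart_map c)},
      {within chart_img c, continuous (chart_inv c)} &
      forall p, chart_dom c p -> chart_inv c (chart_map c p) = p].

Definition smooth_atlas atlas : Prop :=
  [/\ forall c, atlas c -> is_chart c,
      forall p : M, exists2 c, atlas c & chart_dom c p &
      forall c1 c2, atlas c1 -> atlas c2 ->
        smooth_on (chart_map c1 @` (chart_dom c1 `&` chart_dom c2))
                  (chart_map c2 \o chart_inv c1)].

Definition smooth_manifold atlas : Prop :=
  [/\ hausdorff_space M, @second_countable M & smooth_atlas atlas].

Definition local_diffeo atlas (iota : M -> 'rV[R]_n) : Prop :=
  forall c, atlas c ->
    smooth_on (chart_img c) (iota \o chart_inv c) /\
    (forall x, chart_img c x -> 'J (iota \o chart_inv c) x \in unitmx).

End Manifolds.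

Definition id_chart (R : realType) (n : nat) : chart R 'rV[R]_n n :=
  Chart setT id id.

Definition std_atlas (R : realType) (n : nat) : set (chart R 'rV[R]_n n) :=
  [set @id_chart R n].
Arguments std_atlas : clear implicits.

Definition embedding (M N : topologicalType) (f : M -> N) : Prop :=
  [/\ continuous f, injective f &
      forall U, open U -> exists2 V, open V & f @` U = range f `&` V].

(* Tensors and connections of a parametrised piece of hypersurface [g] with the
   constant transversal field [xi]. Row vectors are used throughout: row [i] of
   ['J g x] is the i-th partial derivative of [g]. The convention for indices
   is that the upper index comes last. *)
Section Parametrised.
Variables (R : realType) (n : nat).
Variables (g : 'rV[R]_n -> 'rV[R]_(n + 1)) (xi : 'rV[R]_(n + 1)).

Definition pd (W : normedModType R) (i : 'I_n) (u : 'rV[R]_n -> W)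
  : 'rV[R]_n -> W := 'D_(delta_mx 0 i) u.

Definition immersed_at (x : 'rV[R]_n) : Prop := row_free ('J g x).

Definition transversal_at (x : 'rV[R]_n) : Prop := ~~ (xi <= 'J g x)%MS.

(* Coefficients of the second partial derivative in the frame
   (pd 0 g, ..., pd (n-1) g, xi), that is
     pd i (pd j g) = \sum_k induced_conn i j k * pd k g + aff_form i j * xi. *)
Definition gauss (x : 'rV[R]_n) (i j : 'I_n) : 'rV[R]_(n + 1) :=
  pd i (pd j g) x *m invmx (col_mx ('J g x) xi).

Definition induced_conn (i j k : 'I_n) (x : 'rV[R]_n) : R :=
  lsubmx (gauss x i j) 0 k.

Definition aff_form (x : 'rV[R]_n) : 'M[R]_n :=
  \matrix_(i, j) rsubmx (gauss x i j) 0 0.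

Definition h_ (i j : 'I_n) (x : 'rV[R]_n) : R := aff_form x i j.

Definition levi_civita (i j k : 'I_n) (x : 'rV[R]_n) : R :=
  2^-1 * \sum_l invmx (aff_form x) k l *
    (pd i (h_ j l) x + pd j (h_ i l) x - pd l (h_ i j) x).

Definition difference_tensor (i j k : 'I_n) (x : 'rV[R]_n) : R :=
  induced_conn i j k x - levi_civita i j k x.

Let K := difference_tensor.
Let Gamma := induced_conn.

Definition nabla_K (l i j k : 'I_n) (x : 'rV[R]_n) : R :=
  pd l (K i j k) x
  + \sum_m Gamma l m k x * K i j m x
  - \sum_m Gamma l i m x * K m j k x
  - \sum_m Gamma l j m x * K i m k x.

End Parametrised.

Section GraphImmersions.
Variables (R : realType) (n : nat) (M : topologicalType).
Variables (atlas : set (chart R M n)).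
Variables (f : M -> 'rV[R]_(n + 1)) (xi : 'rV[R]_(n + 1)).

Definition graph_immersion : Prop :=
  forall c, atlas c ->
    smooth_on (chart_img c) (f \o chart_inv c) /\
    (forall x, chart_img c x ->
       immersed_at (f \o chart_inv c) x /\
       transversal_at (f \o chart_inv c) xi x).

Definition nondegenerate_immersion : Prop :=
  forall c, atlas c -> forall x, chart_img c x ->
    aff_form (f \o chart_inv c) xi x \in unitmx.

Definition parallel_K : Prop :=
  forall c, atlas c -> forall x, chart_img c x ->
    forall l i j k, nabla_K (f \o chart_inv c) xi l i j k x = 0.

(* The tangent space at [y] is identified with ['rV[R]_n] by means of the
   coordinate frame of the chart [c]. *)
Variables (c : chart R M n) (y : M).

Definition tangent_mul (u v : 'rV[R]_n) : 'rV[R]_n :=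
  \row_k \sum_i \sum_j u 0 i * v 0 j *
    difference_tensor (f \o chart_inv c) xi i j k (chart_map c y).

Definition tangent_gram : 'M[R]_n :=
  aff_form (f \o chart_inv c) xi (chart_map c y).

Definition tangent_form (u v : 'rV[R]_n) : R :=
  (u *m tangent_gram *m v^T) 0 0.

Definition tangent_frame : 'M[R]_(n, n + 1) :=
  'J (f \o chart_inv c) (chart_map c y).

End GraphImmersions.

Section AffineCoordinates.
Variables (R : realType) (n : nat).

(* A point [o], a matrix [B] and a vector [xi] such that [col_mx B xi] is
   invertible form affine coordinates (x, t) |-> o + x *m B + t *: xi of the
   ambient space, in which [xi] becomes the vector (0, 1). *)
Definition graph_in (o : 'rV[R]_(n + 1)) (B : 'M[R]_(n, n + 1))
    (xi : 'rV[R]_(n + 1)) (F : 'rV[R]_n -> R) (x : 'rV[R]_n)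
  : 'rV[R]_(n + 1) :=
  o + x *m B + F x *: xi.

Definition graph_map (F : 'rV[R]_n -> R) (x : 'rV[R]_n) : 'rV[R]_(n + 1) :=
  row_mx x (F x)%:M.

Definition vertical : 'rV[R]_(n + 1) := row_mx 0 1%:M.

Definition horizontal : 'M[R]_(n, n + 1) := row_mx 1%:M 0.

Definition represented_near (M : topologicalType) (f : M -> 'rV[R]_(n + 1))
    (xi : 'rV[R]_(n + 1)) (o : 'rV[R]_(n + 1)) (B : 'M[R]_(n, n + 1))
    (y : M) (V : set 'rV[R]_n) (F : 'rV[R]_n -> R) : Prop :=
  exists U : set M, [/\ open U, U y, set_inj U f &
                        f @` U = graph_in o B xi F @` V].

Definition hessian (F : 'rV[R]_n -> R) (x : 'rV[R]_n) : 'M[R]_n :=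
  \matrix_(i, j) pd i (pd j F) x.

(* The volume form is the standard one in the affine coordinates (o, B, xi). *)
Definition improper_affine_sphere (M : topologicalType)
    (f : M -> 'rV[R]_(n + 1)) (xi : 'rV[R]_(n + 1))
    (o : 'rV[R]_(n + 1)) (B : 'M[R]_(n, n + 1)) : Prop :=
  forall y : M, exists (V : set 'rV[R]_n) (F : 'rV[R]_n -> R),
    [/\ open V, smooth_on V F, represented_near f xi o B y V F &
        forall x, V x -> `|\det (hessian F x)| = 1].

(* Row [i] consists of the horizontal coordinates, with respect to
   (o, B, xi), of the tangent vector given by row [i] of [J]. *)
Definition horizontal_part (J B : 'M[R]_(n, n + 1)) (xi : 'rV[R]_(n + 1))
  : 'M[R]_n :=
  lsubmx (J *m invmx (col_mx B xi)).

(* [G] is a Gram matrix with respect to the frame [J]; the result is the Gram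
   matrix of the same form in the affine coordinates (o, B, xi). *)
Definition gram_in (G : 'M[R]_n) (J B : 'M[R]_(n, n + 1))
    (xi : 'rV[R]_(n + 1)) : 'M[R]_n :=
  invmx (horizontal_part J B xi) *m G *m (invmx (horizontal_part J B xi))^T.

End AffineCoordinates.

Section Algebras.
Variables (R : realType) (A : vectType R).
Variables (mul : A -> A -> A) (gam : A -> A -> R).

Definition metrised_algebra : Prop :=
  [/\ (forall u, linear (mul u)) /\ (forall v, linear (mul^~ v)),
      (forall u, scalar (gam u)) /\ (forall v, scalar (gam^~ v)),
      forall u v, gam u v = gam v u,
      forall u, (forall v, gam u v = 0) -> u = 0 &
      forall u v w, gam (mul u v) w = gam u (mul v w)].

(* x^k = mul x (... (mul x x)) with k >= 1 factors; the value at k = 0 is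
   irrelevant. *)
Definition alg_pow (x : A) (k : nat) : A := iter k.-1 (mul x) x.

(* [is_product m x]: [x] is a product of [m] elements, with any bracketing. *)
Inductive is_product : nat -> A -> Prop :=
| Product1 x : is_product 1 x
| ProductM p q x y : is_product p x -> is_product q y ->
    is_product (p + q)%N (mul x y).

(* There is no product of 0 elements, whence the condition on [m]. *)
Definition nilpotent_algebra : Prop :=
  exists2 m, (0 < m)%N & forall x, is_product m x -> x = 0.

Definition potential_partial_sum (x : A) (N : nat) : R :=
  \sum_(2 <= k < N) (-2) ^+ (k - 2) / k`!%:R * gam x (alg_pow x k.-1).

Definition potential (x : A) : R := limn (potential_partial_sum x).

Definition gram_of (n : nat) (X : n.-tuple A) : 'M[R]_n :=
  \matrix_(i, j) gam X`_i X`_j.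

Definition potential_in (n : nat) (X : n.-tuple A) (x : 'rV[R]_n) : R :=
  potential (\sum_i x 0 i *: X`_i).

End Algebras.

(* Main.v *)
(** In affine coordinates in which [xi] is vertical, the immersion is locally the
    graph of a function F, nabla is the coordinate derivative and h = F''.
    Therefore nabla K = 0 says that the structure matrices C_a of K are constant.
    They are self-adjoint with respect to h because the third derivatives of F
    are symmetric, so that D_v F'' = -2 C_v F'', and they commute because the
    second derivatives of F'' are symmetric; hence the algebra is associative.
    The column (F, dF, 1) then solves a linear system whose constant coefficient
    matrices commute, so that F is a matrix coefficient of an exponential, and the
    power series of this exponential is the series of the theorem. Such a
    solution is defined on the whole space and determined by its restriction to
    any non-empty open set, which gives the global extension when M is connected.
    Finally D_v (det F'') = -2 tr(C_v) det F'', and the operators C_v are all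
    traceless exactly when the algebra is nilpotent, since powers of
    multiplication operators are multiplication operators. *)

Require Import Defs.
From mathcomp Require Import perm ring lra.
From HB Require Import structures.
From mathcomp Require Import all_boot all_order all_algebra.
From mathcomp Require Import all_classical all_reals all_analysis.
Import Order.TTheory GRing.Theory Num.Theory.
Import numFieldNormedType.Exports.
Local Open Scope classical_set_scope.
Local Open Scope ring_scope.

Set Implicit Arguments.
Unset Strict Implicit.
Unset Printing Implicit Defensive.

(** Two kinds of coordinates meet: charts, in which the tensors are defined, and affine coordinates,
    in which they become constant. The projection along [xi] is never inverted to rewrite the
    tensors; everything stays a function of the chart parameter, and only the frame changes, by the
    horizontal part of the Jacobian. The inverse function theorem then has to supply just
    injectivity and openness of the projection.

    The factor -2 arises because h is parallel for nabla - K, so that K enters the derivative of h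
    through both arguments, and self-adjointness makes the two contributions equal.

    The system for (F, dF, 1) is linear because F'' is an affine function of dF: the form dF(ab),
    where ab is the product of the algebra, has derivative C_v F'' along v, so F'' + 2 dF(ab) is
    constant. The entry 1 carries this constant. It is the Hessian extrapolated to gradient zero and
    may be degenerate if the gradient at the base point is not zero; invertibility is therefore
    asked of F'' at the base point. *)

Section Differentiability.
Context {R : realType} {V W : normedModType R}.

Lemma near_eq_differentiable (f g : V -> W) (x : V) :
  (\near x, f x = g x) -> differentiable f x -> differentiable g x.
Proof.
move=> fg df; have [dc dE] := (diff_locallyP _ _).1 df.
(* The expansion of [f] carries over because the increments agree near 0; [diff_unique] then
   identifies ['d g x] with ['d f x]. *)
have H : g \o shift x = cst (g x) + 'd f x +o_ 0 id.
  apply/eqaddoP => e e0.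
  have /eqaddoP/(_ _ e0) := dE; rewrite (nbhs_singleton fg).
  have : \forall h \near 0, f (h + x) = g (h + x).
    by move: fg; rewrite (near_shift 0)/= subr0.
  by apply: filterS2 => h /= E; rewrite !fctE /= E.
by apply/diff_locallyP; rewrite (diff_unique dc H).
Qed.

End Differentiability.

Section MatrixDerivatives.
Context {R : realType} {V : normedModType R}.

Lemma is_derive_mxP m n (M : V -> 'M[R]_(m, n)) x v dM :
  is_derive x v M dM <-> forall i j, is_derive x v (fun t => M t i j) (dM i j).
Proof.
split=> [[dv <-] i j|H].
  split; first exact: (derivable_mxP _ _ _).1 dv i j.
  by rewrite derive_mx// mxE.
have dv : derivable M x v by apply/derivable_mxP => i j; case: (H i j).
split=> //; rewrite derive_mx//; apply/matrixP => i j.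
by rewrite mxE; case: (H i j).
Qed.

Lemma is_derive_mulmx m n p (A : V -> 'M[R]_(m, n)) (B : V -> 'M[R]_(n, p))
    x v dA dB :
  is_derive x v A dA -> is_derive x v B dB ->
  is_derive x v (fun t => A t *m B t) (dA *m B x + A x *m dB).
Proof.
move=> /is_derive_mxP HA /is_derive_mxP HB; apply/is_derive_mxP => i j.
have HM k : is_derive x v (fun t => A t i k * B t k j)
    (dA i k * B x k j + A x i k * dB k j).
  apply: (is_derive_eq (is_deriveM (HA i k) (HB k j))) => /=.
  by rewrite addrC ![_ *: _]mulrC [_ * A x i k]mulrC.
rewrite (_ : (fun t => _) = \sum_k (fun t => A t i k * B t k j)); last first.
  by apply/funext => t; rewrite mxE fct_sumE.
by rewrite !mxE -big_split; apply: is_derive_sum.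
Qed.

End MatrixDerivatives.

(** * Smooth functions *)

Section CkClosure.
Context {R : realType} {V : normedModType R}.
Variables (U : set V) (oU : open U).

(** Derivative formulas hold only at points of [U]; this lets them replace ['D_v f] there, which is
    how the closure proofs below pass from order k to k + 1. *)
Lemma Ck_on_congr (W : normedModType R) k (f g : V -> W) :
  (forall x, U x -> f x = g x) -> Ck_on k U f -> Ck_on k U g.
Proof.
have near_eq (f' g' : V -> W) x : (forall x, U x -> f' x = g' x) -> U x ->
    \near x, f' x = g' x.
  by move=> fg Ux; apply: filterS (open_nbhs_nbhs (conj oU Ux)) => y /fg.
elim: k f g => [|k IH] f g fg /= => [cf x Ux|[df Df]].
  rewrite /prop_for /continuous_at -(fg _ Ux); apply: cvg_trans (cf x Ux).
  exact/near_eq_cvg/near_eq.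
split=> [x Ux|v].
  by apply: near_eq_differentiable (df x Ux); exact: near_eq.
by apply: IH (Df v) => x Ux; apply: near_eq_derive; exact: near_eq.
Qed.

Lemma Ck_onS (W : normedModType R) k (f : V -> W) :
  Ck_on k.+1 U f -> Ck_on k U f.
Proof.
elim: k f => [|k IH] f [df Df].
  by move=> x Ux; apply: differentiable_continuous; exact: df.
by split=> // v; apply: IH.
Qed.

Lemma Ck_on_lin (W W' : normedModType R) k (f : V -> W)
    (L : {linear W -> W'}) :
  continuous L -> Ck_on k U f -> Ck_on k U (L \o f).
Proof.
move=> cL; elim: k f => [|k IH] f /= => [cf x Ux|[df Df]].
  by apply: continuous_comp; [exact: cf|exact: cL].
have dL y : differentiable L y by exact: linear_differentiable.
split=> [x Ux|v]; first by apply: differentiable_comp => //; exact: df.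
apply: Ck_on_congr (IH _ (Df v)) => x Ux /=.
have dfx := df _ Ux.
rewrite !deriveE//; last exact: differentiable_comp.
by rewrite (diff_comp dfx (dL _))/= diff_lin.
Qed.

Lemma Ck_on_cst (W : normedModType R) k (w : W) : Ck_on k U (cst w).
Proof.
elim: k w => [|k IH] w /=; first by move=> x Ux; exact: cst_continuous.
split=> // v; rewrite (_ : 'D_v _ = cst 0)//.
by apply/funext => x; rewrite derive_cst.
Qed.

Lemma Ck_onD (W : normedModType R) k (f g : V -> W) :
  Ck_on k U f -> Ck_on k U g -> Ck_on k U (f + g).
Proof.
elim: k f g => [|k IH] f g /= => [cf cg x Ux|[df Df] [dg Dg]].
  by apply: continuousD; [exact: cf|exact: cg].
split=> [x Ux|v]; first by apply: differentiableD; [exact: df|exact: dg].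
apply: Ck_on_congr (IH _ _ (Df v) (Dg v)) => x Ux.
have dfx := df _ Ux; have dgx := dg _ Ux.
by rewrite deriveD//; exact: diff_derivable.
Qed.

Lemma Ck_on_sum (W : normedModType R) k I (s : seq I) (P : pred I)
    (f : I -> V -> W) :
  (forall i, P i -> Ck_on k U (f i)) -> Ck_on k U (\sum_(i <- s | P i) f i).
Proof.
move=> H; elim/big_rec : _ => [|i g Pi Hg]; first exact: Ck_on_cst.
by apply: Ck_onD => //; exact: H.
Qed.

Lemma Ck_onM k (f g : V -> R) :
  Ck_on k U f -> Ck_on k U g -> Ck_on k U (f * g).
Proof.
elim: k f g => [|k IH] f g => [cf cg x Ux|Cf Cg].
  by apply: continuousM; [exact: cf|exact: cg].
have [[df Df] [dg Dg]] := (Cf, Cg).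
split=> [x Ux|v]; first by apply: differentiableM; [exact: df|exact: dg].
apply: (@Ck_on_congr _ _ (f * 'D_v g + g * 'D_v f)); last first.
  by apply: Ck_onD; apply: IH; [exact: Ck_onS Cf|exact: Dg|exact: Ck_onS Cg|exact: Df].
move=> x Ux; have dfx := df _ Ux; have dgx := dg _ Ux.
by rewrite deriveM//; exact: diff_derivable.
Qed.

(** The derivative of 1/f contains 1/f undifferentiated, so order k of the claim yields order k +
    1. *)
Lemma Ck_onV k (f : V -> R) : (forall x, U x -> f x != 0) ->
  Ck_on k U f -> Ck_on k U (fun x => (f x)^-1).
Proof.
move=> f0; elim: k => [|k IH] => [cf x Ux|Cf].
  by apply: continuousV; [exact: f0|exact: cf].
have [df Df] := Cf; have CV := IH (Ck_onS Cf).
split=> [x Ux|v]; first by apply: differentiableV; [exact: df|exact: f0].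
apply: (@Ck_on_congr _ _ (cst (-1) * (((fun x => (f x)^-1) *
    (fun x => (f x)^-1)) * 'D_v f))); last first.
  apply: Ck_onM; first exact: (@Ck_on_cst R k (-1)).
  by apply: Ck_onM; [exact: Ck_onM|exact: Df].
move=> x Ux; rewrite deriveV; [|exact: f0|exact/diff_derivable/df].
by rewrite !fctE -exprVn expr2 mulN1r -mulNr.
Qed.

End CkClosure.

Section SmoothClosure.
Context {R : realType} {V : normedModType R}.
Variables (U : set V) (oU : open U).

Lemma smooth_differentiable (W : normedModType R) (f : V -> W) x :
  smooth_on U f -> U x -> differentiable f x.
Proof. by move=> /(_ 1%N)[df _] /df. Qed.

Lemma smooth_continuous (W : normedModType R) (f : V -> W) x :
  smooth_on U f -> U x -> {for x, continuous f}.
Proof. by move=> /(_ 0%N); exact. Qed.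

Lemma smooth_derive (W : normedModType R) (f : V -> W) v :
  smooth_on U f -> smooth_on U ('D_v f).
Proof. by move=> sf k; have [_] := sf k.+1; exact. Qed.

Lemma smooth_congr (W : normedModType R) (f g : V -> W) :
  (forall x, U x -> f x = g x) -> smooth_on U f -> smooth_on U g.
Proof. by move=> fg sf k; apply: Ck_on_congr (sf k). Qed.

Lemma smooth_lin (W W' : normedModType R) (f : V -> W) (L : {linear W -> W'}) :
  continuous L -> smooth_on U f -> smooth_on U (L \o f).
Proof. by move=> cL sf k; exact: Ck_on_lin. Qed.

Lemma smooth_cst (W : normedModType R) (w : W) : smooth_on U (fun=> w).
Proof. by move=> k; exact: Ck_on_cst. Qed.

Lemma smoothD (W : normedModType R) (f g : V -> W) :
  smooth_on U f -> smooth_on U g -> smooth_on U (fun x => f x + g x).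
Proof. by move=> sf sg k; exact: Ck_onD. Qed.

Lemma smooth_sum (W : normedModType R) (I : Type) (s : seq I) (P : pred I)
    (f : I -> V -> W) : (forall i, P i -> smooth_on U (f i)) ->
  smooth_on U (fun x => \sum_(i <- s | P i) f i x).
Proof.
move=> H k; rewrite (_ : (fun x => _) = \sum_(i <- s | P i) f i).
  by apply: Ck_on_sum => // i Pi; exact: H.
by apply/funext => x; rewrite fct_sumE.
Qed.

Lemma smoothM (f g : V -> R) :
  smooth_on U f -> smooth_on U g -> smooth_on U (fun x => f x * g x).
Proof. by move=> sf sg k; exact: Ck_onM. Qed.

Lemma smooth_prod (I : Type) (s : seq I) (P : pred I) (f : I -> V -> R) :
  (forall i, P i -> smooth_on U (f i)) ->
  smooth_on U (fun x => \prod_(i <- s | P i) f i x).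
Proof.
move=> H; elim: s => [|i s IH].
  by under eq_fun do rewrite big_nil; exact: smooth_cst.
under eq_fun do rewrite big_cons.
by case Pi: (P i) => //; apply: smoothM => //; exact: H.
Qed.

Lemma smoothV (f : V -> R) : (forall x, U x -> f x != 0) ->
  smooth_on U f -> smooth_on U (fun x => (f x)^-1).
Proof. by move=> f0 sf k; exact: Ck_onV. Qed.

Lemma smoothZl (W : normedModType R) (f : V -> R) (w : W) :
  smooth_on U f -> smooth_on U (fun x => f x *: w).
Proof.
have lin : linear (fun t : R => t *: w).
  by move=> a s t; rewrite scalerDl scalerA.
pose L : {linear R -> W} := HB.pack (fun t : R => t *: w)
  (GRing.isLinear.Build _ _ _ _ _ lin).
by apply: (@smooth_lin _ _ f L); exact: scalel_continuous.
Qed.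

Lemma smooth_mxP m n (M : V -> 'M[R]_(m, n)) :
  smooth_on U M <-> forall i j, smooth_on U (fun x => M x i j).
Proof.
split=> [sM i j|sM].
  have lin : linear (fun N : 'M[R]_(m, n) => N i j).
    by move=> a A B; rewrite !mxE.
  pose L : {linear 'M[R]_(m, n) -> R} := HB.pack (fun N : 'M[R]_(m, n) => N i j)
    (GRing.isLinear.Build _ _ _ _ _ lin).
  by apply: (@smooth_lin _ _ M L) => //; exact: coord_continuous.
apply: (@smooth_congr _ (fun x => \sum_i \sum_j M x i j *: delta_mx i j)).
  by move=> x _; rewrite -matrix_sum_delta.
by do 2![apply: smooth_sum => ? _]; exact: smoothZl.
Qed.

Lemma smooth_mulmx m n p (A : V -> 'M[R]_(m, n)) (B : V -> 'M[R]_(n, p)) :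
  smooth_on U A -> smooth_on U B -> smooth_on U (fun x => A x *m B x).
Proof.
move=> /smooth_mxP sA /smooth_mxP sB; apply/smooth_mxP => i j.
under eq_fun do rewrite mxE.
by apply: smooth_sum => k _; apply: smoothM.
Qed.

Lemma smooth_tr m n (A : V -> 'M[R]_(m, n)) :
  smooth_on U A -> smooth_on U (fun x => (A x)^T).
Proof.
move=> /smooth_mxP sA; apply/smooth_mxP => i j.
by under eq_fun do rewrite mxE; exact: sA.
Qed.

Lemma smooth_det n (A : V -> 'M[R]_n) :
  smooth_on U A -> smooth_on U (fun x => \det (A x)).
Proof.
move=> /smooth_mxP sA; apply: smooth_sum => s _.
by apply: smoothM; [exact: smooth_cst|exact: smooth_prod].
Qed.

(** Cramer's rule. Where [A x] is singular, [invmx] returns its argument, so the formula is used on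
    [U] only. *)
Lemma smooth_invmx n (A : V -> 'M[R]_n) :
  (forall x, U x -> A x \in unitmx) ->
  smooth_on U A -> smooth_on U (fun x => invmx (A x)).
Proof.
move=> uA sA; apply: (@smooth_congr _ (fun x => (\det (A x))^-1 *: \adj (A x))).
  by move=> x Ux; rewrite /invmx uA.
apply/smooth_mxP => i j; under eq_fun do rewrite !mxE.
apply: smoothM.
  by apply: smoothV; [move=> x /uA; rewrite unitmxE unitfE|exact: smooth_det].
apply: smoothM; first exact: smooth_cst.
apply: smooth_det; apply/smooth_mxP => a b; under eq_fun do rewrite !mxE.
exact: ((smooth_mxP A).1 sA).
Qed.

End SmoothClosure.

(** * Mean value theorem and symmetry of second derivatives *)

Section MeanValue.
Context {R : realType} {V : normedModType R}.

Lemma is_derive_line (W : normedModType R) (f : V -> W) x v (t : R) :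
  differentiable f (x + t *: v) ->
  is_derive t 1 (fun s : R => f (x + s *: v)) ('D_v f (x + t *: v)).
Proof.
move=> df; have dl : is_diff t (fun s : R => x + s *: v) (fun s => s *: v).
  by apply: (is_diff_eq (is_diffD (is_diff_cst _ _) _)); rewrite add0r.
have dfl : differentiable (f \o (fun s : R => x + s *: v)) t.
  by apply: differentiable_comp => //; case: dl.
split; first exact: diff_derivable.
have [dl' dlE] := dl.
rewrite (deriveE (1 : R) dfl) (diff_comp dl' df)/= dlE scale1r.
by rewrite deriveE.
Qed.

Lemma derive_scale (W : normedModType R) (f : V -> W) x v (r : R) :
  differentiable f x -> 'D_(r *: v) f x = r *: 'D_v f x.
Proof. by move=> df; rewrite !deriveE// linearZ. Qed.

Lemma mean_value (f : V -> R) x v :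
  (forall t : R, 0 <= t <= 1 -> differentiable f (x + t *: v)) ->
  exists2 t : R, 0 <= t <= 1 & f (x + v) - f x = 'D_v f (x + t *: v).
Proof.
move=> df.
have [||c] := @MVT_segment R (fun t : R => f (x + t *: v))
  (fun t => 'D_v f (x + t *: v)) 0 1 ler01.
- move=> t; rewrite in_itv/= => /andP[t0 t1].
  by apply: is_derive_line; apply: df; rewrite !ltW.
- apply: continuous_in_subspaceT => t; rewrite inE/= in_itv/= => t01.
  apply: differentiable_continuous; apply/derivable1_diffP.
  by case: (is_derive_line (df _ t01)).
- rewrite in_itv/= => c01; rewrite scale0r scale1r addr0 subr0 mulr1 => E.
  by exists c.
Qed.

Lemma ball_segment (u x v : V) e (t : R) : 0 <= t <= 1 ->
  ball u e x -> ball u e (x + v) -> ball u e (x + t *: v).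
Proof.
rewrite -!ball_normE /= => /andP[t0 t1] Bx By.
rewrite (_ : u - _ = (1 - t) *: (u - x) + t *: (u - (x + v))); last first.
  by rewrite !opprD !addrA scalerBl scale1r (scalerBr t (u - x)) subrKA.
apply: le_lt_trans (ler_normD _ _) _; rewrite !normrZ ger0_norm ?subr_ge0//.
rewrite (ger0_norm t0).
(* Strictness comes from the summand with factor t, which vanishes for t = 0. *)
have [->|t_neq0] := eqVneq t 0; first by rewrite subr0 mul1r mul0r addr0.
rewrite (_ : e = (1 - t) * e + t * e); last by ring.
by rewrite ler_ltD ?ler_wpM2l ?subr_ge0 ?ltr_pM2l ?(ltW Bx)// lt_neqAle eq_sym t_neq0.
Qed.

Lemma derive_cst_ball (f : V -> R) u e :
  (forall x, ball u e x -> differentiable f x) ->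
  (forall x, ball u e x -> forall v, 'D_v f x = 0) ->
  forall x, ball u e x -> f x = f u.
Proof.
move=> df D0 x Bx; have e0 : 0 < e.
  by move: Bx; rewrite -ball_normE; apply: le_lt_trans.
have Bu : ball u e u by exact: ballxx.
have Bt (t : R) : 0 <= t <= 1 -> ball u e (u + t *: (x - u)).
  by move=> t01; apply: ball_segment => //; rewrite subrKC.
have [t t01|t t01] := @mean_value f u (x - u); first exact/df/Bt.
by rewrite (D0 _ (Bt _ t01)) subrKC => /eqP; rewrite subr_eq0 => /eqP.
Qed.

(** The mean value theorem twice: along v for the increment of [f] by [r *: w], then along w for
    ['D_v f]. *)
Let second_difference (f : V -> R) (U : set V) x v w (r : R) :
  (forall y, U y -> differentiable f y) ->
  (forall y, U y -> differentiable ('D_v f) y) ->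
  (forall s t : R, 0 <= s <= 1 -> 0 <= t <= 1 ->
    U (x + s *: (r *: v) + t *: (r *: w))) ->
  exists s t : R, [/\ 0 <= s <= 1, 0 <= t <= 1 &
    f (x + r *: v + r *: w) - f (x + r *: v) - (f (x + r *: w) - f x) =
    r * (r * 'D_w ('D_v f) (x + s *: (r *: v) + t *: (r *: w)))].
Proof.
move=> df ddf HU.
have H01 : 0 <= (1 : R) <= 1 by rewrite ler01 lexx.
have H00 : 0 <= (0 : R) <= 1 by rewrite ler01 lexx.
have dk (s : R) : 0 <= s <= 1 ->
    is_diff (x + s *: (r *: v)) (fun y => f (y + r *: w) - f y)
      (fun z => 'd f (x + s *: (r *: v) + r *: w) z - 'd f (x + s *: (r *: v)) z).
  move=> s01.
  have d1 : differentiable f (x + s *: (r *: v) + r *: w).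
    by have := HU _ _ s01 H01; rewrite scale1r => /df.
  have d2 : differentiable f (x + s *: (r *: v)).
    by have := HU _ _ s01 H00; rewrite scale0r addr0 => /df.
  apply: is_diffB; last exact: differentiableP.
  have dsh : is_diff (x + s *: (r *: v)) (fun y => y + r *: w) id.
    by apply: (is_diff_eq (is_diffD _ (is_diff_cst _ _))); rewrite addr0.
  exact: (is_diff_comp dsh (differentiableP d1)).
have [s s01|s s01] := @mean_value (fun y => f (y + r *: w) - f y) x (r *: v).
  by have [] := dk _ s01.
have [s01'] : 'D_(r *: v) (fun y => f (y + r *: w) - f y) (x + s *: (r *: v)) =
    r * ('D_v f (x + s *: (r *: v) + r *: w) - 'D_v f (x + s *: (r *: v))).
  rewrite derive_scale; last by have [] := dk _ s01.
  rewrite deriveE; last by have [] := dk _ s01.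
  have [_ ->] := dk _ s01; rewrite !deriveE//.
    by have := HU _ _ s01 H00; rewrite scale0r addr0 => /df.
  by have := HU _ _ s01 H01; rewrite scale1r => /df.
rewrite s01' => ->.
have [t t01|t t01 ->] :=
    @mean_value ('D_v f) (x + s *: (r *: v)) (r *: w).
  by apply: ddf; exact: HU.
exists s, t; split=> //; rewrite derive_scale//; apply: ddf; exact: HU.
Qed.

(** The second difference over the parallelogram spanned by [r *: v] and [r *: w] is symmetric in v
    and w. It equals r^2 times either mixed derivative, taken at some point of the parallelogram,
    and both are continuous at x. *)
Lemma derive_sym (U : set V) (f : V -> R) v w x : open U -> smooth_on U f ->
  U x -> 'D_v ('D_w f) x = 'D_w ('D_v f) x.
Proof.
move=> oU sf Ux; apply/eqP; rewrite -subr_eq0 -normr_le0.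
apply/ler_addgt0Pl => /= e e0; rewrite addr0.
have e20 : 0 < e / 2 by rewrite divr_gt0.
have close (a b p : R) : `|b - p| < e / 2 -> `|a - p| < e / 2 -> `|a - b| <= e.
  move=> Hb1 Ha; rewrite -(subrKA p) (le_trans (ler_normD _ _))//.
  by rewrite (splitr e) lerD ?ltW// distrC.
have swap (a b c d : R) : a - b - (c - d) = a - c - (b - d) by ring.
have c1 := smooth_continuous (smooth_derive v (smooth_derive w sf)) Ux.
have c2 := smooth_continuous (smooth_derive w (smooth_derive v sf)) Ux.
have N1 : nbhs x U by exact: open_nbhs_nbhs.
have N2 : nbhs x [set y | `|'D_v ('D_w f) x - 'D_v ('D_w f) y| < e / 2].
  exact: ((cvgrPdist_lt _ _).1 c1).
have N3 : nbhs x [set y | `|'D_w ('D_v f) x - 'D_w ('D_v f) y| < e / 2].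
  exact: ((cvgrPdist_lt _ _).1 c2).
have FF : Filter (nbhs x) by exact: nbhs_filter.
have /nbhs_ballP[d /= d0 Hd] := @filterI _ _ FF _ _ N1 (@filterI _ _ FF _ _ N2 N3).
have [r r0 rd] : exists2 r : R, 0 < r & r * (`|v| + `|w|) < d.
  have N0 : 0 < `|v| + `|w| + 1 by rewrite ltr_wpDl// addr_ge0.
  (* The summand 1 gives a positive denominator even for v = w = 0, and makes the bound strict. *)
  exists (d / (`|v| + `|w| + 1)); first by rewrite divr_gt0.
  by rewrite mulrAC ltr_pdivrMr// ltr_pM2l// ltrDl.
have Hb (s t : R) : 0 <= s <= 1 -> 0 <= t <= 1 ->
    ball x d (x + s *: (r *: v) + t *: (r *: w)).
  move=> /andP[s0 s1] /andP[t0 t1]; rewrite -ball_normE /= -addrA opprD addNKr.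
  rewrite normrN; apply: le_lt_trans (ler_normD _ _) _; rewrite !normrZ.
  rewrite (ger0_norm s0) (ger0_norm t0) (gtr0_norm r0).
  apply: le_lt_trans rd; rewrite mulrDr.
  by rewrite lerD// ler_piMl// mulr_ge0// ltW.
have sU (s t : R) : 0 <= s <= 1 -> 0 <= t <= 1 ->
    U (x + s *: (r *: v) + t *: (r *: w)).
  by move=> s01 t01; case: (Hd _ (Hb _ _ s01 t01)).
have sU' (s t : R) : 0 <= s <= 1 -> 0 <= t <= 1 ->
    U (x + s *: (r *: w) + t *: (r *: v)).
  by move=> s01 t01; rewrite addrAC; exact: sU.
have df y : U y -> differentiable f y by exact: smooth_differentiable.
have dv y : U y -> differentiable ('D_v f) y.
  by move=> Uy; exact: smooth_differentiable (smooth_derive v sf) Uy.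
have dw y : U y -> differentiable ('D_w f) y.
  by move=> Uy; exact: smooth_differentiable (smooth_derive w sf) Uy.
have [s [t [s01 t01 E1]]] := second_difference df dv sU.
have [s' [t' [s01' t01' E2]]] := second_difference df dw sU'.
have E : 'D_w ('D_v f) (x + s *: (r *: v) + t *: (r *: w)) =
         'D_v ('D_w f) (x + s' *: (r *: w) + t' *: (r *: v)).
  apply: (mulfI (lt0r_neq0 r0)); apply: (mulfI (lt0r_neq0 r0)).
  by apply: (etrans (esym E1)); apply: (etrans _ E2); rewrite (addrAC x) swap.
have [_ [_ B1]] := Hd _ (Hb _ _ s01 t01).
have := Hb _ _ t01' s01'; rewrite addrAC => Hb'.
have [_ [B2 _]] := Hd _ Hb'.
by apply: close B1 _; rewrite E.
Qed.

End MeanValue.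

Section SmoothIdentity.
Context {R : realType} {V : normedModType R}.

Lemma smooth_id (U : set V) : smooth_on U (@id V).
Proof.
case=> [x _|k]; first exact: cvg_id.
split=> // v; rewrite (_ : 'D_v id = cst v); first exact: Ck_on_cst.
by apply/funext => x; rewrite derive_id.
Qed.

End SmoothIdentity.

Section PartialDerivatives.
Context {R : realType} {V : normedModType R}.

Lemma derive_pd n (W : normedModType R) (f : 'rV[R]_n -> W) x v :
  differentiable f x -> 'D_v f x = \sum_i v 0 i *: pd i f x.
Proof.
move=> df; rewrite deriveE// {1}(row_sum_delta v) linear_sum.
by apply: eq_bigr => i _; rewrite linearZ /pd deriveE.
Qed.

Lemma mulmx_continuous m n p (B : 'M[R]_(n, p)) :
  continuous (fun A : 'M[R]_(m, n) => A *m B).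
Proof.
move=> A; apply: (@smooth_continuous _ _ setT _ (fun A => A *m B)) => //.
by apply: smooth_mulmx; [exact: openT|exact: smooth_id|exact: smooth_cst].
Qed.

Lemma derive_entry m n (M : V -> 'M[R]_(m, n)) x v i j :
  differentiable M x -> 'D_v (fun y => M y i j) x = ('D_v M x) i j.
Proof. by move=> dM; rewrite derive_mx ?mxE//; exact: diff_derivable. Qed.

Lemma row_jacobian n m (g : 'rV[R]_n -> 'rV[R]_m) x i :
  differentiable g x -> row i ('J g x) = pd i g x.
Proof. by move=> dg; rewrite rowE /pd deriveEjacobian. Qed.

End PartialDerivatives.

(** * Inverse function theorem *)

Section InverseFunction.
Context {R : realType} {n : nat}.

(** The norm of row vectors is the maximum norm, so each component k is estimated on its own by the
    mean value theorem. [s k] is the sum norm of the gradient of that component, dual to the maximum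
    norm; it vanishes at [u0] and is continuous. *)
Lemma smooth_strict_derivative (O : set 'rV[R]_n) (psi : 'rV[R]_n -> 'rV[R]_n)
    u0 (c : R) : open O -> smooth_on O psi -> O u0 ->
  (forall v, 'D_v psi u0 = 0) -> 0 < c ->
  exists2 e : R, 0 < e & ball u0 e `<=` O /\
    forall u v, ball u0 e u -> ball u0 e v ->
      `|psi u - psi v| <= c * `|u - v|.
Proof.
move=> oO spsi Ou0 D0 c0; pose s (k : 'I_n) (p : 'rV[R]_n) : R := \sum_i `|pd i psi p 0 k|.
have FF : Filter (nbhs u0) by exact: nbhs_filter.
have Ns : nbhs u0 [set p | forall k, s k p < c].
  suff H k : nbhs u0 [set p | s k p < c].
    exact: (@filter_forall _ _ (fun k p => s k p < c) (nbhs u0) FF H).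
  have cs : {for u0, continuous (s k)}.
    rewrite (_ : s k = \sum_i (fun p => `|pd i psi p 0 k|)); last first.
      by apply/funext => p; rewrite fct_sumE.
    elim/big_ind : _ => [|f g cf cg|i _]; first exact: cst_continuous.
      exact: continuousD.
    apply: cvg_norm.
    apply: (smooth_continuous (U := O)) => //.
    by apply: (smooth_mxP oO _).1; exact: smooth_derive.
  have s0 : s k u0 = 0.
    by rewrite /s big1// => i _; rewrite /pd D0 mxE normr0.
  move/cvgrPdist_lt : cs => /(_ _ c0) H.
  apply: filterS H => p; rewrite /= s0 sub0r normrN ger0_norm//.
  by apply: sumr_ge0.
have /nbhs_ballP[e /= e0 He] :=
  @filterI _ _ FF _ _ (open_nbhs_nbhs (conj oO Ou0)) Ns.
exists e => //; split=> [p /He[]//|u v Bu Bv].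
have [->|uv] := eqVneq u v; first by rewrite !subrr !normr0 mulr0.
rewrite [leLHS]/Num.Def.normr/= mx_normrE; apply: bigmax_le => [|[i k] _].
  by rewrite mulr_ge0// ltW.
rewrite !ord1 /= !mxE.
have dpsi p : ball u0 e p -> differentiable psi p.
  by move=> /He[Op _]; exact: smooth_differentiable spsi Op.
have seg (t : R) : 0 <= t <= 1 -> ball u0 e (v + t *: (u - v)).
  by move=> t01; apply: ball_segment => //; rewrite subrKC.
have [t t01|t t01] := @mean_value _ _ (fun p => psi p 0 k) v (u - v).
  apply: differentiable_comp (differentiable_coord _ _ _).
  exact/dpsi/seg.
rewrite subrKC => ->; rewrite derive_entry; last exact/dpsi/seg.
rewrite derive_pd; last exact/dpsi/seg.
rewrite summxE; apply: le_trans (ler_norm_sum _ _ _) _.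
have [_ /(_ k)/ltW sc] := He _ (seg _ t01).
apply: (@le_trans _ _ (s k (v + t *: (u - v)) * `|u - v|)); last first.
  by rewrite ler_wpM2r.
rewrite /s mulr_suml; apply: ler_sum => j _; rewrite mxE normrM mulrC.
rewrite ler_wpM2l// [leRHS]/Num.Def.normr/= mx_normrE.
exact: (le_bigmax _ _ (0, j)).
Qed.

(** Composed with the inverse [A] of the Jacobian at [u0], [phi] is the identity plus a map [psi]
    with vanishing differential, hence 1/2-Lipschitz near [u0]. This gives injectivity at once, and
    openness by the Banach fixed point theorem. *)
Theorem inverse_function (O : set 'rV[R]_n) (phi : 'rV[R]_n -> 'rV[R]_n) u0 :
  open O -> smooth_on O phi -> O u0 -> 'J phi u0 \in unitmx ->
  exists2 e : R, 0 < e & [/\ ball u0 e `<=` O, set_inj (ball u0 e) phi &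
    forall U, open U -> U `<=` ball u0 e -> open (phi @` U)].
Proof.
move=> oO sphi Ou0 uJ; set A := invmx ('J phi u0).
pose psi u := phi u *m A - u.
have spsi : smooth_on O psi.
  apply: smoothD => //; first by apply: smooth_mulmx => //; exact: smooth_cst.
  apply: (@smooth_congr _ _ _ oO _ (fun u => u *m (- 1%:M))).
    by move=> x _; rewrite mulmxN mulmx1.
  by apply: smooth_mulmx => //; [exact: smooth_id|exact: smooth_cst].
have D0 v : 'D_v psi u0 = 0.
  have dphi : is_derive u0 v phi (v *m 'J phi u0).
    have dphi := smooth_differentiable sphi Ou0.
    by split; [exact: diff_derivable|rewrite deriveEjacobian].
  have := is_derive_mulmx dphi (is_derive_cst A u0 v).
  rewrite mulmx0 addr0 -mulmxA mulmxV// mulmx1 => D1.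
  have D2 : is_derive u0 v psi (v - v) by apply: is_deriveB.
  by rewrite (@derive_val _ _ _ _ _ _ _ D2) subrr.
have [e e0 [BO lip]] := @smooth_strict_derivative O psi u0 2^-1
  oO spsi Ou0 D0 (ltac:(by rewrite invr_gt0)).
exists e => //; split=> // [u v|U oU UB].
  rewrite !inE => Bu Bv E; have := lip u v Bu Bv.
  rewrite /psi E opprB addrC subrKA distrC.
  have [->//|uv] := eqVneq u v.
  by rewrite ler_pMl ?normr_gt0 ?subr_eq0// leNgt invf_lt1// ltr1n.
rewrite openE => _ [u Uu <-].
have /nbhs_ballP[d /= d0 Bd] := open_nbhs_nbhs (conj oU Uu).
have BdU w : `|u - w| < d -> U w by move=> uw; apply: Bd; rewrite -ball_normE.
pose r := d / 2; have r0 : 0 < r by rewrite divr_gt0.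
have rd : r < d by rewrite ltr_pdivrMr// ltr_pMr// ltr1n.
(* The map [T] below displaces the centre u by less than [r / 2] and contracts by one half, so it
   preserves the closed ball of radius r, which lies in [U] as r < d. *)
have : nbhs (phi u) [set z | `|phi u *m A - z *m A| < r / 2].
  have := @mulmx_continuous R 1 n n A (phi u).
  by move=> /cvgrPdist_lt /(_ (r / 2)); apply; rewrite divr_gt0.
apply: filterS => z /= zr.
(* Fixed points of [T] are solutions of [phi w = z]. *)
pose T w := z *m A - psi w.
have lipU v w : U v -> U w -> `|psi v - psi w| <= 2^-1 * `|v - w|.
  by move=> /UB Bv /UB Bw; exact: lip.
have idt (a b p v : 'rV[R]_n) : v - (b - p) = a - b + (p - (a - v)).
  by apply/rowP => k; rewrite !mxE; ring.
have lipT v w : U v -> U w -> `|T v - T w| <= 2^-1 * `|v - w|.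
  move=> Uv Uw; rewrite (_ : _ - _ = psi w - psi v) 1?distrC; first exact: lipU.
  by rewrite /T; apply/rowP => k; rewrite !mxE; ring.
pose C := closed_ball_ Num.norm u r.
have CU w : C w -> U w by move=> Cw; apply: BdU; exact: le_lt_trans Cw rd.
have HT : set_fun C C T.
  move=> w Cw; rewrite /C /closed_ball_ /= /T.
  rewrite (_ : u - _ = (phi u *m A - z *m A) + (psi w - psi u)); last first.
    exact: idt.
  apply: le_trans (ler_normD _ _) _; rewrite (splitr r) lerD ?(ltW zr)//.
  apply: le_trans (lipU _ _ (CU _ Cw) Uu) _.
  by rewrite mulrC distrC ler_wpM2r// invr_ge0.
pose Tf : {fun C >-> C} := HB.pack T (isFun.Build _ _ C C T HT).
pose X : completeNormedModType R := HB.pack 'rV[R]_n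
  (Uniform_isComplete.Build 'rV[R]_n (@cauchy_cvg 'rV[R]_n)).
have [|||w Cw Ew] := @banach_fixed_point R X C Tf.
- have q0 : 0 <= 2^-1 :> R by rewrite invr_ge0.
  exists (NngNum q0); split=> /=; first by rewrite invf_lt1// ltr1n.
  by move=> [v w] [/= Cv Cw]; exact: lipT (CU _ Cv) (CU _ Cw).
- exact: closed_closed_ball_.
- by exists u; rewrite /C /closed_ball_ /= subrr normr0 ltW.
exists w; first exact: CU.
have : phi w *m A = z *m A.
  have {}Ew : w = T w := Ew.
  have := congr1 (fun a => a + psi w) Ew.
  by rewrite /T subrK /psi addrC subrK.
by move/(congr1 (mulmx^~ ('J phi u0))); rewrite -!mulmxA mulVmx// !mulmx1.
Qed.

End InverseFunction.

(** * Derivatives of matrix products; constancy from vanishing derivatives *)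

Section MatrixDifferentiability.
Context {R : realType} {V : normedModType R}.

Lemma differentiable_mxP m n (M : V -> 'M[R]_(m, n)) x :
  differentiable M x <-> forall i j, differentiable (fun y => M y i j) x.
Proof.
split=> [dM i j|dM].
  exact: differentiable_comp dM (differentiable_coord _ _ _).
rewrite (_ : M = \sum_i \sum_j (fun y => M y i j *: delta_mx i j)).
  apply: differentiable_sum => i; apply: differentiable_sum => j.
  exact: differentiableZl.
apply/funext => y; rewrite fct_sumE [LHS]matrix_sum_delta.
by apply: eq_bigr => i _; rewrite fct_sumE.
Qed.

Lemma differentiable_mulmx m n p (A : V -> 'M[R]_(m, n)) (B : V -> 'M[R]_(n, p))
    x : differentiable A x -> differentiable B x ->
  differentiable (fun y => A y *m B y) x.
Proof.
move=> /differentiable_mxP dA /differentiable_mxP dB.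
apply/differentiable_mxP => i j.
rewrite (_ : (fun y => _) = \sum_k (fun y => A y i k * B y k j)).
  by apply: differentiable_sum => k; exact: differentiableM.
by apply/funext => y; rewrite mxE fct_sumE.
Qed.

Lemma derive_mulmx m n p (A : V -> 'M[R]_(m, n)) (B : V -> 'M[R]_(n, p)) x v :
  differentiable A x -> differentiable B x ->
  'D_v (fun y => A y *m B y) x = 'D_v A x *m B x + A x *m 'D_v B x.
Proof.
move=> dA dB.
have HA := derivableP (diff_derivable (v := v) dA).
have HB := derivableP (diff_derivable (v := v) dB).
exact: (@derive_val _ _ _ _ _ _ _ (is_derive_mulmx HA HB)).
Qed.

Lemma derive_cst_ball_mx m n (M : V -> 'M[R]_(m, n)) u e :
  (forall x, ball u e x -> differentiable M x) ->
  (forall x, ball u e x -> forall v, 'D_v M x = 0) ->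
  forall x, ball u e x -> M x = M u.
Proof.
move=> dM D0 x Bx; apply/matrixP => i j.
apply: (derive_cst_ball (f := fun y => M y i j) (e := e)) => // y By.
  exact: (differentiable_mxP _ _).1 (dM _ By) i j.
by move=> v; rewrite derive_entry ?D0 ?mxE//; exact: dM.
Qed.

Lemma derive_cst_mx m n (M : V -> 'M[R]_(m, n)) x y :
  (forall x, differentiable M x) -> (forall x v, 'D_v M x = 0) -> M x = M y.
Proof.
move=> dM D0; apply: (derive_cst_ball_mx (e := `|y - x| + 1)) => //.
by rewrite -ball_normE /= ltrDl.
Qed.

End MatrixDifferentiability.

(** * Matrix exponentials *)

Section MatrixExponential.
Context {R : realType} {m : nat}.
Implicit Types N : 'M[R]_m.

(** Entrywise, so that the theory of scalar power series applies. *)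
Definition expm N (t : R) : 'M[R]_m :=
  \matrix_(i, j) limn (pseries (fun k => (N ^+ k) i j / k`!%:R) t).

Let mx_bound N : R := \sum_i \sum_j `|N i j|.

(** The sum of all absolute entries is submultiplicative; the scalar exponential series thus
    dominates the series of every entry. *)
Let expmx_bound N k i j : `|(N ^+ k) i j| <= mx_bound N ^+ k.
Proof.
have c0 : 0 <= mx_bound N by do 2![apply: sumr_ge0 => ? _].
elim: k i j => [|k IH] i j.
  by rewrite !expr0 mxE; case: eqP; rewrite ?normr1 ?normr0.
rewrite !exprS mxE; apply: le_trans (ler_norm_sum _ _ _) _.
apply: (@le_trans _ _ ((\sum_l `|N i l|) * mx_bound N ^+ k)).
  by rewrite mulr_suml ler_sum// => l _; rewrite normrM ler_wpM2l.
apply: ler_wpM2r; first exact: exprn_ge0.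
rewrite /mx_bound [leRHS](bigD1 i)//= lerDl.
by do 2![apply: sumr_ge0 => ? _].
Qed.

Let is_cvg_expm N i j t :
  cvgn (pseries (fun k => (N ^+ k) i j / k`!%:R) t).
Proof.
apply: normed_cvg; rewrite /normed_series_of.
apply: (series_le_cvg _ _ _ (is_cvg_series_exp_coeff (mx_bound N * `|t|))) => k.
- exact: normr_ge0.
- by rewrite /exp_coeff /= divr_ge0// exprn_ge0// mulr_ge0//;
    do 2![apply: sumr_ge0 => ? _].
rewrite /exp_coeff /= !normrM normfV normrX (ger0_norm (ler0n _ _)) exprMn.
rewrite mulrAC ler_wpM2r ?invr_ge0//.
by rewrite ler_wpM2r ?exprn_ge0.
Qed.

(** The two outer factors serve several ends: a matrix commuting with N for [expm_comm], N itself
    for the derivative, and an initial column for the series of the potential. *)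
Lemma expm_series (p q : nat) (A : 'M[R]_(p, m)) N (B : 'M[R]_(m, q)) i j t :
  pseries (fun k => (A *m (N ^+ k) *m B) i j / k`!%:R) t @ \oo -->
    (A *m expm N t *m B) i j.
Proof.
rewrite (_ : pseries _ _ = \sum_k \sum_l (fun n => A i l * B k j *
    pseries (fun r => (N ^+ r) l k / r`!%:R) t n)); last first.
  apply/funext => n; rewrite fct_sumE /pseries /series /=.
  under eq_bigr => r _ do rewrite mxE -mulrA mulr_suml.
  rewrite exchange_big; apply: eq_bigr => k _; rewrite fct_sumE /=.
  under eq_bigr => r _ do rewrite mxE !mulr_suml.
  rewrite exchange_big; apply: eq_bigr => l _; rewrite mulr_sumr.
  by apply: eq_bigr => r _; ring.
rewrite (_ : (A *m _ *m B) i j =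
    \sum_k \sum_l A i l * B k j * expm N t l k); last first.
  rewrite mxE; apply: eq_bigr => k _; rewrite mxE mulr_suml.
  by apply: eq_bigr => l _; rewrite mulrAC.
elim/big_ind2 : _ => [|f a g b|k _]; [exact: cvg_cst|exact: cvgD|].
elim/big_ind2 : _ => [|f a g b|l _]; [exact: cvg_cst|exact: cvgD|].
by apply: cvgMr; rewrite mxE; exact: is_cvg_expm.
Qed.

Lemma expm_comm N M t : N *m M = M *m N -> expm N t *m M = M *m expm N t.
Proof.
move=> NM; apply/matrixP => i j.
have H1 := @expm_series _ _ 1%:M N M i j t; rewrite mul1mx in H1.
have H2 := @expm_series _ _ M N 1%:M i j t; rewrite mulmx1 in H2.
apply: (cvg_unique _ H1); first exact: Rhausdorff.
rewrite (_ : (fun k => _) = (fun k => (M *m N ^+ k *m 1%:M) i j / k`!%:R))//.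
apply/funext => k; congr (_ / _); rewrite mul1mx mulmx1; congr (fun_of_matrix _ i j).
have : GRing.comm M (N ^+ k) by apply: commrX; rewrite /GRing.comm.
by [].
Qed.

Lemma expm0 N : expm N 0 = 1%:M.
Proof.
apply/matrixP => i j; rewrite mxE; apply/cvg_lim => //.
apply/cvg_ballP => e e0; exists 1%N => // n /= n1.
rewrite /pseries /series /= big_ltn// big_nat big1 => [|k /andP[k0 _]].
  by rewrite expr0 mulr1 addr0 fact0 invr1 mulr1; exact: ballxx.
by rewrite expr0n eqn0Ngt k0 mulr0.
Qed.

Lemma is_derive_expm N (t : R) : is_derive t (1 : R) (expm N) (N *m expm N t).
Proof.
apply/is_derive_mxP => i j.
rewrite (_ : (fun s => _) =
    fun s => limn (pseries (fun k => (N ^+ k) i j / k`!%:R) s)); last first.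
  by apply/funext => s; rewrite mxE.
(* Termwise differentiation only inserts a further factor N, since k + 1 cancels in the
   factorial. *)
have diffs (M : 'M[R]_m) :
    pseries_diffs (fun k => (M *m N ^+ k *m 1%:M) i j / k`!%:R) =
    fun k => (M *m N *m N ^+ k *m 1%:M) i j / k`!%:R.
  apply/funext => k; rewrite /pseries_diffs !mulmx1 exprS mulmxA.
  by rewrite factS natrM invfM mulrCA mulVKf// pnatr_eq0.
have E0 : (fun k => (N ^+ k) i j / k`!%:R) =
    (fun k => (1%:M *m N ^+ k *m 1%:M) i j / k`!%:R).
  by apply/funext => k; rewrite mul1mx mulmx1.
have cv (M : 'M[R]_m) s : cvgn (pseries
    (fun k => (M *m N ^+ k *m 1%:M) i j / k`!%:R) s).
  by apply/cvg_ex; eexists; exact: expm_series.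
(* Convergence of the series and of its first two formal derivatives is required at a point beyond
   |t|; |t| + 1 serves. *)
rewrite E0; have := @pseries_snd_diffs R
  (fun k => (1%:M *m N ^+ k *m 1%:M) i j / k`!%:R) (`|t| + 1) t.
rewrite !diffs => H; apply: is_derive_eq.
  by apply: H; rewrite ?cv// [ltRHS]ger0_norm ?ltrDl// addr_ge0.
apply/cvg_lim => //; have := @expm_series _ _ (1%:M *m N) N 1%:M i j t.
by rewrite mulmx1 mul1mx.
Qed.

End MatrixExponential.

Section CommutingExponential.
Context {R : realType} {n m : nat}.
Variable N : 'I_n -> 'M[R]_m.
Hypothesis cN : forall a b, N a *m N b = N b *m N a.
Implicit Types x v : 'rV[R]_n.

Definition mx_comb x : 'M[R]_m := \sum_a x 0 a *: N a.

(** The exponential of [mx_comb x], written as a product of one-parameter exponentials so that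
    partial derivatives reduce to [is_derive_expm]. That it is this exponential, thanks to
    commutativity, is [mexp_expm]. *)
Definition mexp x : 'M[R]_m :=
  foldr (fun a M => expm (N a) (x 0 a) *m M) 1%:M (enum 'I_n).

Let differentiable_factor a x : differentiable (fun y : 'rV[R]_n => expm (N a) (y 0 a)) x.
Proof.
have de : differentiable (expm (N a)) (x 0 a).
  by apply/derivable1_diffP; case: (is_derive_expm (N a) (x 0 a)).
exact: (differentiable_comp (differentiable_coord x 0 a) de).
Qed.

Let derive_factor a x v : 'D_v (fun y : 'rV[R]_n => expm (N a) (y 0 a)) x =
  v 0 a *: (N a *m expm (N a) (x 0 a)).
Proof.
have De := is_derive_expm (N a) (x 0 a).
have de : differentiable (expm (N a)) (x 0 a).
  by apply/derivable1_diffP; case: De.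
have dc := differentiable_coord x 0 a.
rewrite (deriveE v (differentiable_factor a x)).
rewrite (diff_comp dc de) /= -(deriveE v dc).
rewrite (derive_entry v 0 a (M := id))//.
rewrite derive_id -[v 0 a in LHS]mulr1 -[_ * 1]/(v 0 a *: (1 : R)) linearZ.
by rewrite -deriveE// (@derive_val _ _ _ _ _ _ _ De).
Qed.

Let comm_factors (s : seq 'I_n) x b :
  N b *m foldr (fun a M => expm (N a) (x 0 a) *m M) 1%:M s =
  foldr (fun a M => expm (N a) (x 0 a) *m M) 1%:M s *m N b.
Proof.
elim: s => [|a s IH] /=; first by rewrite mul1mx mulmx1.
by rewrite mulmxA -(expm_comm _ (cN a b)) -!mulmxA IH.
Qed.

Let derive_factors (s : seq 'I_n) x :
  let P (y : 'rV[R]_n) := foldr (fun a M => expm (N a) (y 0 a) *m M) 1%:M s in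
  differentiable P x /\
  forall v, 'D_v P x = (\sum_(a <- s) v 0 a *: N a) *m P x.
Proof.
elim: s => [|a s [dP DP]] /=.
  split; first exact: differentiable_cst.
  by move=> v; rewrite big_nil mul0mx derive_cst.
split=> [|v]; first exact: differentiable_mulmx.
rewrite derive_mulmx// derive_factor DP big_cons mulmxDl; congr (_ + _).
  by rewrite scalemxAl -!scalemxAl mulmxA.
rewrite !mulmxA; congr (_ *m _); rewrite mulmx_suml mulmx_sumr.
apply: eq_bigr => b _; rewrite -scalemxAl -scalemxAr; congr (_ *: _).
exact: expm_comm.
Qed.

Lemma mexp_comm x b : N b *m mexp x = mexp x *m N b.
Proof. exact: comm_factors. Qed.

Lemma differentiable_mexp x : differentiable mexp x.
Proof. by have [] := derive_factors (enum 'I_n) x. Qed.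

Lemma derive_mexp x v : 'D_v mexp x = mx_comb v *m mexp x.
Proof.
have [_ ->] := derive_factors (enum 'I_n) x.
by rewrite /mx_comb big_enum.
Qed.

Lemma mx_comb_comm x b : N b *m mx_comb x = mx_comb x *m N b.
Proof.
rewrite mulmx_suml mulmx_sumr; apply: eq_bigr => a _.
by rewrite -scalemxAl -scalemxAr cN.
Qed.

Lemma mx_comb_mexp_comm x v : mx_comb v *m mexp x = mexp x *m mx_comb v.
Proof.
rewrite mulmx_suml mulmx_sumr; apply: eq_bigr => a _.
by rewrite -scalemxAl -scalemxAr mexp_comm.
Qed.

Lemma mexp0 : mexp 0 = 1%:M.
Proof.
rewrite /mexp; elim: (enum _) => //= a s ->.
by rewrite mxE expm0 mulmx1.
Qed.

Lemma mx_combZ (t : R) x : mx_comb (t *: x) = t *: mx_comb x.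
Proof.
by rewrite scaler_sumr; apply: eq_bigr => a _; rewrite mxE scalerA.
Qed.

Lemma mx_combN x : mx_comb (- x) = - mx_comb x.
Proof. by rewrite -scaleN1r mx_combZ scaleN1r. Qed.

Lemma mx_comb_delta a : mx_comb (delta_mx 0 a) = N a.
Proof.
rewrite /mx_comb (bigD1 a)//= big1 => [|b /negbTE ba].
  by rewrite mxE !eqxx scale1r addr0.
by rewrite mxE ba andbF scale0r.
Qed.

Section Composition.
Context {V : normedModType R}.
Variables (g : V -> 'rV[R]_n).

Lemma differentiable_mexp_comp (x : V) : differentiable g x ->
  differentiable (fun y => mexp (g y)) x.
Proof. by move=> dg; exact: differentiable_comp (differentiable_mexp _). Qed.

Lemma derive_mexp_comp (x v : V) : differentiable g x ->
  'D_v (fun y => mexp (g y)) x = mx_comb ('D_v g x) *m mexp (g x).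
Proof.
move=> dg; rewrite deriveE; last exact: differentiable_mexp_comp.
rewrite (diff_comp dg (differentiable_mexp _)) /= -(deriveE v dg).
by rewrite -(deriveE _ (differentiable_mexp _)) derive_mexp.
Qed.

End Composition.

(** The product has zero derivative, as the contributions of the two factors cancel, and it is the
    identity at 0. *)
Lemma mexpN x : mexp x *m mexp (- x) = 1%:M.
Proof.
have dN y : differentiable (fun y : 'rV[R]_n => - y) y by apply: differentiableN.
have D y : differentiable (fun y => mexp y *m mexp (- y)) y.
  apply: differentiable_mulmx (differentiable_mexp _) _.
  exact: differentiable_mexp_comp.
rewrite (derive_cst_mx (M := fun y => mexp y *m mexp (- y)) x 0)//.
  by rewrite oppr0 mexp0 mulmx1.
move=> y v; rewrite derive_mulmx; last exact: differentiable_mexp_comp.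
  rewrite derive_mexp derive_mexp_comp//.
  rewrite deriveN// derive_id mx_combN mulNmx mulmxN mulmxA.
  by rewrite -mx_comb_mexp_comm subrr.
exact: differentiable_mexp.
Qed.

(** Along the ray through x both sides solve the same linear equation:
    [expm (mx_comb x) t *m mexp (t *: - x)] has zero derivative in t. *)
Lemma mexp_expm x : mexp x = expm (mx_comb x) 1.
Proof.
have dl t : differentiable (fun t : R => t *: - x) t by apply: differentiableZl.
have de t : differentiable (expm (mx_comb x)) t.
  by apply/derivable1_diffP; case: (is_derive_expm (mx_comb x) t).
suff : expm (mx_comb x) 1 *m mexp (- x) = 1%:M.
  move/(congr1 (fun M => M *m mexp x)); rewrite -mulmxA mul1mx.
  by have := mexpN (- x); rewrite opprK => ->; rewrite mulmx1.
rewrite -[- x]scale1r.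
rewrite (derive_cst_mx (M := fun t => expm (mx_comb x) t *m mexp (t *: - x)) _ 0).
- by rewrite scale0r expm0 mexp0 mulmx1.
- by move=> t; apply: differentiable_mulmx => //; exact: differentiable_mexp_comp.
move=> t v; rewrite derive_mulmx//; last exact: differentiable_mexp_comp.
have -> : v = v *: (1 : R) by rewrite /GRing.scale /= mulr1.
rewrite !derive_scale//; last exact: differentiable_mexp_comp.
rewrite derive_mexp_comp// (@derive_val _ _ _ _ _ _ _ (is_derive_expm _ _)).
have -> : 'D_(1 : R) (fun t : R => t *: - x) t = - x.
  by rewrite deriveE// diff_val scale1r.
rewrite mx_combN mulNmx -scalemxAl -scalemxAr mulmxN.
rewrite -scalerDr mulmxA expm_comm ?subrr ?scaler0//.
Qed.

Lemma smooth_mexp : smooth_on setT mexp.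
Proof.
(* The constant left factor closes the induction: differentiation along v only replaces A by
   [A *m mx_comb v]. *)
move=> k; suff H (A : 'M[R]_m) : Ck_on k setT (fun x => A *m mexp x).
  by have := H 1%:M; under eq_fun do rewrite mul1mx.
elim: k A => [|k IH] A.
  move=> x _; apply: differentiable_continuous.
  by apply: differentiable_mulmx (differentiable_mexp x); exact: differentiable_cst.
split=> [x _|v].
  by apply: differentiable_mulmx (differentiable_mexp x); exact: differentiable_cst.
rewrite (_ : 'D_v _ = fun x => (A *m mx_comb v) *m mexp x)//.
apply/funext => x; rewrite derive_mulmx//; last exact: differentiable_mexp.
by rewrite derive_cst mul0mx add0r derive_mexp mulmxA.
Qed.

Lemma mexp_series p q (A : 'M[R]_(p, m)) (B : 'M[R]_(m, q)) x i j :
  series (fun k => (A *m mx_comb x ^+ k *m B) i j / k`!%:R) @ \oo -->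
    (A *m mexp x *m B) i j.
Proof.
rewrite mexp_expm; have := @expm_series R m p q A (mx_comb x) B i j 1.
by rewrite /pseries; under eq_fun do rewrite expr1n mulr1.
Qed.

End CommutingExponential.

Section BlockDerivatives.
Context {R : realType} {V : normedModType R}.

Lemma differentiable_col_mx m1 m2 n (A : V -> 'M[R]_(m1, n))
    (B : V -> 'M[R]_(m2, n)) x :
  differentiable A x -> differentiable B x ->
  differentiable (fun y => col_mx (A y) (B y)) x.
Proof.
move=> /differentiable_mxP dA /differentiable_mxP dB.
apply/differentiable_mxP => i j; under eq_fun do rewrite mxE.
by case: (fintype.split i) => k.
Qed.

Lemma derive_col_mx m1 m2 n (A : V -> 'M[R]_(m1, n))
    (B : V -> 'M[R]_(m2, n)) x v :
  differentiable A x -> differentiable B x ->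
  'D_v (fun y => col_mx (A y) (B y)) x = col_mx ('D_v A x) ('D_v B x).
Proof.
move=> dA dB; apply/matrixP => i j.
rewrite -derive_entry; last exact: differentiable_col_mx.
under eq_fun do rewrite mxE.
by rewrite mxE; case: (fintype.split i) => k; rewrite derive_entry.
Qed.

Lemma derive_linear_mx m n p q (L : {linear 'M[R]_(m, n) -> 'M[R]_(p, q)})
    (A : V -> 'M[R]_(m, n)) x v :
  continuous L -> differentiable A x ->
  differentiable (fun y => L (A y)) x /\
  'D_v (fun y => L (A y)) x = L ('D_v A x).
Proof.
move=> cL dA; have dL : differentiable L (A x) by exact: linear_differentiable.
have dLA : differentiable (L \o A) x by exact: differentiable_comp.
split=> //; rewrite -[fun y => _]/(L \o A) deriveE// (diff_comp dA dL)/=.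
by rewrite diff_lin// deriveE.
Qed.

End BlockDerivatives.

(** * The Hessian system of a metrised associative algebra *)

Section FlatData.
Context {R : realType} {n : nat}.
Variables (C : 'I_n -> 'M[R]_n) (gam : 'M[R]_n).

(* [C a b c] are the structure coefficients of a commutative, associative
   algebra and [gam] is the Gram matrix of an invariant form. *)
Definition flat_data : Prop :=
  [/\ forall a b, C a *m C b = C b *m C a,
      forall a b c, C a b c = C b a c,
      gam^T = gam &
      forall a, C a *m gam = gam *m (C a)^T].

(** The Hessian of a solution at a point where its gradient is w; thus [gam] is its value for
    gradient zero. *)
Definition hess_at (w : 'cV[R]_n) : 'M[R]_n :=
  \matrix_(a, b) (gam a b - 2 * (C a *m w) b 0).

(** The bilinear form (a, b) |-> w(ab), where w is read as a covector and ab is the product of the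
    algebra. *)
Definition alg_contract (w : 'cV[R]_n) : 'M[R]_n :=
  \matrix_(a, b) (C a *m w) b 0.

(* Coefficients of the linear system satisfied by the column
   (F, dF, 1) of a function F with Hessian [hess_at dF]. *)
Definition aug (v : 'rV[R]_n) : 'M[R]_(1 + (n + 1)) :=
  block_mx 0 (row_mx v 0)
           0 (block_mx (-2 *: mx_comb C v) (gam *m v^T) 0 0).

Definition augN (a : 'I_n) := aug (delta_mx 0 a).

Lemma mx_comb_linear : linear (mx_comb C).
Proof.
move=> t u v; rewrite scaler_sumr -big_split; apply: eq_bigr => a _ /=.
by rewrite !mxE scalerDl scalerA.
Qed.

Lemma aug_linear : linear aug.
Proof.
move=> t u v; rewrite /aug mx_comb_linear.
rewrite scale_block_mx add_block_mx !scaler0 !addr0 scale_row_mx add_row_mx.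
rewrite scaler0 addr0 scale_block_mx add_block_mx !scaler0 !addr0.
have -> : (t *: u + v)^T = t *: u^T + v^T by rewrite linearP.
by rewrite mulmxDr -scalemxAr scalerDr !scalerA (mulrC t).
Qed.

Lemma mx_comb_aug v : mx_comb augN v = aug v.
Proof.
pose L : {linear 'rV[R]_n -> 'M[R]_(1 + (n + 1))} :=
  HB.pack aug (GRing.isLinear.Build _ _ _ _ _ aug_linear).
rewrite -[aug v]/(L v) {2}(row_sum_delta v) linear_sum.
by apply: eq_bigr => a _; rewrite linearZ.
Qed.

Lemma aug_col v (f : 'M[R]_1) (w : 'cV[R]_n) (t : 'M[R]_1) :
  aug v *m col_mx f (col_mx w t) =
  col_mx (v *m w)
    (col_mx (-2 *: mx_comb C v *m w + gam *m v^T *m t) 0).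
Proof.
by rewrite mul_block_col mul_row_col mul_block_col !mul0mx !addr0 !add0r.
Qed.

(** [v *m mx_comb C u] is the product of u and v in coordinates, so this is commutativity. *)
Lemma mul_rV_mx_comb_sym u v : (forall a b c, C a b c = C b a c) ->
  u *m mx_comb C v = v *m mx_comb C u.
Proof.
move=> sC; apply/rowP => k; rewrite !mxE.
have E (x y : 'rV[R]_n) : \sum_j x 0 j * mx_comb C y j k =
    \sum_j \sum_i x 0 j * (y 0 i * C i j k).
  apply: eq_bigr => j _; rewrite summxE mulr_sumr.
  by apply: eq_bigr => i _; rewrite mxE.
rewrite !E exchange_big; apply: eq_bigr => i _; apply: eq_bigr => j _.
by rewrite mulrCA sC.
Qed.

Hypothesis Cg : flat_data.

Let cC a b : C a *m C b = C b *m C a. Proof. by case: Cg => /(_ a b). Qed.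
Let sC a b c : C a b c = C b a c. Proof. by case: Cg => _ /(_ a b c). Qed.
Let sg : gam^T = gam. Proof. by case: Cg. Qed.
Let Cgam a : C a *m gam = gam *m (C a)^T. Proof. by case: Cg => _ _ _. Qed.

Lemma mul_rV_mx_comb u v : u *m mx_comb C v = v *m mx_comb C u.
Proof. exact: mul_rV_mx_comb_sym. Qed.

Lemma mx_comb_gam v : mx_comb C v *m gam = gam *m (mx_comb C v)^T.
Proof.
rewrite linear_sum mulmx_suml mulmx_sumr; apply: eq_bigr => a _.
by rewrite linearZ /= -scalemxAl -scalemxAr Cgam.
Qed.

Lemma mx_combC u v : mx_comb C u *m mx_comb C v = mx_comb C v *m mx_comb C u.
Proof.
rewrite {1 4}/mx_comb mulmx_suml mulmx_sumr; apply: eq_bigr => a _.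
by rewrite -scalemxAl -scalemxAr mx_comb_comm.
Qed.

(** The integrability condition of the linear system. Its four blocks are symmetric in u and v by
    commutativity of the product, symmetry of [gam], commutation of the multiplications, and
    self-adjointness together with commutativity. *)
Lemma aug_comm u v : aug u *m aug v = aug v *m aug u.
Proof.
suff H x y : aug x *m aug y = block_mx 0 (row_mx (-2 *: (x *m mx_comb C y))
    (x *m gam *m y^T)) 0 (block_mx (4 *: (mx_comb C x *m mx_comb C y))
    (-2 *: (gam *m (y *m mx_comb C x)^T)) 0 0).
  rewrite !H mul_rV_mx_comb mx_combC (mul_rV_mx_comb v u).
  have -> : u *m gam *m v^T = v *m gam *m u^T => //.
  transitivity ((v *m gam *m u^T)^T).
    by rewrite !trmx_mul trmxK sg mulmxA.
  by apply/matrixP => i j; rewrite mxE !ord1.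
rewrite /aug mulmx_block mul_row_block mulmx_block.
rewrite !(mulmx0, mul0mx, addr0, add0r, row_mx0, block_mx0) mulmxA.
rewrite -scalemxAr -!scalemxAl -scalemxAr scalerA mulmxA mx_comb_gam.
have -> : -2 * -2 = 4 :> R by ring.
by rewrite trmx_mul mulmxA.
Qed.

Lemma augN_comm a b : augN a *m augN b = augN b *m augN a.
Proof. exact: aug_comm. Qed.

(** Associativity: multiplication by the product of two basis vectors is the composite of their
    multiplications. It follows from commuting multiplications and a commutative product. *)
Lemma struct_mul a b : \sum_d C a b d *: C d = C a *m C b.
Proof.
apply/matrixP => c e; rewrite summxE.
transitivity ((C b *m C c) a e).
  by rewrite mxE; apply: eq_bigr => d _; rewrite mxE sC (sC d).
rewrite cC !mxE; apply: eq_bigr => d _.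
by rewrite (sC c a d).
Qed.

(** The entry is the e-th coordinate of the product of the basis vectors c, a and b, which is
    symmetric in the three. *)
Lemma struct_rot a b c e : (C a *m C b) c e = (C c *m C a) b e.
Proof.
have swap x y i j : (C x *m C y) i j = (C i *m C y) x j.
  by rewrite mxE [RHS]mxE; apply: eq_bigr => d _; rewrite sC.
by rewrite swap -cC swap cC swap.
Qed.

Lemma hess_atE w : hess_at w = gam - 2 *: alg_contract w.
Proof. by apply/matrixP => b c; rewrite !mxE. Qed.

Let alg_contract_sym w : (alg_contract w)^T = alg_contract w.
Proof.
apply/matrixP => b c; rewrite !mxE.
by apply: eq_bigr => d _; rewrite sC.
Qed.

Lemma hess_at_sym w : (hess_at w)^T = hess_at w.
Proof. by rewrite hess_atE linearB linearZ /= alg_contract_sym sg. Qed.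

(** Invariance survives a change of gradient because w(abc) does not depend on the order or
    bracketing of the factors. *)
Lemma mul_C_hess_at a w : C a *m hess_at w = hess_at w *m (C a)^T.
Proof.
suff E : C a *m alg_contract w = alg_contract w *m (C a)^T.
  by rewrite hess_atE mulmxBr mulmxBl Cgam -scalemxAr -scalemxAl E.
have E1 b c : (C a *m alg_contract w) b c = (C a *m C b *m w) c 0.
  rewrite -struct_mul mulmx_suml summxE mxE; apply: eq_bigr => d _.
  by rewrite -scalemxAl !mxE.
apply/matrixP => b c; rewrite E1 -[in RHS]alg_contract_sym -trmx_mul [RHS]mxE E1 [LHS]mxE [RHS]mxE.
apply: eq_bigr => e _; congr (_ * _).
by rewrite (cC a c) (struct_rot c a b) (struct_rot b c a).
Qed.

(** This turns the equation 'the derivative of dF along v is F'' v' into one that is affine in dF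
    with constant coefficients. *)
Lemma hess_at_mul w (v : 'rV[R]_n) :
  hess_at w *m v^T = gam *m v^T - 2 *: (mx_comb C v *m w).
Proof.
rewrite hess_atE mulmxBl -scalemxAl; congr (_ - 2 *: _).
apply/colP => b; rewrite -alg_contract_sym mulmx_suml summxE mxE.
by apply: eq_bigr => a _; rewrite -scalemxAl !mxE mulrC.
Qed.

Lemma mul_C_hess_at_rot a b c w :
  (C a *m hess_at w) b c = (C b *m hess_at w) a c.
Proof. by rewrite mxE [RHS]mxE; apply: eq_bigr => d _; rewrite sC. Qed.

Lemma alg_contract_linear : linear alg_contract.
Proof.
move=> t u v; apply/matrixP => b c.
have E w : alg_contract w b c = (C b *m w) c 0 by rewrite mxE.
rewrite E mulmxDr -scalemxAr [LHS]mxE [X in X + _]mxE.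
by rewrite [RHS]mxE [X in _ = X + _]mxE !E.
Qed.

(** For the covector H v the contracted form is H(v, ab) = H(va, b), by invariance. Consequently, if
    the gradient has derivative H v, the form [hess_at] of the gradient has derivative -2 C_v H. *)
Lemma alg_contract_hess w v : alg_contract (hess_at w *m v^T) = mx_comb C v *m hess_at w.
Proof.
apply/matrixP => a b; rewrite mxE mulmxA [LHS]mxE mulmx_suml summxE.
apply: eq_bigr => c _; rewrite -scalemxAl [v^T _ _]mxE [RHS]mxE mulrC.
congr (_ * _); rewrite -[in RHS]mul_C_hess_at_rot [in LHS]mul_C_hess_at.
by rewrite -{1}hess_at_sym -trmx_mul mxE.
Qed.

Lemma derive_alg_contract (V : normedModType R) (W : V -> 'cV[R]_n) x v :
  differentiable W x ->
  differentiable (fun u => alg_contract (W u)) x /\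
  'D_v (fun u => alg_contract (W u)) x = alg_contract ('D_v W x).
Proof.
move=> dW; pose L : {linear 'cV[R]_n -> 'M[R]_n} :=
  HB.pack alg_contract (GRing.isLinear.Build _ _ _ _ _ alg_contract_linear).
apply: (@derive_linear_mx _ _ _ _ _ _ L W x v) => // w.
apply: differentiable_continuous; apply/differentiable_mxP => a b.
rewrite /= /alg_contract; under eq_fun do rewrite mxE.
apply: (differentiable_mxP _ _).1.
by apply: differentiable_mulmx => //; exact: differentiable_cst.
Qed.

Lemma derive_hess_at (V : normedModType R) (W : V -> 'cV[R]_n) x v y :
  differentiable W x -> 'D_v W x = hess_at (W x) *m y^T ->
  differentiable (fun u => hess_at (W u)) x /\
  'D_v (fun u => hess_at (W u)) x = -2 *: (mx_comb C y *m hess_at (W x)).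
Proof.
move=> dW DW; have [dLW DLW] := derive_alg_contract v dW.
rewrite (_ : (fun u => hess_at _) = cst gam + (-2) \*: (fun u => alg_contract (W u))).
  split; first by apply: differentiableD; [exact: differentiable_cst|exact: differentiableZ].
  rewrite deriveD; [|exact: derivable_cst|exact/diff_derivable/differentiableZ].
  rewrite derive_cst add0r deriveZ; last exact: diff_derivable.
  by rewrite DLW DW /= alg_contract_hess.
by apply/funext => u; rewrite hess_atE -scaleNr.
Qed.

Lemma hess_atD u w : hess_at (u + w) = hess_at u - 2 *: alg_contract w.
Proof.
rewrite !hess_atE -addrA -opprD -scalerDr -[u in LHS]scale1r.
by rewrite alg_contract_linear scale1r.
Qed.

End FlatData.

Section Rebase.
Context {R : realType} {n : nat}.
Variables (C : 'I_n -> 'M[R]_n) (gam : 'M[R]_n).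

(** Moves the origin of the gradient. With the opposite of the actual gradient it recovers [gam]
    from a Hessian at an arbitrary point. *)
Lemma flat_data_hess_at w : flat_data C gam -> flat_data C (hess_at C gam w).
Proof.
move=> Cg; have [cC sC _ _] := Cg.
by split=> // [|a]; [exact: hess_at_sym|exact: mul_C_hess_at].
Qed.

Lemma hess_at0 : hess_at C gam 0 = gam.
Proof.
rewrite hess_atE (_ : alg_contract C 0 = 0) ?scaler0 ?subr0//.
by apply/matrixP => a b; rewrite mxE mulmx0 mxE [RHS]mxE.
Qed.

Lemma hess_at_hess_at u w :
  hess_at C (hess_at C gam u) w = hess_at C gam (u + w).
Proof. by rewrite hess_atD// hess_atE. Qed.

End Rebase.

Section Solutions.
Context {R : realType} {n : nat}.
Variables (C : 'I_n -> 'M[R]_n) (gam : 'M[R]_n).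
Hypothesis Cg : flat_data C gam.
Variables (f0 : R) (w0 : 'cV[R]_n).

(** The solution of the linear system with value [f0] and gradient [w0] at 0. *)
Definition sol_col (x : 'rV[R]_n) : 'cV[R]_(1 + (n + 1)) :=
  mexp (augN C gam) x *m col_mx f0%:M (col_mx w0 1%:M).

Definition sol (x : 'rV[R]_n) : R := usubmx (sol_col x) 0 0.

Definition sol_grad (x : 'rV[R]_n) : 'cV[R]_n := usubmx (dsubmx (sol_col x)).

Let cN := augN_comm Cg.

Let smooth_sol_col : smooth_on setT sol_col.
Proof.
apply: smooth_mulmx; [exact: openT|exact: smooth_mexp|exact: smooth_cst].
Qed.

Let derive_sol_col x v : 'D_v sol_col x = aug C gam v *m sol_col x.
Proof.
rewrite derive_mulmx; [|exact: differentiable_mexp|exact: differentiable_cst].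
by rewrite derive_cst mulmx0 addr0 derive_mexp// mx_comb_aug mulmxA.
Qed.

Let differentiable_sol_col x : differentiable sol_col x.
Proof. exact: smooth_differentiable smooth_sol_col _. Qed.

Let sol_col0 : sol_col 0 = col_mx f0%:M (col_mx w0 1%:M).
Proof. by rewrite /sol_col mexp0 mul1mx. Qed.

Lemma sol_grad0 : sol_grad 0 = w0.
Proof. by rewrite /sol_grad sol_col0 col_mxKd col_mxKu. Qed.

Lemma smooth_sol : smooth_on setT sol.
Proof.
rewrite /sol; under eq_fun do rewrite mxE.
exact: (smooth_mxP openT _).1.
Qed.

Lemma smooth_sol_grad : smooth_on setT sol_grad.
Proof.
apply/(smooth_mxP openT) => i j; rewrite /sol_grad.
under eq_fun do rewrite mxE mxE.
exact: (smooth_mxP openT _).1.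
Qed.

(** The last row of [aug v] is zero, so the last entry of the column keeps its initial value 1. *)
Lemma sol_colE x : sol_col x = col_mx (sol x)%:M (col_mx (sol_grad x) 1%:M).
Proof.
rewrite -[LHS]vsubmxK -[dsubmx (sol_col x)]vsubmxK; congr col_mx.
  by apply/matrixP => i j; rewrite !ord1 [RHS]mxE.
congr col_mx; have dD y : differentiable (fun y => dsubmx (dsubmx (sol_col y))) y.
  apply/differentiable_mxP => i j; under eq_fun do rewrite mxE mxE.
  exact: (differentiable_mxP _ _).1.
rewrite (derive_cst_mx (M := fun y => dsubmx (dsubmx (sol_col y))) x 0)//.
  by rewrite sol_col0 !col_mxKd.
move=> y v; apply/matrixP => i j; rewrite -derive_entry//.
under eq_fun do rewrite mxE mxE.
rewrite derive_entry// derive_sol_col -[sol_col y]vsubmxK.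
rewrite -[dsubmx (sol_col y)]vsubmxK aug_col.
by rewrite (col_mxEd (v *m _)) col_mxEd [LHS]mxE [RHS]mxE.
Qed.

Lemma derive_sol x v : 'D_v sol x = (v *m sol_grad x) 0 0.
Proof.
rewrite (_ : sol = fun y => sol_col y (lshift _ 0) 0); last first.
  by apply/funext => y; rewrite /sol mxE.
rewrite derive_entry// derive_sol_col sol_colE aug_col.
by rewrite (col_mxEu (v *m sol_grad x)).
Qed.

Lemma derive_sol_grad x v :
  'D_v sol_grad x = hess_at C gam (sol_grad x) *m v^T.
Proof.
have dg y : differentiable sol_grad y by exact: smooth_differentiable smooth_sol_grad _.
apply/matrixP => i j; rewrite -derive_entry//.
rewrite /sol_grad; under eq_fun do rewrite mxE mxE.
rewrite derive_entry// derive_sol_col sol_colE aug_col.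
rewrite (col_mxEd (v *m sol_grad x)) col_mxEu hess_at_mul//.
by rewrite mulmx1 addrC -scalemxAl scaleNr col_mxKd col_mxKu.
Qed.

Lemma derive_sol_hess x v :
  differentiable (fun y => hess_at C gam (sol_grad y)) x /\
  'D_v (fun y => hess_at C gam (sol_grad y)) x =
    -2 *: (mx_comb C v *m hess_at C gam (sol_grad x)).
Proof.
apply: derive_hess_at => //; last exact: derive_sol_grad.
exact: smooth_differentiable smooth_sol_grad _.
Qed.

Lemma pd_sol x i : pd i sol x = sol_grad x i 0.
Proof. by rewrite /pd derive_sol -rowE mxE. Qed.

Lemma hessian_sol x : hessian sol x = hess_at C gam (sol_grad x).
Proof.
apply/matrixP => i j; rewrite mxE.
rewrite (_ : pd j sol = fun y => sol_grad y j 0); last first.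
  by apply/funext => y; rewrite pd_sol.
rewrite /pd derive_entry; last exact: smooth_differentiable smooth_sol_grad _.
by rewrite derive_sol_grad trmx_delta -colE mxE -[in RHS]hess_at_sym// [RHS]mxE.
Qed.

End Solutions.

(** * Jacobi's formula; uniqueness and rigidity of solutions *)

Section Jacobi.
Context {R : realType} {V : normedModType R}.

Lemma differentiable_prod n (f : 'I_n -> V -> R) x :
  (forall i, differentiable (f i) x) ->
  differentiable (fun y => \prod_i f i y) x.
Proof.
move=> df; elim: n f df => [|n IH] f df.
  by under eq_fun do rewrite big_ord0; exact: differentiable_cst.
under eq_fun do rewrite big_ord_recl.
by apply: differentiableM => //; apply: IH => i.
Qed.

Lemma derive_prod n (f : 'I_n -> V -> R) x v :
  (forall i, differentiable (f i) x) ->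
  'D_v (fun y => \prod_i f i y) x =
  \sum_i 'D_v (f i) x * \prod_(j | j != i) f j x.
Proof.
elim: n f => [|n IH] f df.
  by under eq_fun do rewrite big_ord0; rewrite derive_cst big_ord0.
under eq_fun do rewrite big_ord_recl.
have dP : differentiable (fun y => \prod_i f (lift ord0 i) y) x.
  exact: differentiable_prod.
rewrite (deriveM (diff_derivable (df ord0)) (diff_derivable dP)).
rewrite IH// big_ord_recl addrC; congr (_ + _).
  rewrite [_ *: _]mulrC; congr (_ * _).
  by rewrite [RHS]big_mkcond big_ord_recl /= mul1r.
rewrite [_ *: _]mulr_sumr; apply: eq_bigr => i _; rewrite mulrCA.
congr (_ * _); rewrite [RHS]big_mkcond big_ord_recl/=; congr (_ * _).
rewrite [LHS]big_mkcond; apply: eq_bigr => j _.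
by rewrite (inj_eq lift_inj).
Qed.

(** In the Leibniz expansion, differentiation of row i replaces it by row i of [A *m M x]. Expanding
    that determinant along row i gives the i-th diagonal entry of [A *m M x *m \adj (M x)], that is,
    [A i i * \det (M x)]. *)
Lemma derive_det n (M : V -> 'M[R]_n) (A : 'M[R]_n) x v :
  differentiable M x -> 'D_v M x = A *m M x ->
  differentiable (fun y => \det (M y)) x /\
  'D_v (fun y => \det (M y)) x = \tr A * \det (M x).
Proof.
move=> dM DM; have dij i j : differentiable (fun y => M y i j) x.
  exact: (differentiable_mxP _ _).1.
have dP (s : 'S_n) : differentiable (fun y => \prod_i M y i (s i)) x.
  exact: (@differentiable_prod _ (fun i y => M y i (s i))).
pose g (s : 'S_n) : V -> R := (-1) ^+ s \*: (fun y => \prod_i M y i (s i)).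
have dg s : differentiable (g s) x by exact: differentiableZ.
have -> : (fun y => \det (M y)) = \sum_(s : 'S_n) g s.
  by apply/funext => y; rewrite fct_sumE.
split.
  by elim/big_ind : _ => [|f h df dh|s _]; [exact: differentiable_cst|exact: differentiableD|exact: dg].
have -> : 'D_v (\sum_(s : 'S_n) g s) x = \sum_(s : 'S_n) 'D_v (g s) x.
  suff [] : differentiable (\sum_(s : 'S_n) g s) x /\
    'D_v (\sum_(s : 'S_n) g s) x = \sum_(s : 'S_n) 'D_v (g s) x by [].
  elim/big_rec2 : _ => [|s y h _ [dh <-]].
    by split; [exact: differentiable_cst|rewrite derive_cst].
  split; first exact: differentiableD.
  by rewrite deriveD//; exact: diff_derivable.
pose N i : 'M[R]_n := \matrix_(k, l) if k == i then (A *m M x) k l else M x k l.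
transitivity (\sum_i \det (N i)).
  rewrite [RHS]exchange_big /=; apply: eq_bigr => s _.
  rewrite deriveZ; last exact: diff_derivable.
  rewrite (@derive_prod _ (fun i y => M y i (s i)))// [LHS]mulr_sumr.
  apply: eq_bigr => i _; congr (_ * _); rewrite [RHS](bigD1 i)//= mxE eqxx.
  rewrite derive_entry// DM; congr (_ * _).
  by apply: eq_bigr => j /negbTE ji; rewrite mxE ji.
rewrite /mxtrace mulr_suml; apply: eq_bigr => i _.
rewrite (expand_det_row _ i).
transitivity ((A *m M x *m \adj (M x)) i i).
  rewrite [RHS]mxE; apply: eq_bigr => j _; rewrite mxE eqxx; congr (_ * _).
  rewrite [RHS]mxE /cofactor; congr (_ * \det _).
  by apply/matrixP => k l; rewrite !mxE eq_sym (negbTE (neq_lift _ _)).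
by rewrite -mulmxA mul_mx_adj mul_mx_scalar mxE mulrC.
Qed.

End Jacobi.

Section SolutionUniqueness.
Context {R : realType} {n : nat}.
Variables (C : 'I_n -> 'M[R]_n) (gam : 'M[R]_n).
Hypothesis Cg : flat_data C gam.

(** The column (F, W, 1) multiplied by [mexp] of the opposite displacement of [phi] has zero
    derivative. Since F and W are functions of an arbitrary parameter and [phi] gives the affine
    position, the lemma applies directly in a chart. *)
Lemma sol_unique (V : normedModType R) (phi : V -> 'rV[R]_n) (F : V -> R)
    (W : V -> 'cV[R]_n) u0 e :
  (forall u, ball u0 e u ->
    [/\ differentiable phi u, differentiable F u & differentiable W u]) ->
  (forall u, ball u0 e u -> forall v, 'D_v F u = ('D_v phi u *m W u) 0 0) ->
  (forall u, ball u0 e u -> forall v,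
    'D_v W u = hess_at C gam (W u) *m ('D_v phi u)^T) ->
  forall u, ball u0 e u ->
    F u = sol C gam (F u0) (W u0) (phi u - phi u0) /\
    W u = sol_grad C gam (F u0) (W u0) (phi u - phi u0).
Proof.
move=> dd DF DW u Bu; have cN := augN_comm Cg.
pose Z u := col_mx (F u)%:M (col_mx (W u) 1%:M) : 'cV[R]_(1 + (n + 1)).
pose psi u := - (phi u - phi u0).
have dF1 y : ball u0 e y -> differentiable (fun y => (F y)%:M : 'M[R]_1) y.
  move=> By; apply/differentiable_mxP => i j; rewrite !ord1.
  by under eq_fun do rewrite mxE eqxx mulr1n; case: (dd _ By).
have dW1 y : ball u0 e y -> differentiable (fun y => col_mx (W y) 1%:M) y.
  move=> By; apply: differentiable_col_mx; first by case: (dd _ By).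
  exact: differentiable_cst.
have dZ y : ball u0 e y -> differentiable Z y.
  by move=> By; apply: differentiable_col_mx; [exact: dF1|exact: dW1].
have DZ y v : ball u0 e y -> 'D_v Z y = aug C gam ('D_v phi y) *m Z y.
  move=> By; rewrite /Z derive_col_mx; [|exact: dF1|exact: dW1].
  rewrite derive_col_mx; [|by case: (dd _ By)|exact: differentiable_cst].
  rewrite derive_cst aug_col; congr (col_mx _ (col_mx _ _)).
    apply/matrixP => i j; rewrite !ord1 -derive_entry; last exact: dF1.
    by under eq_fun do rewrite mxE eqxx mulr1n; rewrite DF.
  by rewrite DW// hess_at_mul// mulmx1 addrC -scalemxAl scaleNr.
have dpsi y : ball u0 e y -> differentiable psi y.
  move=> By; apply: differentiableN; apply: differentiableB => //.
  by case: (dd _ By).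
have Dpsi y v : ball u0 e y -> 'D_v psi y = - 'D_v phi y.
  move=> By; have [dphi _ _] := dd _ By; have dvphi := diff_derivable (v := v) dphi.
  have Hpsi : is_derive y v psi (- ('D_v phi y - 0)).
    by apply: is_deriveN; apply: is_deriveB; exact: derivableP.
  by rewrite (@derive_val _ _ _ _ _ _ _ Hpsi) subr0.
have dM y : ball u0 e y -> differentiable (fun u => mexp (augN C gam) (psi u)) y.
  by move=> By; apply: differentiable_mexp_comp => //; exact: dpsi.
have H : mexp (augN C gam) (psi u) *m Z u = Z u0.
  rewrite (derive_cst_ball_mx (M := fun u => mexp (augN C gam) (psi u) *m Z u)
    (u := u0) (e := e))//.
  - by rewrite /psi subrr oppr0 mexp0 mul1mx.
  - by move=> y By; apply: differentiable_mulmx; [exact: dM|exact: dZ].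
  move=> y By v; rewrite derive_mulmx; [|exact: dM|exact: dZ].
  rewrite derive_mexp_comp//; last exact: dpsi.
  rewrite Dpsi// DZ// mx_combN mulNmx mx_comb_mexp_comm// mx_comb_aug.
  by rewrite mulmxA mulNmx addrC subrr.
have {}H : Z u = sol_col C gam (F u0) (W u0) (phi u - phi u0).
  rewrite /sol_col -/(Z u0) -H mulmxA -[phi u - phi u0]opprK -/(psi u).
  by have := mexpN cN (- psi u); rewrite opprK => ->; rewrite mul1mx.
by rewrite /sol /sol_grad -H !col_mxKd !col_mxKu mxE eqxx mulr1n.
Qed.

End SolutionUniqueness.

Section SolutionHessian.
Context {R : realType} {n : nat}.
Variables (C : 'I_n -> 'M[R]_n) (gam : 'M[R]_n).
Hypothesis Cg : flat_data C gam.
Variables (f0 : R) (w0 : 'cV[R]_n).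

Local Notation G := (sol C gam f0 w0).
Local Notation dG := (sol_grad C gam f0 w0).
Local Notation H := (fun x => hess_at C gam (dG x)).

Lemma differentiable_sol x : differentiable G x.
Proof. exact: smooth_differentiable (smooth_sol Cg f0 w0) _. Qed.

Lemma differentiable_sol_grad x : differentiable dG x.
Proof. exact: smooth_differentiable (smooth_sol_grad Cg f0 w0) _. Qed.

Lemma sol_rebase x1 x : G x = sol C gam (G x1) (dG x1) (x - x1).
Proof.
have [||||//] := @sol_unique _ _ _ _ Cg _ id G dG x1 (`|x1 - x| + 1) _ _ _ x.
- by move=> u _; split=> //; [exact: differentiable_sol|exact: differentiable_sol_grad].
- by move=> u _ v; rewrite derive_sol// derive_id.
- by move=> u _ v; rewrite derive_sol_grad// derive_id.
by rewrite -ball_normE /= ltrDl.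
Qed.

(** A translate of a solution solves the same system from another initial value; statements about
    solutions centred at [x0] thus reduce to [x0 = 0]. *)
Lemma sol_shift x0 : exists f1 w1,
  (forall x, G (x - x0) = sol C gam f1 w1 x) /\ (forall x, dG (x - x0) = sol_grad C gam f1 w1 x).
Proof.
exists (G (- x0)), (dG (- x0)).
have dshift (x : 'rV[R]_n) : is_diff x (fun y : 'rV[R]_n => y - x0) id.
  by apply: (is_diff_eq (is_diffD _ (is_diff_cst _ _))); rewrite addr0.
suff S x : G (x - x0) = sol C gam (G (- x0)) (dG (- x0)) x /\
    dG (x - x0) = sol_grad C gam (G (- x0)) (dG (- x0)) x.
  by split=> x; case: (S x).
have d1 y : differentiable (G \o (fun y => y - x0)) y.
  by apply: differentiable_comp; [by case: (dshift y)|exact: differentiable_sol].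
have d2 y : differentiable (dG \o (fun y => y - x0)) y.
  by apply: differentiable_comp; [by case: (dshift y)|exact: differentiable_sol_grad].
have Dc (W : normedModType R) (f : 'rV[R]_n -> W) y v :
    differentiable f (y - x0) -> 'D_v (f \o (fun y => y - x0)) y = 'D_v f (y - x0).
  move=> df; have [ds Ds] := dshift y.
  rewrite deriveE; last exact: differentiable_comp.
  by rewrite diff_comp//= Ds deriveE.
have [||||E1 E2] := @sol_unique _ _ _ _ Cg _ id (G \o (fun y => y - x0))
  (dG \o (fun y => y - x0)) 0 (`|x| + 1) _ _ _ x.
- by move=> u _; split.
- by move=> u _ v; rewrite Dc ?derive_sol ?derive_id//; exact: differentiable_sol.
- by move=> u _ v; rewrite Dc ?derive_sol_grad ?derive_id//; exact: differentiable_sol_grad.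
- by rewrite -ball_normE /= sub0r normrN ltrDl.
by move: E1 E2; rewrite /= !sub0r !subr0.
Qed.

(** As D_v H = -2 C_v H, the product of the exponential of 2 C_x and H(x) is constant; its value at
    0 is invertible. *)
Lemma hess_unit x : hess_at C gam w0 \in unitmx -> H x \in unitmx.
Proof.
move=> u0; pose M a := -2 *: C a.
have cM a b : M a *m M b = M b *m M a.
  by rewrite -!scalemxAl -!scalemxAr; case: Cg => /(_ a b) ->.
have combM v : mx_comb M v = -2 *: mx_comb C v.
  rewrite scaler_sumr; apply: eq_bigr => a _.
  by rewrite scalerA mulrC -scalerA.
have dN y : differentiable (fun y : 'rV[R]_n => - y) y by apply: differentiableN.
suff E : mexp M (- x) *m H x = hess_at C gam w0.
  by move: u0; rewrite -E unitmx_mul => /andP[].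
rewrite (derive_cst_mx (M := fun x => mexp M (- x) *m H x) x 0)//.
- by rewrite oppr0 mexp0 mul1mx sol_grad0.
- move=> y; apply: differentiable_mulmx; first exact: differentiable_mexp_comp.
  by have [] := derive_sol_hess Cg f0 w0 y 0.
move=> y v; have [dH DH] := derive_sol_hess Cg f0 w0 y v.
rewrite derive_mulmx//; last exact: differentiable_mexp_comp.
rewrite derive_mexp_comp// DH deriveN// derive_id mx_combN combM.
rewrite mulNmx -combM mx_comb_mexp_comm// combM mulNmx -mulmxA.
by rewrite -scalemxAl addrC subrr.
Qed.

Lemma derive_det_hess x v :
  differentiable (fun y => \det (H y)) x /\
  'D_v (fun y => \det (H y)) x = -2 * \tr (mx_comb C v) * \det (H x).
Proof.
have [dH DH] := derive_sol_hess Cg f0 w0 x v.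
have := @derive_det R _ n H (-2 *: mx_comb C v) x v dH.
by rewrite DH -scalemxAl => /(_ erefl)[]; rewrite linearZ.
Qed.

End SolutionHessian.

Section Rigidity.
Context {R : realType} {n : nat}.

(* [C] is determined by [D_v H = -2 C_v H], as the Hessian [H] is invertible. *)
Let rigid0 (C C' : 'I_n -> 'M[R]_n) (gam gam' : 'M[R]_n) f0 w0 f0' w0'
    (U : set 'rV[R]_n) x1 :
  flat_data C gam -> flat_data C' gam' -> open U -> U x1 ->
  hess_at C gam w0 \in unitmx ->
  (forall x, U x -> sol C gam f0 w0 x = sol C' gam' f0' w0' x) ->
  forall x, sol C gam f0 w0 x = sol C' gam' f0' w0' x.
Proof.
move=> Cg Cg' oU Ux1 u0 E.
have near_eq (W : normedModType R) (f g : 'rV[R]_n -> W) x v :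
    (forall x, U x -> f x = g x) -> U x -> 'D_v f x = 'D_v g x.
  move=> fg Ux; apply: near_eq_derive.
  by apply: filterS (open_nbhs_nbhs (conj oU Ux)) => y /fg.
have E1 x : U x -> sol_grad C gam f0 w0 x = sol_grad C' gam' f0' w0' x.
  move=> Ux; apply/colP => i.
  rewrite -(pd_sol Cg f0 w0 x i) -(pd_sol Cg' f0' w0' x i).
  exact: near_eq E Ux.
have E2 x : U x -> hess_at C gam (sol_grad C gam f0 w0 x) =
    hess_at C' gam' (sol_grad C' gam' f0' w0' x).
  move=> Ux; rewrite -(hessian_sol Cg f0 w0) -(hessian_sol Cg' f0' w0').
  apply/matrixP => i j; rewrite [LHS]mxE [RHS]mxE.
  by apply: (near_eq _ _ _ _ _ _ Ux) => y Uy; exact: near_eq E Uy.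
have EC a : C a = C' a.
  have [_ D] := derive_sol_hess Cg f0 w0 x1 (delta_mx 0 a).
  have [_ D'] := derive_sol_hess Cg' f0' w0' x1 (delta_mx 0 a).
  move: D; rewrite (near_eq _ _ _ _ _ E2 Ux1) D' -(E2 _ Ux1) => /eqP.
  have n2 : (-2 : R) != 0 by rewrite oppr_eq0 pnatr_eq0.
  rewrite !mx_comb_delta -subr_eq0 -scalerBr scaler_eq0 (negbTE n2)/=.
  rewrite -mulmxBl => /eqP/(congr1 (mulmx^~ (invmx (hess_at C gam (sol_grad C gam f0 w0 x1))))).
  rewrite mul0mx -mulmxA mulmxV ?mulmx1; last exact: hess_unit.
  by move/eqP; rewrite subr_eq0 => /eqP ->.
have Eg : gam = gam'.
  apply/matrixP => i j; move/matrixP : (E2 _ Ux1) => /(_ i j).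
  rewrite [hess_at _ _ _ _ _]mxE [hess_at _ _ _ _ _]mxE EC (E1 _ Ux1).
  by move/addIr.
by move=> x; rewrite (sol_rebase Cg _ _ x1) [RHS](sol_rebase Cg' _ _ x1);
   rewrite -(E1 _ Ux1) -(E _ Ux1) (funext EC) Eg.
Qed.

(** Plays the role of analytic continuation when local graphs are glued. The two centres differ
    because each local graph is expanded at its own point. *)
Lemma sol_rigid (C C' : 'I_n -> 'M[R]_n) (gam gam' : 'M[R]_n) f0 w0 f0' w0'
    (U : set 'rV[R]_n) x0 x0' x1 :
  flat_data C gam -> flat_data C' gam' -> open U -> U x1 ->
  hess_at C gam w0 \in unitmx ->
  (forall x, U x -> sol C gam f0 w0 (x - x0) = sol C' gam' f0' w0' (x - x0')) ->
  forall x, sol C gam f0 w0 (x - x0) = sol C' gam' f0' w0' (x - x0').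
Proof.
move=> Cg Cg' oU Ux1 u0.
have [f1 [w1 [E1 E1g]]] := sol_shift Cg f0 w0 x0.
have [f2 [w2 [E2 _]]] := sol_shift Cg' f0' w0' x0'.
move=> E x; rewrite E1 E2; apply: (rigid0 Cg Cg' oU Ux1).
  by rewrite -(sol_grad0 C gam f1 w1) -E1g; exact: hess_unit.
by move=> y Uy; rewrite -E1 -E2 E.
Qed.

End Rigidity.

Lemma unitmx_col_mx (R : fieldType) n (J : 'M[R]_(n, n + 1)) xi :
  (col_mx J xi \in unitmx) = row_free J && ~~ (xi <= J)%MS.
Proof.
rewrite -row_free_unit; apply/idP/andP => [/row_free_inj inj|[/row_free_inj inj xiJ]].
  split.
    apply: inj_row_free => v vJ; have := inj _ (row_mx v 0) 0.
    rewrite mul_row_col vJ !mul0mx addr0 => /(_ erefl)/(congr1 lsubmx).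
    by rewrite row_mxKl linear0.
  apply/negP => /submxP[D xiE]; have := inj _ (row_mx D (- 1%:M)) 0.
  rewrite mul_row_col mulNmx mul1mx -xiE subrr mul0mx => /(_ erefl).
  move/(congr1 rsubmx); rewrite row_mxKr linear0 => /matrixP/(_ 0 0).
  by rewrite !mxE eqxx => /eqP; rewrite oppr_eq0 oner_eq0.
apply: inj_row_free => w; rewrite -(hsubmxK w) mul_row_col.
set u := lsubmx w; set t := rsubmx w.
have [t0|t0] := eqVneq t 0.
  rewrite t0 mul0mx addr0 => uJ; have := inj _ u 0; rewrite uJ mul0mx.
  by move=> /(_ erefl) ->; rewrite row_mx0.
move=> /eqP; rewrite addr_eq0 => /eqP E; case/negP: xiJ.
have t00 : t 0 0 != 0.
  by apply: contra t0 => /eqP t0; apply/eqP/matrixP => i j; rewrite !ord1 t0 mxE.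
apply/submxP; exists (- (t 0 0)^-1 *: u).
rewrite -scalemxAl E (mx11_scalar t) mul_scalar_mx -scaleNr scalerA.
by rewrite mulrNN mxE eqxx mulr1n mulVf// scale1r.
Qed.

(** The Levi-Civita connection is metric: lowering the upper index leaves half of three derivatives
    of h, and adding the transpose cancels all but the derivative along l. *)
Lemma levi_civita_metric (R : numFieldType) n (h : 'M[R]_n)
    (dh L : 'I_n -> 'M[R]_n) l :
  h \in unitmx -> h^T = h -> (forall k, (dh k)^T = dh k) ->
  (forall i j k, L i j k =
    2^-1 * \sum_l invmx h k l * (dh i j l + dh j i l - dh l i j)) ->
  dh l = L l *m h + h *m (L l)^T.
Proof.
move=> uh sh sdh LE; have E i j : (L l *m h) i j =
    2^-1 * (dh l i j + dh i l j - dh j l i).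
  rewrite mxE; under eq_bigr => k _ do rewrite LE -mulrA mulr_suml.
  rewrite -mulr_sumr; congr (_ * _); rewrite exchange_big /=.
  under eq_bigr => p _ do under eq_bigr => k _ do rewrite mulrAC mulrC.
  under eq_bigr => p _ do rewrite -mulr_sumr.
  have V p : \sum_k invmx h k p * h k j = (p == j)%:R.
    under eq_bigr => k _ do rewrite mulrC -[in X in X * _]sh mxE.
    transitivity ((h *m invmx h) j p); first by rewrite mxE.
    by rewrite mulmxV// mxE eq_sym.
  under eq_bigr => p _ do rewrite V.
  rewrite (bigD1 j)//= big1 => [|p /negbTE ->]; last by rewrite mulr0.
  by rewrite eqxx mulr1 addr0.
have -> : h *m (L l)^T = (L l *m h)^T by rewrite trmx_mul sh.
apply/matrixP => i j; rewrite [RHS]mxE [X in _ + X]mxE (E i j) (E j i).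
by rewrite -[in dh l j i]sdh mxE; field.
Qed.

Local Opaque derive.

Section DerivativeHelpers.
Context {R : realType} {n : nat}.

Lemma derive_sym_mx (O : set 'rV[R]_n) p q (M : 'rV[R]_n -> 'M[R]_(p, q)) v w x :
  open O -> smooth_on O M -> O x -> 'D_v ('D_w M) x = 'D_w ('D_v M) x.
Proof.
move=> oO sM Ox; apply/matrixP => i j.
have E a b : 'D_a ('D_b M) x i j = 'D_a ('D_b (fun y => M y i j)) x.
  rewrite -derive_entry; last exact: smooth_differentiable (smooth_derive _ sM) Ox.
  apply: near_eq_derive; apply: filterS (open_nbhs_nbhs (conj oO Ox)) => y Oy.
  by rewrite derive_entry//; exact: smooth_differentiable sM Oy.
apply: (etrans (E v w)); apply: etrans _ (esym (E w v)).
exact: (derive_sym v w oO ((smooth_mxP oO M).1 sM i j) Ox).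
Qed.

Lemma smooth_col_mx (V : normedModType R) (U : set V) m1 m2 p
    (A : V -> 'M[R]_(m1, p)) (B : V -> 'M[R]_(m2, p)) : open U ->
  smooth_on U A -> smooth_on U B -> smooth_on U (fun x => col_mx (A x) (B x)).
Proof.
move=> oU /(smooth_mxP oU) sA /(smooth_mxP oU) sB.
apply/(smooth_mxP oU) => i j; under eq_fun do rewrite mxE.
by case: (fintype.split i) => l; [exact: sA|exact: sB].
Qed.

End DerivativeHelpers.

(** * Parametrised hypersurfaces *)

Section ParametrisedGeometry.
Context {R : realType} {n : nat}.
Variables (g : 'rV[R]_n -> 'rV[R]_(n + 1)) (xi : 'rV[R]_(n + 1)).
Variable O : set 'rV[R]_n.
Hypothesis oO : open O.
Hypothesis sg : smooth_on O g.
Hypothesis immg : forall u, O u -> immersed_at g u.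
Hypothesis trg : forall u, O u -> transversal_at g xi u.
Hypothesis ndg : forall u, O u -> aff_form g xi u \in unitmx.
Hypothesis parg : forall u, O u -> forall l i j k, nabla_K g xi l i j k u = 0.

(** Equal to ['J g u] where g is differentiable; built from partial derivatives so that smoothness
    is immediate from [smooth_on]. *)
Definition jac u : 'M[R]_(n, n + 1) := \matrix_(i, j) pd i g u 0 j.
(** The first lower index is split off. Rows carry the second lower index and columns the upper one,
    so the matrix acts on row vectors from the right. *)
Definition conn i u : 'M[R]_n := \matrix_(j, k) induced_conn g xi i j k u.
Definition lc i u : 'M[R]_n := \matrix_(j, k) levi_civita g xi i j k u.
Definition diff_mx i u : 'M[R]_n := \matrix_(j, k) difference_tensor g xi i j k u.
Let h := aff_form g xi.

Let near_eqD (W : normedModType R) (f f' : 'rV[R]_n -> W) x v :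
  (forall x, O x -> f x = f' x) -> O x -> 'D_v f x = 'D_v f' x.
Proof.
move=> ff' Ox; apply: near_eq_derive.
by apply: filterS (open_nbhs_nbhs (conj oO Ox)) => y /ff'.
Qed.

Lemma jacE u : O u -> 'J g u = jac u.
Proof.
move=> Ou; apply/row_matrixP => i; rewrite row_jacobian.
  by apply/rowP => j; rewrite !mxE.
exact: smooth_differentiable sg Ou.
Qed.

Lemma smooth_pd (W : normedModType R) (f : 'rV[R]_n -> W) i :
  smooth_on O f -> smooth_on O (pd i f).
Proof. exact: smooth_derive. Qed.

Lemma smooth_jac : smooth_on O jac.
Proof.
apply/(smooth_mxP oO) => i j; rewrite /jac; under eq_fun do rewrite mxE.
by apply: (smooth_mxP oO _).1; exact: smooth_pd.
Qed.

Lemma frame_unit u : O u -> col_mx (jac u) xi \in unitmx.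
Proof.
move=> Ou; rewrite unitmx_col_mx -jacE//; apply/andP.
by split; [exact: immg|exact: trg].
Qed.

Lemma gaussE u i j : O u ->
  gauss g xi u i j = pd i (pd j g) u *m invmx (col_mx (jac u) xi).
Proof. by move=> Ou; rewrite /gauss jacE. Qed.

Lemma smooth_gauss i j : smooth_on O (fun u => gauss g xi u i j).
Proof.
apply: (smooth_congr oO (fun u Ou => esym (gaussE i j Ou))).
apply: smooth_mulmx => //; first by apply: smooth_pd; exact: smooth_pd.
apply: smooth_invmx => //; first exact: frame_unit.
by apply: smooth_col_mx => //; [exact: smooth_jac|exact: smooth_cst].
Qed.

Lemma smooth_conn i : smooth_on O (conn i).
Proof.
apply/(smooth_mxP oO) => j k; rewrite /conn /induced_conn.
under eq_fun do rewrite mxE mxE.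
exact: (smooth_mxP oO _).1 (smooth_gauss i j) _ _.
Qed.

Lemma smooth_h : smooth_on O h.
Proof.
apply/(smooth_mxP oO) => i j; rewrite /h /aff_form.
under eq_fun do rewrite mxE mxE.
exact: (smooth_mxP oO _).1 (smooth_gauss i j) _ _.
Qed.

Lemma smooth_h_ i j : smooth_on O (h_ g xi i j).
Proof. exact: (smooth_mxP oO _).1 smooth_h i j. Qed.

Lemma smooth_lc i : smooth_on O (lc i).
Proof.
apply/(smooth_mxP oO) => j k; rewrite /lc; under eq_fun do rewrite mxE.
apply: smoothM => //; first exact: smooth_cst.
apply: smooth_sum => // l _; apply: smoothM => //.
  by apply: (smooth_mxP oO _).1; apply: smooth_invmx => //; exact: smooth_h.
apply: smoothD => //; first by apply: smoothD => //; apply: smooth_pd; exact: smooth_h_.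
rewrite (_ : (fun x => _) = fun x => (-1) * pd l (h_ g xi i j) x); last first.
  by apply/funext => x; rewrite mulN1r.
apply: smoothM => //; first exact: smooth_cst.
by apply: smooth_pd; exact: smooth_h_.
Qed.

Lemma diff_mxE i u : diff_mx i u = conn i u - lc i u.
Proof. by apply/matrixP => j k; rewrite !mxE. Qed.

Lemma smooth_diff_mx i : smooth_on O (diff_mx i).
Proof.
apply: (@smooth_congr _ _ _ oO _ (fun u => conn i u + (lc i u *m - 1%:M))).
  by move=> u _; rewrite mulmxN mulmx1 -diff_mxE.
apply: smoothD => //; first exact: smooth_conn.
by apply: smooth_mulmx => //; [exact: smooth_lc|exact: smooth_cst].
Qed.

Lemma gauss_sym u i j : O u -> gauss g xi u i j = gauss g xi u j i.
Proof.
move=> Ou; rewrite (gaussE i j Ou) (gaussE j i Ou).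
exact: (congr1 (mulmx^~ _)
  (derive_sym_mx (delta_mx 0 i) (delta_mx 0 j) oO sg Ou)).
Qed.

Local Opaque gauss.

Lemma conn_sym u i j k : O u -> conn i u j k = conn j u i k.
Proof. move=> Ou. 
rewrite [LHS]mxE.
rewrite [RHS]mxE.
rewrite /induced_conn.
have E := gauss_sym i j Ou.
rewrite E.
done. Qed.

Lemma h_sym u : O u -> (h u)^T = h u.
Proof. by move=> Ou; apply/matrixP => i j; rewrite mxE [LHS]mxE [RHS]mxE (gauss_sym j i Ou). Qed.

Lemma h__sym u i j : O u -> h_ g xi i j u = h_ g xi j i u.
Proof.
move=> Ou; have /matrixP/(_ j i) := h_sym Ou; rewrite [LHS]mxE.
exact.
Qed.

Lemma derive_jac l u : O u ->
  pd l jac u = conn l u *m jac u + col l (h u) *m xi.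
Proof.
move=> Ou; apply/row_matrixP => j; rewrite linearD /= !row_mul.
transitivity (pd l (pd j g) u).
  apply/rowP => k; rewrite mxE /pd -derive_entry; last first.
    exact: smooth_differentiable smooth_jac Ou.
  rewrite -derive_entry; last exact: smooth_differentiable (smooth_pd j sg) Ou.
  apply: (congr1 (fun f => 'D_(delta_mx 0 l) f u)).
  by apply/funext => y; rewrite mxE.
have := gaussE l j Ou => /(congr1 (mulmx^~ (col_mx (jac u) xi))).
rewrite mulmxKV ?frame_unit// => <-.
rewrite -[gauss _ _ _ _ _]hsubmxK mul_row_col; congr (_ + _); congr (_ *m _).
  by apply/rowP => k; rewrite [RHS]mxE [RHS]mxE.
apply/matrixP => a b; rewrite !ord1 -(h_sym Ou) [RHS]mxE [RHS]mxE [RHS]mxE.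
by rewrite [RHS]mxE.
Qed.

Lemma lcE u i j k : lc i u j k =
  2^-1 * \sum_l invmx (h u) k l *
    (pd i (h_ g xi j l) u + pd j (h_ g xi i l) u - pd l (h_ g xi i j) u).
Proof. by rewrite [LHS]mxE. Qed.

Lemma diff_mx_entry u i j k : diff_mx i u j k = conn i u j k - lc i u j k.
Proof. by rewrite [LHS]mxE [conn i u j k]mxE [lc i u j k]mxE. Qed.

Lemma connE u i j k : induced_conn g xi i j k u = conn i u j k.
Proof. by rewrite [RHS]mxE. Qed.

Lemma diff_tensorE u i j k : difference_tensor g xi i j k u = diff_mx i u j k.
Proof. by rewrite [RHS]mxE. Qed.

Local Opaque induced_conn levi_civita difference_tensor aff_form pd.
Local Opaque conn lc diff_mx jac.

Lemma pd_h_sym u l i j : O u -> pd l (h_ g xi i j) u = pd l (h_ g xi j i) u.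
Proof. by move=> Ou; apply: (near_eqD _ _ Ou) => y; exact: h__sym. Qed.

Lemma lc_sym u i j k : O u -> lc i u j k = lc j u i k.
Proof.
move=> Ou; rewrite (lcE u i j k) (lcE u j i k); congr (_ * _).
apply: eq_bigr => l _; rewrite (pd_h_sym l i j Ou).
by rewrite [X in _ * (X - _)]addrC.
Qed.

Lemma diff_mx_sym u i j k : O u -> diff_mx i u j k = diff_mx j u i k.
Proof.
move=> Ou; rewrite (diff_mx_entry u i j k) (diff_mx_entry u j i k).
exact: (congr2 (fun a b => a - b) (conn_sym i j k Ou) (lc_sym i j k Ou)).
Qed.

Lemma pd_hE u l i j : O u -> pd l h u i j = pd l (h_ g xi i j) u.
Proof.
move=> Ou; have dh := smooth_differentiable smooth_h Ou.
exact: (esym (derive_entry (delta_mx 0 l) i j dh)).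
Qed.

Lemma lc_metric u l : O u ->
  pd l h u = lc l u *m h u + h u *m (lc l u)^T.
Proof.
move=> Ou; apply: (@levi_civita_metric R n (h u) (fun l => pd l h u)
  (fun l => lc l u) l (ndg Ou) (h_sym Ou)).
  move=> k; apply/matrixP => i j; rewrite mxE.
  apply: (etrans (pd_hE k j i Ou)); apply: etrans (esym (pd_hE k i j Ou)).
  exact: pd_h_sym.
move=> i j k; apply: (etrans (lcE u i j k)).
congr (_ * _); apply: eq_bigr => p _; apply: congr1.
apply: congr2; last exact: congr1 (esym (pd_hE _ _ _ Ou)).
by apply: congr2; exact: (esym (pd_hE _ _ _ Ou)).
Qed.

(** The connection terms for the second lower index and the upper index form a commutator; the
    remaining lower index gives a combination of the matrices of K. *)
Lemma nabla_K_mx u l i : O u ->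
  pd l (diff_mx i) u = \sum_m conn l u i m *: diff_mx m u +
    (conn l u *m diff_mx i u - diff_mx i u *m conn l u).
Proof.
have alg (A B S D : 'M[R]_n) j k :
    A j k + B j k - S j k - D j k = 0 -> A j k = (S + (D - B)) j k.
  by rewrite !mxE => E; lra.
move=> Ou; apply/matrixP => j k; have := parg Ou l i j k; rewrite /nabla_K.
have dK : differentiable (diff_mx i) u.
  exact: smooth_differentiable (smooth_diff_mx i) Ou.
have -> : pd l (difference_tensor g xi i j k) u = pd l (diff_mx i) u j k.
  rewrite -[RHS](derive_entry (delta_mx 0 l) j k dK).
  by apply: near_eqD Ou => y _; exact: diff_tensorE.
have -> : \sum_m induced_conn g xi l m k u * difference_tensor g xi i j m u =
    (diff_mx i u *m conn l u) j k.
  by rewrite [RHS]mxE; apply: eq_bigr => m _; rewrite connE diff_tensorE mulrC.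
have -> : \sum_m induced_conn g xi l i m u * difference_tensor g xi m j k u =
    (\sum_m conn l u i m *: diff_mx m u) j k.
  rewrite summxE; apply: eq_bigr => m _.
  by rewrite connE diff_tensorE [RHS]mxE.
have -> : \sum_m induced_conn g xi l j m u * difference_tensor g xi i m k u =
    (conn l u *m diff_mx i u) j k.
  by rewrite [RHS]mxE; apply: eq_bigr => m _; rewrite connE diff_tensorE.
exact: alg.
Qed.

End ParametrisedGeometry.

(** Let k a b c = H(ab, c), symmetric in a and b. The hypothesis, carried to all directions by the
    invertible J, says that k a b c + k a c b is invariant under exchange of a and b, whence k a c b
    = k b c a. So k is totally symmetric, which is self-adjointness. *)
Lemma codazzi_sym (R : realType) n (C : 'I_n -> 'M[R]_n) (H J : 'M[R]_n) :
  let Q w := mx_comb C w *m H + H *m (mx_comb C w)^T in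
  J \in unitmx -> H^T = H -> (forall a b c, C a b c = C b a c) ->
  (forall v w, Q (v *m J) *m (w *m J)^T = Q (w *m J) *m (v *m J)^T) ->
  forall a, C a *m H = H *m (C a)^T.
Proof.
move=> Q uJ sH sC HQ; pose k a b c : R := (C a *m H) b c.
have k12 a b c : k a b c = k b a c.
  by rewrite /k mxE [RHS]mxE; apply: eq_bigr => d _; rewrite sC.
have QE a b c : (Q (delta_mx 0 a)) c b = k a c b + k a b c.
  rewrite /Q mx_comb_delta [LHS]mxE; congr (_ + _).
  by rewrite -{1}sH -trmx_mul mxE.
have Qsym a b c : (Q (delta_mx 0 a)) c b = (Q (delta_mx 0 b)) c a.
  have := HQ (delta_mx 0 a *m invmx J) (delta_mx 0 b *m invmx J).
  rewrite !mulmxKV// !trmx_delta -!colE => /colP/(_ c).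
  by rewrite [X in X = _]mxE [X in _ = X]mxE.
move=> a; apply/matrixP => b c.
have -> : (H *m (C a)^T) b c = k a c b by rewrite -{1}sH -trmx_mul mxE.
rewrite -/(k a b c); have := Qsym b c a; rewrite !QE.
by rewrite (k12 b c a) => /addIr; rewrite (k12 b a c) (k12 c a b).
Qed.

Section Combination.
Context {R : realType} {n m : nat} {V : normedModType R}.
Variables (K : V -> 'I_n -> 'M[R]_m) (w : V -> 'rV[R]_n).

Lemma derive_mx_comb x v :
  (forall i, differentiable (fun u => K u i) x) -> differentiable w x ->
  differentiable (fun u => mx_comb (K u) (w u)) x /\
  'D_v (fun u => mx_comb (K u) (w u)) x =
    mx_comb (fun i => 'D_v (fun u => K u i) x) (w x) +
    mx_comb (K x) ('D_v w x).
Proof.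
move=> dK dw; have dwi i : differentiable (fun u => w u 0 i) x.
  exact: (differentiable_mxP _ _).1.
pose f i u := (w u 0 i)%:M *m K u i.
have df0 i : differentiable (fun u => (w u 0 i)%:M : 'M[R]_m) x.
  apply/differentiable_mxP => a b; under eq_fun do rewrite mxE.
  by case: (a == b); [under eq_fun do rewrite mulr1n|exact: differentiable_cst].
have df i : differentiable (f i) x by exact: differentiable_mulmx.
have Df i : 'D_v (f i) x = w x 0 i *: 'D_v (fun u => K u i) x +
    ('D_v w x) 0 i *: K x i.
  rewrite /f derive_mulmx// mul_scalar_mx addrC; congr (_ + _).
  rewrite -mul_scalar_mx; congr (_ *m _); apply/matrixP => a b.
  rewrite -(derive_entry v a b (df0 i)); under eq_fun do rewrite mxE.
  rewrite [RHS]mxE; case: (a == b); last by rewrite derive_cst.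
  under eq_fun do rewrite mulr1n.
  by rewrite (derive_entry v 0 i dw) mulr1n.
have -> : (fun u => mx_comb (K u) (w u)) = \sum_i f i.
  apply/funext => u; rewrite fct_sumE; apply: eq_bigr => i _.
  by rewrite /f mul_scalar_mx.
split; first exact: differentiable_sum.
rewrite derive_sum; last by move=> i; exact: diff_derivable.
by rewrite -big_split; apply: eq_bigr => i _; rewrite Df.
Qed.

End Combination.

Section CombinationSmooth.
Context {R : realType} {n m : nat} {V : normedModType R}.
Variables (K : V -> 'I_n -> 'M[R]_m) (w : V -> 'rV[R]_n) (O : set V).

Lemma smooth_mx_comb : open O -> (forall i, smooth_on O (fun u => K u i)) ->
  smooth_on O w -> smooth_on O (fun u => mx_comb (K u) (w u)).
Proof.
move=> oO sK sw; apply/(smooth_mxP oO) => a b.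
rewrite (_ : (fun u => _) = fun u => \sum_i w u 0 i * K u i a b).
  apply: smooth_sum => // i _; apply: smoothM => //.
    exact: (smooth_mxP oO _).1.
  exact: ((smooth_mxP oO _).1 (sK i)).
by apply/funext => u; rewrite summxE; apply: eq_bigr => i _; rewrite mxE.
Qed.

End CombinationSmooth.

Section InverseDerivative.
Context {R : realType} {n : nat} {V : normedModType R}.
Variables (O : set V) (J : V -> 'M[R]_n).

Lemma derive_invmx u v : open O -> smooth_on O J ->
  (forall u, O u -> J u \in unitmx) -> O u ->
  'D_v (fun y => invmx (J y)) u = - (invmx (J u) *m 'D_v J u *m invmx (J u)).
Proof.
move=> oO sJ uJ Ou; have si : smooth_on O (fun y => invmx (J y)).
  exact: smooth_invmx.
have dJ := smooth_differentiable sJ Ou; have di := smooth_differentiable si Ou.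
have : 'D_v (fun y => invmx (J y) *m J y) u = 0.
  rewrite -(derive_cst (1%:M : 'M[R]_n) u v); apply: near_eq_derive.
  apply: filterS (open_nbhs_nbhs (conj oO Ou)) => y Oy.
  by rewrite mulVmx// uJ.
rewrite derive_mulmx// => /eqP; rewrite addr_eq0 => /eqP.
move=> /(congr1 (mulmx^~ (invmx (J u)))).
by rewrite mulmxK ?uJ// mulNmx.
Qed.

End InverseDerivative.

(** * Local structure of immersions with parallel difference tensor *)

Section FlatFrame.
Context {R : realType} {n : nat}.
Local Notation V := 'rV[R]_n.
Variables (O : set V) (oO : open O).
(** [phi] and [F] stand for the affine coordinates of the hypersurface point with chart parameter u,
    [J] and [dF] for their derivatives in the chart, [Gam] and [K] for the connection and the
    difference tensor. [DJ] says that the affine coordinates are flat for nabla, [Dh] that h is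
    parallel for nabla - K, and [DK] that nabla K = 0. *)
Variables (phi : V -> 'rV[R]_n) (F : V -> R) (J h : V -> 'M[R]_n).
Variables (dF : V -> 'cV[R]_n) (Gam K : V -> 'I_n -> 'M[R]_n).
Hypothesis sphi : smooth_on O phi.
Hypothesis sF : smooth_on O F.
Hypothesis sJ : smooth_on O J.
Hypothesis sh : smooth_on O h.
Hypothesis sdF : smooth_on O dF.
Hypothesis sK : forall i, smooth_on O (fun u => K u i).
Hypothesis uJ : forall u, O u -> J u \in unitmx.
Hypothesis uh : forall u, O u -> h u \in unitmx.
Hypothesis symh : forall u, O u -> (h u)^T = h u.
Hypothesis symG : forall u v w, O u ->
  v *m mx_comb (Gam u) w = w *m mx_comb (Gam u) v.
Hypothesis symK : forall u v w, O u ->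
  v *m mx_comb (K u) w = w *m mx_comb (K u) v.
Hypothesis Dphi : forall u v, O u -> 'D_v phi u = v *m J u.
Hypothesis DF : forall u v, O u -> 'D_v F u = (v *m dF u) 0 0.
Hypothesis DJ : forall u v, O u -> 'D_v J u = mx_comb (Gam u) v *m J u.
Hypothesis DdF : forall u v, O u ->
  'D_v dF u = mx_comb (Gam u) v *m dF u + h u *m v^T.
Hypothesis Dh : forall u v, O u -> 'D_v h u =
  (mx_comb (Gam u) v - mx_comb (K u) v) *m h u +
  h u *m (mx_comb (Gam u) v - mx_comb (K u) v)^T.
Hypothesis DK : forall u v i, O u -> 'D_v (fun y => K y i) u =
  mx_comb (K u) (delta_mx 0 i *m mx_comb (Gam u) v) +
  (mx_comb (Gam u) v *m K u i - K u i *m mx_comb (Gam u) v).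

Let Ji u := invmx (J u).
Let sJi : smooth_on O Ji. Proof. exact: smooth_invmx. Qed.

Let DJi u v : O u -> 'D_v Ji u = - (Ji u *m mx_comb (Gam u) v).
Proof.
move=> Ou; rewrite (derive_invmx v oO sJ uJ Ou) DJ// mulmxA.
by rewrite mulmxK ?uJ.
Qed.

(* [K], [h] and [dF] in the affine coordinates whose frame is mapped to the
   coordinate frame of the chart by [J]. *)
Definition frame_alg u (w : 'rV[R]_n) : 'M[R]_n :=
  Ji u *m mx_comb (K u) (w *m Ji u) *m J u.
Definition frame_hess u : 'M[R]_n := Ji u *m h u *m (Ji u)^T.
Definition frame_grad u : 'cV[R]_n := Ji u *m dF u.

Let sJw (w : 'rV[R]_n) : smooth_on O (fun u => w *m Ji u).
Proof. by apply: smooth_mulmx => //; exact: smooth_cst. Qed.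

Let sKw (w : 'rV[R]_n) : smooth_on O (fun u => mx_comb (K u) (w *m Ji u)).
Proof. exact: smooth_mx_comb. Qed.

Lemma smooth_frame_alg w : smooth_on O (frame_alg ^~ w).
Proof. by do 2![apply: smooth_mulmx => //]. Qed.

Lemma smooth_frame_hess : smooth_on O frame_hess.
Proof. by apply: smooth_mulmx => //; [exact: smooth_mulmx|exact: smooth_tr]. Qed.

Lemma smooth_frame_grad : smooth_on O frame_grad.
Proof. exact: smooth_mulmx. Qed.

(** In the flat frame the covariant derivative is the ordinary one: the derivatives of [J] and its
    inverse cancel the connection terms of [DK]. *)
Lemma derive_frame_alg u v w : O u -> 'D_v (frame_alg ^~ w) u = 0.
Proof.
move=> Ou; have dJ := smooth_differentiable sJ Ou.
have dJi := smooth_differentiable sJi Ou.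
have dJw := smooth_differentiable (sJw w) Ou.
have dKw := smooth_differentiable (sKw w) Ou.
have dK i : differentiable (fun u => K u i) u.
  exact: smooth_differentiable (sK i) Ou.
have dJK : differentiable (fun u => Ji u *m mx_comb (K u) (w *m Ji u)) u.
  exact: differentiable_mulmx.
have DJw : 'D_v (fun u => w *m Ji u) u = - (w *m Ji u *m mx_comb (Gam u) v).
  rewrite derive_mulmx; [|exact: differentiable_cst|exact: dJi].
  by rewrite derive_cst mul0mx add0r DJi// mulmxN mulmxA.
rewrite (derive_mulmx v dJK dJ) (derive_mulmx v dJi dKw) DJi// DJ//.
have [_ ->] := derive_mx_comb v dK (dJw : differentiable (fun u => w *m Ji u) u).
rewrite DJw.
set G := mx_comb (Gam u) v; set x := w *m Ji u.
have -> : mx_comb (fun i => 'D_v (fun u => K u i) u) x =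
    mx_comb (K u) (x *m G) + (G *m mx_comb (K u) x - mx_comb (K u) x *m G).
  transitivity (\sum_i x 0 i *: (mx_comb (K u) (delta_mx 0 i *m G) +
      (G *m K u i - K u i *m G))).
    by apply: eq_bigr => i _; rewrite DK.
  under eq_bigr => i _ do rewrite scalerDr scalerBr.
  rewrite big_split sumrB /=; congr (_ + (_ - _)).
  - rewrite [in RHS](row_sum_delta x) mulmx_suml.
    pose L : {linear 'rV[R]_n -> 'M[R]_n} := HB.pack (mx_comb (K u))
      (GRing.isLinear.Build _ _ _ _ _ (mx_comb_linear (K u))).
    rewrite -[mx_comb (K u)]/(L : _ -> _) linear_sum; apply: eq_bigr => i _.
    by rewrite -scalemxAl linearZ.
  - by rewrite mulmx_sumr; apply: eq_bigr => i _; rewrite -scalemxAr.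
  - by rewrite mulmx_suml; apply: eq_bigr => i _; rewrite -scalemxAl.
rewrite -/x mx_combN.
have alg (A B X Y : 'M[R]_n) :
    (- (A *m G) *m X + A *m (Y + (G *m X - X *m G) - Y)) *m B +
    A *m X *m (G *m B) = 0.
  by rewrite (addrC Y) addrK mulmxBr !mulmxA mulNmx addKr mulNmx addNr.
exact: alg.
Qed.

Lemma mx_comb_frame_alg u w :
  mx_comb (fun a => frame_alg u (delta_mx 0 a)) w = frame_alg u w.
Proof.
have lin : linear (frame_alg u).
  move=> t x y; rewrite /frame_alg mulmxDl -scalemxAl mx_comb_linear.
  by rewrite mulmxDr mulmxDl -scalemxAr -scalemxAl.
pose L : {linear 'rV[R]_n -> 'M[R]_n} := HB.pack (frame_alg u)
  (GRing.isLinear.Build _ _ _ _ _ lin).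
rewrite -[frame_alg u w]/(L w) [in RHS](row_sum_delta w) linear_sum.
by apply: eq_bigr => i _; rewrite linearZ.
Qed.

Lemma frame_alg_sym u a b c : O u ->
  frame_alg u (delta_mx 0 a) b c = frame_alg u (delta_mx 0 b) a c.
Proof.
move=> Ou; have E (i j : 'I_n) : frame_alg u (delta_mx 0 i) j c =
    ((delta_mx 0 j : 'rV_n) *m Ji u *m mx_comb (K u) (delta_mx 0 i *m Ji u) *m J u) 0 c.
  transitivity (row j (frame_alg u (delta_mx 0 i)) 0 c).
    by rewrite [RHS]mxE.
  by rewrite rowE /frame_alg !mulmxA.
by rewrite !E symK.
Qed.

Lemma derive_frame_grad u v : O u ->
  'D_v frame_grad u = frame_hess u *m (v *m J u)^T.
Proof.
move=> Ou; rewrite derive_mulmx; [|exact: smooth_differentiable sJi Ou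
  |exact: smooth_differentiable sdF Ou].
rewrite DJi// DdF// mulmxDr mulNmx mulmxA addKr /frame_hess trmx_mul.
rewrite -!mulmxA; congr (_ *m (_ *m _)).
by rewrite mulmxA -trmx_mul mulmxV ?uJ// trmx1 mul1mx.
Qed.

(** The connection terms cancel against the derivatives of the frame; of nabla - K only K remains,
    once for each argument of h. *)
Lemma derive_frame_hess_asym u v : O u ->
  'D_v frame_hess u = - (frame_alg u (v *m J u) *m frame_hess u +
    frame_hess u *m (frame_alg u (v *m J u))^T).
Proof.
move=> Ou; have dJi := smooth_differentiable sJi Ou.
have dh := smooth_differentiable sh Ou.
have dJiT : differentiable (fun u => (Ji u)^T) u.
  exact: smooth_differentiable (smooth_tr oO sJi) Ou.
have DJiT : 'D_v (fun u => (Ji u)^T) u = - (Ji u *m mx_comb (Gam u) v)^T.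
  rewrite -linearN -DJi//; apply/matrixP => i j.
  rewrite -derive_entry//; under eq_fun do rewrite mxE.
  by rewrite [RHS]mxE derive_entry.
rewrite derive_mulmx//; last exact: differentiable_mulmx.
rewrite derive_mulmx// DJi// DJiT Dh// /frame_hess /frame_alg.
rewrite mulmxK ?uJ// !trmx_mul.
set G := mx_comb (Gam u) v; set X := mx_comb (K u) v.
have -> : Ji u *m X *m J u *m (Ji u *m h u *m (Ji u)^T) =
    Ji u *m X *m h u *m (Ji u)^T.
  by rewrite !mulmxA mulmxK ?uJ.
have -> : Ji u *m h u *m (Ji u)^T *m ((J u)^T *m (X^T *m (Ji u)^T)) =
    Ji u *m h u *m X^T *m (Ji u)^T.
  rewrite -mulmxA (mulmxA (Ji u)^T) -trmx_mul mulmxV ?uJ// trmx1 mul1mx.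
  by rewrite !mulmxA.
have alg (A B B' : 'M[R]_n) : (- (A *m G) *m B + A *m ((G - X) *m B +
    B *m (G - X)^T)) *m B' + A *m B *m - (G^T *m B') =
    - (A *m X *m B *m B' + A *m B *m X^T *m B').
  rewrite (_ : (G - X)^T = G^T - X^T); last by rewrite linearB.
  rewrite mulmxBl mulmxBr mulmxDr !mulmxBr !mulmxA mulmxN !mulNmx.
  rewrite !addrA addNr add0r !mulmxDl !mulNmx mulmxA addrAC -!addrA.
  by rewrite [X in _ + X]addrA subrr sub0r opprD.
exact: alg.
Qed.

Lemma frame_hess_sym u : O u -> (frame_hess u)^T = frame_hess u.
Proof. by move=> Ou; rewrite !trmx_mul trmxK symh// mulmxA. Qed.

Lemma frame_hess_unit u : O u -> frame_hess u \in unitmx.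
Proof.
by move=> Ou; rewrite !unitmx_mul unitmx_tr unitmx_inv uJ// uh.
Qed.

(* The cubic form is totally symmetric since the second derivatives of
   [frame_grad] commute. *)
Lemma frame_alg_hess u a : O u ->
  frame_alg u (delta_mx 0 a) *m frame_hess u =
  frame_hess u *m (frame_alg u (delta_mx 0 a))^T.
Proof.
move=> Ou; move: a; apply: (@codazzi_sym R n
  (fun a => frame_alg u (delta_mx 0 a)) _ _ (uJ Ou) (frame_hess_sym Ou)).
  by move=> ? ? ?; exact: frame_alg_sym.
have opp (A B : 'M[R]_n) (a b : 'cV[R]_n) : - A *m a = - B *m b -> A *m a = B *m b.
  by rewrite !mulNmx => /oppr_inj.
move=> v w; rewrite !mx_comb_frame_alg.
have dJ := smooth_differentiable sJ Ou.
have dH := smooth_differentiable smooth_frame_hess Ou.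
have D x y : 'D_x ('D_y frame_grad) u =
    'D_x frame_hess u *m (y *m J u)^T +
    frame_hess u *m (y *m mx_comb (Gam u) x *m J u)^T.
  transitivity ('D_x (fun u => frame_hess u *m ((J u)^T *m y^T)) u).
    apply: near_eq_derive.
    apply: filterS (open_nbhs_nbhs (conj oO Ou)) => z Oz.
    by rewrite derive_frame_grad// trmx_mul.
  have dJT : differentiable (fun u => (J u)^T) u.
    exact: smooth_differentiable (smooth_tr oO sJ) Ou.
  have DJT : 'D_x (fun u => (J u)^T) u = ('D_x J u)^T.
    apply/matrixP => i j; rewrite -(derive_entry x i j dJT).
    by under eq_fun do rewrite mxE; rewrite [RHS]mxE derive_entry.
  rewrite derive_mulmx//; last first.
    by apply: differentiable_mulmx => //; exact: differentiable_cst.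
  rewrite (derive_mulmx x dJT (differentiable_cst _ _)).
  by rewrite derive_cst mulmx0 addr0 DJT DJ// -!trmx_mul mulmxA.
have E := etrans (etrans (esym (D v w))
  (derive_sym_mx v w oO smooth_frame_grad Ou)) (D w v).
have Hv := derive_frame_hess_asym v Ou; have Hw := derive_frame_hess_asym w Ou.
move: E; rewrite (symG w v Ou) Hv Hw => /addIr.
exact: opp.
Qed.

(** Self-adjointness merges the two terms; this is the origin of the constant -2. *)
Lemma derive_frame_hess u v : O u ->
  'D_v frame_hess u = -2 *: (frame_alg u (v *m J u) *m frame_hess u).
Proof.
move=> Ou; rewrite derive_frame_hess_asym//.
have -> : frame_hess u *m (frame_alg u (v *m J u))^T =
    frame_alg u (v *m J u) *m frame_hess u.
  rewrite -mx_comb_frame_alg linear_sum mulmx_sumr mulmx_suml.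
  apply: eq_bigr => a _; rewrite linearZ /= -scalemxAr -scalemxAl.
  by rewrite frame_alg_hess.
by rewrite -mulr2n -scaler_nat scaleNr.
Qed.

Lemma frame_alg_cst u0 e : ball u0 e `<=` O ->
  forall u w, ball u0 e u -> frame_alg u w = frame_alg u0 w.
Proof.
move=> BO u w Bu.
apply: (derive_cst_ball_mx (M := frame_alg ^~ w) (e := e)) => // x /BO Ox.
  exact: smooth_differentiable (smooth_frame_alg w) Ox.
by move=> v; rewrite derive_frame_alg.
Qed.

Section FlatBall.
Variables (u0 : V) (e : R).
Hypothesis BO : ball u0 e `<=` O.
Hypothesis e0 : 0 < e.

Let C a := frame_alg u0 (delta_mx 0 a).
(** Extrapolation of the Hessian at [u0] to gradient zero, so that [hess_at C gam] returns
    [frame_hess u0] at the actual gradient. *)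
Let gam := hess_at C (frame_hess u0) (- frame_grad u0).

Let Bu0 : ball u0 e u0. Proof. exact: ballxx. Qed.

Let algE u w : ball u0 e u -> frame_alg u w = mx_comb C w.
Proof. by move=> Bu; rewrite (frame_alg_cst BO w Bu) -mx_comb_frame_alg. Qed.

Let C_sym a b c : C a b c = C b a c.
Proof. exact/frame_alg_sym/BO. Qed.

Let DH u v : ball u0 e u -> 'D_v frame_hess u =
  mx_comb C ((-2 *: v) *m J u) *m frame_hess u.
Proof.
move=> Bu; rewrite derive_frame_hess ?algE//; last exact: BO.
by rewrite -scalemxAl mx_combZ -scalemxAl.
Qed.

(* The second derivatives of [frame_hess] commute. *)
Let C_comm a b : C a *m C b = C b *m C a.
Proof.
have Ou0 := BO Bu0; have dJ := smooth_differentiable sJ Ou0.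
have dH := smooth_differentiable smooth_frame_hess Ou0.
have D x y : 'D_x ('D_y frame_hess) u0 =
    mx_comb C ((-2 *: y) *m mx_comb (Gam u0) x *m J u0) *m frame_hess u0 +
    mx_comb C ((-2 *: y) *m J u0) *m
      (mx_comb C ((-2 *: x) *m J u0) *m frame_hess u0).
  have dyJ : differentiable (fun u => (-2 *: y) *m J u) u0.
    exact: (differentiable_mulmx (differentiable_cst _ _) dJ).
  have dK i : differentiable (fun u : V => C i) u0 by exact: differentiable_cst.
  have [dC DC] := derive_mx_comb (K := fun=> C) x dK dyJ.
  transitivity ('D_x (fun u => mx_comb C ((-2 *: y) *m J u) *m frame_hess u) u0).
    apply: near_eq_derive.
    apply: filterS (nbhsx_ballx u0 _ e0) => z Bz.
    exact: DH.
  rewrite (derive_mulmx x dC dH) DC (DH _ Bu0); congr (_ *m _ + _).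
  rewrite [X in X + _]big1 => [|i _]; last by rewrite derive_cst scaler0.
  rewrite add0r (derive_mulmx x (differentiable_cst _ _) dJ).
  by rewrite derive_cst mul0mx add0r DJ// mulmxA.
have E v w : mx_comb C ((-2 *: w) *m J u0) *m mx_comb C ((-2 *: v) *m J u0) =
    mx_comb C ((-2 *: v) *m J u0) *m mx_comb C ((-2 *: w) *m J u0).
  have E := etrans (etrans (esym (D v w))
    (derive_sym_mx v w oO smooth_frame_hess Ou0)) (D w v).
  have SG : (-2 *: w) *m mx_comb (Gam u0) v = (-2 *: v) *m mx_comb (Gam u0) w.
    by rewrite -!scalemxAl (symG w v Ou0).
  move: E; rewrite SG => /addrI/(congr1 (mulmx^~ (invmx (frame_hess u0)))).
  rewrite (mulmxA (mx_comb C _)) mulmxK ?frame_hess_unit//.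
  by rewrite [X in _ = X *m _]mulmxA mulmxK ?frame_hess_unit.
have n2 : (-2 : R) != 0 by rewrite oppr_eq0 pnatr_eq0.
have S c : (-2 *: ((-2)^-1 *: (delta_mx 0 c *m invmx (J u0)))) *m J u0 = delta_mx 0 c.
  by rewrite scalerA mulfV// scale1r mulmxKV// uJ.
have := E ((-2)^-1 *: (delta_mx 0 b *m invmx (J u0)))
  ((-2)^-1 *: (delta_mx 0 a *m invmx (J u0))).
by rewrite !S !mx_comb_delta.
Qed.

Let flat u : ball u0 e u -> flat_data C (frame_hess u).
Proof.
move=> Bu; split=> //; first exact/frame_hess_sym/BO.
move=> a; have := frame_alg_hess a (BO Bu).
by rewrite algE// mx_comb_delta.
Qed.

(** [M] is the Hessian plus twice the contraction with the gradient. Its derivative is -2 C_v H + 2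
    C_v H = 0, so the Hessian is affine in the gradient. *)
Let hessE u : ball u0 e u -> frame_hess u = hess_at C gam (frame_grad u).
Proof.
move=> Bu; pose M (u : V) := frame_hess u - -2 *: alg_contract C (frame_grad u).
have dH x : ball u0 e x -> differentiable frame_hess x.
  by move=> /BO Ox; exact: smooth_differentiable smooth_frame_hess Ox.
have dW x : ball u0 e x -> differentiable frame_grad x.
  by move=> /BO Ox; exact: smooth_differentiable smooth_frame_grad Ox.
have dc x v (Bx : ball u0 e x) := derive_alg_contract C v (dW x Bx).
have dcZ x : ball u0 e x ->
    differentiable (-2 \*: (fun u : V => alg_contract C (frame_grad u))) x.
  by move=> Bx; apply: differentiableZ; have [] := dc x 0 Bx.
have MM : M u = M u0.
  apply: (derive_cst_ball_mx (M := M) (e := e)); last exact: Bu.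
    by move=> x Bx; apply: differentiableB; [exact: dH|exact: dcZ].
  move=> x Bx v; have [dcx Dcx] := dc x v Bx.
  have -> : M = frame_hess - (-2 \*: (fun u : V => alg_contract C (frame_grad u))) by [].
  rewrite deriveB; [|exact/diff_derivable/dH|exact/diff_derivable/dcZ].
  rewrite deriveZ; last exact: diff_derivable.
  rewrite Dcx (derive_frame_grad v (BO Bx)).
  (* Here [frame_hess x] itself is the invariant form and the gradient is 0, because its expression
     through [gam] is what is being proved. *)
  have := alg_contract_hess (flat Bx) 0 (v *m J x); rewrite hess_at0 => ->.
  by rewrite (derive_frame_hess v (BO Bx)) (algE _ Bx) subrr.
have -> : hess_at C gam (frame_grad u) =
    frame_hess u0 - 2 *: alg_contract C (frame_grad u - frame_grad u0).
  by rewrite hess_at_hess_at addrC hess_atE.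
have lin : alg_contract C (frame_grad u - frame_grad u0) =
    alg_contract C (frame_grad u) - alg_contract C (frame_grad u0).
  rewrite -[- frame_grad u0]scaleN1r addrC alg_contract_linear scaleN1r.
  by rewrite addrC.
apply/eqP; rewrite -subr_eq0; apply/eqP; rewrite lin.
move: MM; rewrite /M => /eqP; rewrite -subr_eq0 => /eqP <-.
by apply/matrixP => i j; rewrite !mxE; ring.
Qed.

Lemma flat_frame_sol :
  [/\ flat_data C gam, hess_at C gam (frame_grad u0) = frame_hess u0 &
      forall u, ball u0 e u ->
        F u = sol C gam (F u0) (frame_grad u0) (phi u - phi u0)].
Proof.
have Cg : flat_data C gam by apply: flat_data_hess_at; exact: flat.
split=> //; first by rewrite -hessE.
move=> u Bu; have [||||//] :=
  @sol_unique R n C gam Cg V phi F frame_grad u0 e _ _ _ u.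
- move=> x /BO Ox; split; first exact: smooth_differentiable sphi Ox.
    exact: smooth_differentiable sF Ox.
  exact: smooth_differentiable smooth_frame_grad Ox.
- move=> x /BO Ox v; rewrite DF// Dphi// /frame_grad mulmxA mulmxK//.
  exact: uJ.
- move=> x Bx v; rewrite (derive_frame_grad v (BO Bx)) (Dphi v (BO Bx)).
  by rewrite (hessE Bx).
exact: Bu.
Qed.

End FlatBall.

End FlatFrame.

(** * Affine coordinates of the ambient space *)

Section AffineProjections.
Context {R : realType} {n : nat}.
Variables (o : 'rV[R]_(n + 1)) (B : 'M[R]_(n, n + 1)) (xi : 'rV[R]_(n + 1)).

Definition hproj (p : 'rV[R]_(n + 1)) : 'rV[R]_n :=
  lsubmx ((p - o) *m invmx (col_mx B xi)).
Definition vproj (p : 'rV[R]_(n + 1)) : R :=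
  rsubmx ((p - o) *m invmx (col_mx B xi)) 0 0.

Hypothesis uB : col_mx B xi \in unitmx.

Lemma graph_in_proj (F : 'rV[R]_n -> R) p :
  vproj p = F (hproj p) -> p = graph_in o B xi F (hproj p).
Proof.
move=> E; rewrite /graph_in -E -addrA.
have -> : hproj p *m B + vproj p *: xi = p - o.
  rewrite /vproj -mul_scalar_mx -mx11_scalar -mul_row_col hsubmxK.
  by rewrite mulmxKV.
by rewrite addrC subrK.
Qed.

Let graph_inK (F : 'rV[R]_n -> R) x :
  (graph_in o B xi F x - o) *m invmx (col_mx B xi) = row_mx x (F x)%:M.
Proof.
have -> : graph_in o B xi F x - o = row_mx x (F x)%:M *m col_mx B xi.
  by rewrite mul_row_col mul_scalar_mx /graph_in addrC -addrA addrA addNr add0r.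
by rewrite mulmxK.
Qed.

Lemma hproj_graph_in (F : 'rV[R]_n -> R) x : hproj (graph_in o B xi F x) = x.
Proof. by rewrite /hproj graph_inK row_mxKl. Qed.

Lemma vproj_graph_in (F : 'rV[R]_n -> R) x : vproj (graph_in o B xi F x) = F x.
Proof. by rewrite /vproj graph_inK row_mxKr mxE eqxx mulr1n. Qed.

Lemma xi_frame : xi *m invmx (col_mx B xi) = row_mx 0 1%:M.
Proof.
have {1}-> : xi = row_mx 0 1%:M *m col_mx B xi.
  by rewrite mul_row_col mul0mx add0r mul1mx.
by rewrite mulmxK.
Qed.

Lemma B_frame : B *m invmx (col_mx B xi) = row_mx 1%:M 0.
Proof.
have {1}-> : B = row_mx 1%:M 0 *m col_mx B xi.
  by rewrite mul_row_col mul0mx addr0 mul1mx.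
by rewrite mulmxK.
Qed.

(** The matrix expressing (J, xi) in the basis (B, xi) is block triangular with corner 1, so its
    determinant is that of the horizontal part. *)
Lemma horizontal_part_unit (J : 'M[R]_(n, n + 1)) :
  (horizontal_part J B xi \in unitmx) = (col_mx J xi \in unitmx).
Proof.
have E : col_mx J xi = block_mx (horizontal_part J B xi)
    (rsubmx (J *m invmx (col_mx B xi))) 0 1%:M *m col_mx B xi.
  rewrite -[LHS](mulmxKV uB) mul_col_mx xi_frame; congr (_ *m _).
  by rewrite /block_mx hsubmxK.
by rewrite E unitmx_mul uB andbT !unitmxE det_ublock det1 mulr1.
Qed.

Lemma smooth_hproj (V : normedModType R) (U : set V) (f : V -> 'rV[R]_(n + 1)) :
  open U -> smooth_on U f -> smooth_on U (fun u => hproj (f u)).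
Proof.
move=> oU sf; apply/(smooth_mxP oU) => i j; rewrite /hproj.
under eq_fun do rewrite mxE.
apply: (smooth_mxP oU _).1; apply: smooth_mulmx => //; last exact: smooth_cst.
by apply: smoothD => //; exact: smooth_cst.
Qed.

Lemma smooth_vproj (V : normedModType R) (U : set V) (f : V -> 'rV[R]_(n + 1)) :
  open U -> smooth_on U f -> smooth_on U (fun u => vproj (f u)).
Proof.
move=> oU sf; rewrite /vproj; under eq_fun do rewrite mxE.
apply: (smooth_mxP oU _).1; apply: smooth_mulmx => //; last exact: smooth_cst.
by apply: smoothD => //; exact: smooth_cst.
Qed.

Lemma derive_proj (V : normedModType R) (f : V -> 'rV[R]_(n + 1)) x v :
  differentiable f x ->
  'D_v (fun u => hproj (f u)) x = lsubmx ('D_v f x *m invmx (col_mx B xi)) /\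
  'D_v (fun u => vproj (f u)) x =
    rsubmx ('D_v f x *m invmx (col_mx B xi)) 0 0.
Proof.
move=> df; pose q u := (f u - o) *m invmx (col_mx B xi).
have dfo : is_derive x v (fun u => f u - o) ('D_v f x - 0).
  by apply: is_deriveB; apply: derivableP; exact: diff_derivable.
have dfo' : differentiable (fun u => f u - o) x.
  by apply: differentiableB => //; exact: differentiable_cst.
have dq : differentiable q x.
  exact: (differentiable_mulmx dfo' (differentiable_cst _ _)).
have Dq : 'D_v q x = 'D_v f x *m invmx (col_mx B xi).
  rewrite (derive_mulmx v dfo' (differentiable_cst _ _)).
  by rewrite derive_cst mulmx0 addr0 (@derive_val _ _ _ _ _ _ _ dfo) subr0.
split; last first.
  rewrite -Dq mxE -(derive_entry v _ _ dq).
  by apply: (congr1 (fun k => 'D_v k x)); apply/funext => u; rewrite /vproj mxE.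
have dh : differentiable (fun u => hproj (f u)) x.
  apply/differentiable_mxP => i j; rewrite /hproj; under eq_fun do rewrite mxE.
  exact: (differentiable_mxP _ _).1 dq _ _.
apply/matrixP => i j; rewrite -(derive_entry v i j dh) -Dq mxE.
rewrite -(derive_entry v _ _ dq).
by apply: (congr1 (fun k => 'D_v k x)); apply/funext => u; rewrite /hproj mxE.
Qed.

End AffineProjections.

Section LocalStructure.
Context {R : realType} {n : nat}.
Variables (g : 'rV[R]_n -> 'rV[R]_(n + 1)) (xi : 'rV[R]_(n + 1)).
Variable O : set 'rV[R]_n.
Hypothesis oO : open O.
Hypothesis sg : smooth_on O g.
Hypothesis immg : forall u, O u -> immersed_at g u.
Hypothesis trg : forall u, O u -> transversal_at g xi u.
Hypothesis ndg : forall u, O u -> aff_form g xi u \in unitmx.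
Hypothesis parg : forall u, O u -> forall l i j k, nabla_K g xi l i j k u = 0.
Variables (o : 'rV[R]_(n + 1)) (B : 'M[R]_(n, n + 1)).
Hypothesis uB : col_mx B xi \in unitmx.

Let T := invmx (col_mx B xi).
Let phi u := hproj o B xi (g u).
Let F u := vproj o B xi (g u).
Let J u := lsubmx (jac g u *m T).
Let dF u : 'cV[R]_n := rsubmx (jac g u *m T).
Let h := aff_form g xi.
Let Gam u i := conn g xi i u.
Let K u i := diff_mx g xi i u.

Let sP : smooth_on O (fun u => jac g u *m T).
Proof.
apply: smooth_mulmx => //; last exact: smooth_cst.
exact: (smooth_jac oO sg).
Qed.

Let sJ : smooth_on O J.
Proof.
apply/(smooth_mxP oO) => i j; rewrite /J; under eq_fun do rewrite mxE.
exact: (smooth_mxP oO _).1 sP _ _.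
Qed.

Let sdF : smooth_on O dF.
Proof.
apply/(smooth_mxP oO) => i j; rewrite /dF; under eq_fun do rewrite mxE.
exact: (smooth_mxP oO _).1 sP _ _.
Qed.

Let sK i : smooth_on O (fun u => K u i).
Proof. exact: (smooth_diff_mx oO sg immg trg ndg). Qed.

Let uJ u : O u -> J u \in unitmx.
Proof.
move=> Ou; rewrite [_ \in _](horizontal_part_unit uB (jac g u)).
exact: (frame_unit sg immg trg Ou).
Qed.

Let symG u v w : O u -> v *m mx_comb (Gam u) w = w *m mx_comb (Gam u) v.
Proof.
by move=> Ou; apply: mul_rV_mx_comb_sym => a b c; exact: (@conn_sym R n g xi O oO sg u a b c Ou).
Qed.

Let symK u v w : O u -> v *m mx_comb (K u) w = w *m mx_comb (K u) v.
Proof.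
by move=> Ou; apply: mul_rV_mx_comb_sym => a b c; exact: (@diff_mx_sym R n g xi O oO sg u a b c Ou).
Qed.

Let Dg u v : O u -> 'D_v g u = v *m jac g u.
Proof.
move=> Ou; rewrite -(jacE sg Ou) deriveEjacobian//.
exact: smooth_differentiable sg Ou.
Qed.

Let Dphi u v : O u -> 'D_v phi u = v *m J u.
Proof.
move=> Ou; have [-> _] := derive_proj o B xi v (smooth_differentiable sg Ou).
by rewrite Dg// mulmx_lsub mulmxA.
Qed.

Let DF u v : O u -> 'D_v F u = (v *m dF u) 0 0.
Proof.
move=> Ou; have [_ ->] := derive_proj o B xi v (smooth_differentiable sg Ou).
by rewrite Dg// mulmx_rsub mulmxA.
Qed.

Let Djac u v : O u ->
  'D_v (jac g) u = mx_comb (Gam u) v *m jac g u + h u *m v^T *m xi.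
Proof.
move=> Ou; have dj := smooth_differentiable (smooth_jac oO sg) Ou.
rewrite (derive_pd v dj).
transitivity (\sum_l (v 0 l *: (Gam u l *m jac g u) +
    v 0 l *: (col l (h u) *m xi))).
  apply: eq_bigr => l _; rewrite -scalerDr; apply: congr1.
  exact: (derive_jac oO sg immg trg).
rewrite big_split /=; congr (_ + _).
  by rewrite mulmx_suml; apply: eq_bigr => l _; rewrite -scalemxAl.
rewrite [in RHS](row_sum_delta v) linear_sum mulmx_sumr mulmx_suml.
apply: eq_bigr => l _; rewrite linearZ /= -scalemxAr -scalemxAl trmx_delta.
by rewrite -colE.
Qed.

Let DP u v : O u -> 'D_v (fun u => jac g u *m T) u =
  mx_comb (Gam u) v *m (jac g u *m T) + h u *m v^T *m row_mx 0 1%:M.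
Proof.
move=> Ou; have dj := smooth_differentiable (smooth_jac oO sg) Ou.
rewrite (derive_mulmx v dj (differentiable_cst _ _)) derive_cst mulmx0 addr0.
by rewrite Djac// mulmxDl -!mulmxA (xi_frame uB).
Qed.

Let DJ u v : O u -> 'D_v J u = mx_comb (Gam u) v *m J u.
Proof.
move=> Ou; have dP := smooth_differentiable sP Ou.
have dJ := smooth_differentiable sJ Ou.
transitivity (lsubmx ('D_v (fun u => jac g u *m T) u)).
  apply/matrixP => i j; rewrite mxE -(derive_entry v _ _ dP).
  rewrite -(derive_entry v i j dJ).
  by apply: (congr1 (fun k => 'D_v k u)); apply/funext => y; rewrite /J mxE.
rewrite DP// mul_mx_row mulmx0 linearD /= row_mxKl addr0.
by rewrite -mulmx_lsub.
Qed.

Let DdF u v : O u -> 'D_v dF u = mx_comb (Gam u) v *m dF u + h u *m v^T.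
Proof.
move=> Ou; have dP := smooth_differentiable sP Ou.
have ddF := smooth_differentiable sdF Ou.
transitivity (rsubmx ('D_v (fun u => jac g u *m T) u)).
  apply/matrixP => i j; rewrite mxE -(derive_entry v _ _ dP).
  rewrite -(derive_entry v i j ddF).
  by apply: (congr1 (fun k => 'D_v k u)); apply/funext => y; rewrite /dF mxE.
rewrite DP// mul_mx_row mulmx1 linearD /= row_mxKr.
by rewrite -mulmx_rsub.
Qed.

Let Dh u v : O u -> 'D_v h u =
  (mx_comb (Gam u) v - mx_comb (K u) v) *m h u +
  h u *m (mx_comb (Gam u) v - mx_comb (K u) v)^T.
Proof.
move=> Ou; have dh := smooth_differentiable (smooth_h oO sg immg trg) Ou.
rewrite (derive_pd v dh).
have -> : mx_comb (Gam u) v - mx_comb (K u) v =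
    \sum_l v 0 l *: lc g xi l u.
  rewrite -sumrB; apply: eq_bigr => l _; rewrite -scalerBr; congr (_ *: _).
  by rewrite /K diff_mxE opprB addrC subrK.
rewrite linear_sum mulmx_suml mulmx_sumr -big_split; apply: eq_bigr => l _.
rewrite linearZ /= -scalemxAl -scalemxAr -scalerDr; apply: congr1.
exact: (lc_metric oO sg immg trg ndg).
Qed.

Let DK u v i : O u -> 'D_v (fun y => K y i) u =
  mx_comb (K u) (delta_mx 0 i *m mx_comb (Gam u) v) +
  (mx_comb (Gam u) v *m K u i - K u i *m mx_comb (Gam u) v).
Proof.
move=> Ou; have dK := smooth_differentiable (sK i) Ou.
rewrite (derive_pd v dK).
transitivity (\sum_l (v 0 l *: (\sum_m Gam u l i m *: K u m) +
    (v 0 l *: (Gam u l *m K u i) - v 0 l *: (K u i *m Gam u l)))).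
  apply: eq_bigr => l _; rewrite -scalerBr -scalerDr; apply: congr1.
  exact: (nabla_K_mx oO sg immg trg ndg parg).
rewrite big_split sumrB /=; congr (_ + (_ - _)).
- under eq_bigr => l _ do rewrite scaler_sumr.
  rewrite exchange_big; apply: eq_bigr => m _; rewrite -rowE.
  rewrite [row i _ 0 m]mxE summxE scaler_suml; apply: eq_bigr => l _.
  by rewrite [X in _ = X *: _]mxE scalerA.
- by rewrite mulmx_suml; apply: eq_bigr => l _; rewrite -scalemxAl.
- by rewrite mulmx_sumr; apply: eq_bigr => l _; rewrite -scalemxAr.
Qed.

Lemma hproj_jacobian_unit u : O u ->
  'J (fun u => hproj o B xi (g u)) u \in unitmx.
Proof.
move=> Ou; have dp := smooth_differentiable (smooth_hproj o B xi oO sg) Ou.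
suff -> : 'J (fun u => hproj o B xi (g u)) u = J u by exact: uJ.
apply/row_matrixP => i; rewrite (row_jacobian i dp) rowE.
exact: Dphi.
Qed.

(** The explicit values of [C], of [w0] and of the Hessian identify the data with the tangent
    algebra if B is the tangent frame, and let traces and determinants be compared for any other
    B. *)
Theorem local_structure u0 : O u0 ->
  exists (C : 'I_n -> 'M[R]_n) (gam : 'M[R]_n) (w0 : 'cV[R]_n) (e : R),
    let J0 := horizontal_part ('J g u0) B xi in
    [/\ 0 < e, ball u0 e `<=` O, flat_data C gam,
        hess_at C gam w0 = gram_in (aff_form g xi u0) ('J g u0) B xi &
        [/\ forall a, C a = invmx J0 *m
              mx_comb (fun i => diff_mx g xi i u0) (row a (invmx J0)) *m J0,
            w0 = invmx J0 *m rsubmx ('J g u0 *m T) &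
            forall u, ball u0 e u -> F u =
              sol C gam (F u0) w0 (phi u - phi u0)]].
Proof.
move=> Ou0; have /nbhs_ballP[e /= e0 BO] := open_nbhs_nbhs (conj oO Ou0).
have sphi : smooth_on O phi by exact: smooth_hproj.
have sF : smooth_on O F by exact: smooth_vproj.
have sh := smooth_h oO sg immg trg; have symh u := @h_sym _ _ _ xi _ oO sg u.
have [Cg E1 E2] := flat_frame_sol oO sphi sF sJ sh sdF sK uJ ndg symh symG symK
  Dphi DF DJ DdF Dh DK BO e0.
pose C a := frame_alg J K u0 (delta_mx 0 a).
exists C, (hess_at C (frame_hess J h u0) (- frame_grad J dF u0)).
exists (frame_grad J dF u0), e; cbv zeta.
have J0E : horizontal_part ('J g u0) B xi = J u0.
  by rewrite /horizontal_part (jacE sg Ou0).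
split; [exact: e0|exact: BO|exact: Cg| |].
  by rewrite E1 /gram_in J0E.
split; [move=> a| |exact: E2].
  by rewrite J0E rowE.
by rewrite J0E /frame_grad (jacE sg Ou0).
Qed.

End LocalStructure.

(** * Tensors of graphs of solutions *)

Section GraphTensors.
Context {R : realType} {n : nat}.
Variables (o : 'rV[R]_(n + 1)) (B : 'M[R]_(n, n + 1)) (xi : 'rV[R]_(n + 1)).
Hypothesis uB : col_mx B xi \in unitmx.

Section SmoothFunction.
Variables (F : 'rV[R]_n -> R) (sF : smooth_on setT F).
Let g := graph_in o B xi F.
Let dF x : 'cV[R]_n := \col_i pd i F x.

Lemma smooth_graph_in : smooth_on setT g.
Proof.
apply: smoothD; [exact: openT| |].
  apply: smoothD; [exact: openT|exact: smooth_cst|].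
  apply: smooth_mulmx; [exact: openT|exact: smooth_id|exact: smooth_cst].
apply: (@smooth_congr _ _ _ openT _ (fun x => (F x)%:M *m xi)).
  by move=> x _; rewrite mul_scalar_mx.
apply: smooth_mulmx; [exact: openT| |exact: smooth_cst].
apply/(smooth_mxP openT) => i j; rewrite !ord1.
by under eq_fun do rewrite mxE eqxx mulr1n.
Qed.

Let dg x : differentiable g x.
Proof. exact: (smooth_differentiable smooth_graph_in). Qed.

Let dFx x : differentiable F x.
Proof. exact: (smooth_differentiable sF). Qed.

Let pdg i : pd i g = fun x => row i B + pd i F x *: xi.
Proof.
apply/funext => x; rewrite rowE.
have dB : is_derive x (delta_mx 0 i : 'rV[R]_n) (fun x => o + x *m B)
    (0 + delta_mx 0 i *m B).
  apply: is_deriveD; have dx : differentiable (fun x : 'rV[R]_n => x *m B) x.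
    by apply: differentiable_mulmx; [exact: ex_diff|exact: differentiable_cst].
  apply: DeriveDef; first exact: diff_derivable.
  rewrite derive_mulmx; [|exact: ex_diff|exact: differentiable_cst].
  by rewrite derive_cst derive_id mulmx0 addr0.
have dX : is_derive x (delta_mx 0 i : 'rV[R]_n) (fun x => F x *: xi)
    (pd i F x *: xi).
  have dXx : differentiable (fun x : 'rV[R]_n => F x *: xi) x.
    by apply: differentiableZl.
  apply: DeriveDef; first exact: diff_derivable.
  by rewrite deriveE// diffZl// /pd deriveE.
have := is_deriveD dB dX => /(@derive_val _ _ _ _ _ _ _).
by rewrite add0r.
Qed.

Lemma jacobian_graph_in x : 'J g x = B + dF x *m xi.
Proof.
apply/row_matrixP => i; rewrite row_jacobian// pdg linearD /= row_mul.
by congr (_ + _); rewrite (mx11_scalar (row i _)) mul_scalar_mx !mxE.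
Qed.

Lemma graph_in_frame_unit x : col_mx ('J g x) xi \in unitmx.
Proof.
have -> : col_mx ('J g x) xi = block_mx 1%:M (dF x) 0 1%:M *m col_mx B xi.
  by rewrite jacobian_graph_in mul_block_col !mul1mx mul0mx add0r.
by rewrite unitmx_mul uB andbT unitmxE det_ublock !det1 mulr1 unitr1.
Qed.

Lemma graph_in_immersed x : immersed_at g x /\ transversal_at g xi x.
Proof.
by have := graph_in_frame_unit x; rewrite unitmx_col_mx => /andP[].
Qed.

(** The second derivatives of a graph point along [xi]; hence the induced connection vanishes and h
    is the Hessian. *)
Let gauss_graph x i j :
  gauss g xi x i j = row_mx 0 (hessian F x i j)%:M.
Proof.
rewrite /gauss !pdg.
have -> : pd i (fun x => row j B + pd j F x *: xi) x = hessian F x i j *: xi.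
  have dpd : differentiable (pd j F) x.
    have sd : smooth_on setT (pd j F) by exact: smooth_derive.
    exact: (smooth_differentiable sd).
  have dX : is_derive x (delta_mx 0 i : 'rV[R]_n)
      (fun x => pd j F x *: xi) (pd i (pd j F) x *: xi).
    have dX : differentiable (fun y => pd j F y *: xi) x.
      exact: differentiableZl.
    apply: DeriveDef; first exact: diff_derivable.
    rewrite (deriveE _ dX) (diffZl _ dpd) /pd; congr (_ *: _).
    by rewrite (deriveE _ dpd).
  have := is_deriveD (is_derive_cst (row j B) x (delta_mx 0 i)) dX.
  by move=> /(@derive_val _ _ _ _ _ _ _); rewrite add0r mxE.
rewrite -scalemxAl (xi_frame (graph_in_frame_unit x)).
by rewrite scale_row_mx scaler0 scale_scalar_mx mulr1.
Qed.

Lemma induced_conn_graph_in i j k x : induced_conn g xi i j k x = 0.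
Proof. by rewrite /induced_conn gauss_graph row_mxKl mxE. Qed.

Lemma aff_form_graph_in x : aff_form g xi x = hessian F x.
Proof.
apply/matrixP => i j.
by rewrite [LHS]mxE gauss_graph row_mxKr [LHS]mxE eqxx mulr1n.
Qed.

End SmoothFunction.

Section Solution.
Variables (C : 'I_n -> 'M[R]_n) (gam : 'M[R]_n) (f0 : R) (w0 : 'cV[R]_n).
Variable x0 : 'rV[R]_n.
Hypothesis Cg : flat_data C gam.
Hypothesis uH : hess_at C gam w0 \in unitmx.
Let F x := sol C gam f0 w0 (x - x0).
Let g := graph_in o B xi F.

Let F_shift : exists f1 w1, F = sol C gam f1 w1 /\
  forall x, hess_at C gam (sol_grad C gam f1 w1 x) \in unitmx.
Proof.
have [f1 [w1 [E1 E2]]] := sol_shift Cg f0 w0 x0.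
exists f1, w1; split; first by apply/funext => x; exact: E1.
by move=> x; rewrite -E2; exact: hess_unit.
Qed.

Lemma smooth_sol_shift : smooth_on setT F.
Proof. by have [f1 [w1 [-> _]]] := F_shift; exact: smooth_sol. Qed.

Lemma aff_form_sol_unit x : aff_form g xi x \in unitmx.
Proof.
rewrite aff_form_graph_in; last exact: smooth_sol_shift.
by have [f1 [w1 [-> u]]] := F_shift; rewrite hessian_sol.
Qed.

(** As nabla is the coordinate derivative, K is minus the Levi-Civita connection. The derivatives of
    h form the totally symmetric tensor -2 C H, so the three terms of the Christoffel formula reduce
    to one, and the factors -1/2 and -2 cancel. *)
Lemma difference_tensor_sol i j k x : difference_tensor g xi i j k x = C i j k.
Proof.
rewrite /difference_tensor induced_conn_graph_in; last exact: smooth_sol_shift.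
have [f1 [w1 [FE u]]] := F_shift.
pose H y := hess_at C gam (sol_grad C gam f1 w1 y).
have hE a b : h_ g xi a b = fun y => H y a b.
  apply/funext => y; rewrite /h_ aff_form_graph_in; last exact: smooth_sol_shift.
  by rewrite FE hessian_sol.
have Dh a b l : pd l (h_ g xi a b) x = -2 * (C l *m H x) a b.
  have [dH DH] := derive_sol_hess Cg f1 w1 x (delta_mx 0 l).
  rewrite hE /pd (derive_entry (delta_mx 0 l) a b dH) DH mx_comb_delta.
  by rewrite mxE.
have [_ sC _ _] := Cg.
have rot a b l : (C a *m H x) b l = (C b *m H x) a l.
  exact: (mul_C_hess_at_rot Cg).
have tr a b l : (C a *m H x) b l = (C a *m H x) l b.
  suff E : (C a *m H x)^T = C a *m H x by rewrite -{1}E mxE.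
  by rewrite trmx_mul (hess_at_sym Cg) -(mul_C_hess_at Cg).
rewrite /levi_civita sub0r.
have -> : aff_form g xi x = H x.
  by rewrite aff_form_graph_in; [rewrite FE hessian_sol|exact: smooth_sol_shift].
under eq_bigr => l _.
  rewrite !Dh (rot j i l) (rot l i j) (tr i l j).
  have -> : -2 * (C i *m H x) j l + -2 * (C i *m H x) j l -
      -2 * (C i *m H x) j l = -2 * (C i *m H x) j l by rewrite addrK.
  rewrite (tr i j l) mulrCA (mul_C_hess_at Cg); over.
rewrite -mulr_sumr mulrA mulrN mulVf ?pnatr_eq0// mulN1r opprK.
transitivity ((invmx (H x) *m (H x *m (C i)^T)) k j); first by rewrite [RHS]mxE.
by rewrite (mulKmx (u x)) [LHS]mxE.
Qed.

Lemma nabla_K_sol l i j k x : nabla_K g xi l i j k x = 0.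
Proof.
have s := smooth_sol_shift.
rewrite /nabla_K.
under eq_bigr do rewrite (induced_conn_graph_in s) mul0r.
under [X in _ - X - _]eq_bigr do rewrite (induced_conn_graph_in s) mul0r.
under [X in _ - X]eq_bigr do rewrite (induced_conn_graph_in s) mul0r.
rewrite !big1_eq !subr0 addr0.
have -> : difference_tensor g xi i j k = cst (C i j k).
  by apply/funext => y; exact: difference_tensor_sol.
by rewrite /pd derive_cst.
Qed.

End Solution.

End GraphTensors.

(** * Algebras and their potentials *)

Section AlgebraInCoordinates.
Context {R : realType} {A : vectType R} {n : nat}.
Variables (mul : A -> A -> A) (gam : A -> A -> R).
(** [pt] is the identity for a tangent space and [vec_of X] for an abstract algebra with basis X. *)
Variables (C : 'I_n -> 'M[R]_n) (G : 'M[R]_n) (pt : 'rV[R]_n -> A).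
Hypothesis Cg : flat_data C G.
Hypothesis mulE : forall x y, mul (pt x) (pt y) = pt (y *m mx_comb C x).
Hypothesis gamE : forall x y, gam (pt x) (pt y) = (x *m G *m y^T) 0 0.

(** The power with k + 1 factors. *)
Let pow (x : 'rV[R]_n) k : 'rV[R]_n := iter k (fun y => y *m mx_comb C x) x.

Lemma alg_powE x k : alg_pow mul (pt x) k.+1 = pt (pow x k).
Proof. by rewrite /alg_pow /=; elim: k => //= k ->; rewrite mulE. Qed.

(** On the column (0, 0, 1), the first application of [aug] creates the covector of x, each
    intermediate one multiplies it by -2 C_x, and the last pairs it with x. This accounts for the
    coefficient (-2)^(k-2) in degree k. *)
Let augX x k : aug C G x ^+ k.+2 *m col_mx 0 (col_mx 0 1%:M) =
  col_mx ((-2) ^+ k *: (x *m G *m (pow x k)^T))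
    (col_mx ((-2) ^+ k.+1 *: (G *m (pow x k.+1)^T)) 0) :> 'cV[R]_(1 + (n + 1)).
Proof.
have powS l : mx_comb C x *m (G *m (pow x l)^T) = G *m (pow x l.+1)^T.
  by rewrite mulmxA (mx_comb_gam Cg) -mulmxA -trmx_mul.
elim: k => [|k IH].
  rewrite exprS expr1 -mulmxE -mulmxA !aug_col !mulmx0 !add0r mulmx1.
  by rewrite addr0 expr0 expr1 scale1r mulmxA -scalemxAl (powS 0%N).
rewrite exprS -mulmxE -mulmxA IH aug_col mulmx0 addr0 -scalemxAr mulmxA.
congr col_mx; congr col_mx.
by rewrite -scalemxAl -scalemxAr scalerA -exprS powS.
Qed.

Theorem potential_partial_sum_cvg x :
  potential_partial_sum mul gam (pt x) @ \oo --> sol C G 0 0 x.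
Proof.
set B : 'cV[R]_(1 + (n + 1)) := col_mx 0 (col_mx 0 1%:M).
have := @mexp_series R n _ _ (augN_comm Cg) _ _ 1%:M B x (lshift _ 0) 0.
rewrite mul1mx (_ : (mexp _ x *m B) _ 0 = sol C G 0 0 x); last first.
  by rewrite /sol [RHS]mxE /sol_col (raddf0 (@scalar_mx R 1)).
set u := series _; suff -> : potential_partial_sum mul gam (pt x) = u by [].
apply/esym/funext => N.
rewrite /series /= /potential_partial_sum [RHS](big_nat_widenl _ 0%N)//=.
rewrite [RHS]big_mkcond; apply: eq_bigr => k _ /=.
(* The terms of degree 0 and 1 vanish because value and gradient are 0 at the origin; hence the
   series starts at k = 2. *)
rewrite mul1mx mx_comb_aug; case: k => [|[|k]] /=.
- by rewrite expr0 mul1mx col_mxEu mxE mul0r.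
- by rewrite expr1 aug_col mulmx0 col_mxEu mxE mul0r.
rewrite augX col_mxEu mxE subSS subSS subn0 alg_powE gamE.
by rewrite mulrAC.
Qed.

End AlgebraInCoordinates.

Section FlatAlgebra.
Context {R : realType} {n : nat}.
Variables (C : 'I_n -> 'M[R]_n) (G : 'M[R]_n).
Hypothesis Cg : flat_data C G.
Let mul (u v : 'rV[R]_n) : 'rV[R]_n := v *m mx_comb C u.
Let gam (u v : 'rV[R]_n) : R := (u *m G *m v^T) 0 0.

Lemma flat_mulC : commutative mul.
Proof. by move=> u v; rewrite /mul (mul_rV_mx_comb Cg). Qed.

Lemma flat_mulA : associative mul.
Proof.
move=> u v w; rewrite [RHS]flat_mulC [in LHS](flat_mulC v w) /mul.
by rewrite -!mulmxA (mx_combC Cg).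
Qed.

Lemma flat_metrised : G \in unitmx -> metrised_algebra mul gam.
Proof.
move=> uG; have [_ _ sG _] := Cg; have symg u v : gam u v = gam v u.
  rewrite /gam -[in LHS](trmxK (u *m G *m v^T)) mxE !trmx_mul trmxK sG.
  by rewrite mulmxA.
have ling u : scalar (gam u).
  by move=> a v w; rewrite /gam linearP mulmxDr -scalemxAr !mxE.
split.
- split=> u a v w; first by rewrite /mul mulmxDl scalemxAl.
  by rewrite /mul mx_comb_linear mulmxDr -scalemxAr.
- split=> // u a v w; rewrite ![gam _ u]symg; exact: ling.
- exact: symg.
- move=> u u0; apply/eqP; rewrite -(mulmxK uG u); apply/eqP.
  suff -> : u *m G = 0 by rewrite mul0mx.
  apply/rowP => j; have := u0 (delta_mx 0 j).
  by rewrite /gam trmx_delta -colE !mxE.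
- move=> u v w; rewrite flat_mulC /gam /mul -(mulmxA u) (mx_comb_gam Cg).
  by rewrite trmx_mul !mulmxA.
Qed.

End FlatAlgebra.

Section CoordinateAlgebra.
Context {R : realType} {A : vectType R} {n : nat}.
Variables (mul : A -> A -> A) (gam : A -> A -> R) (X : n.-tuple A).
Hypothesis metA : metrised_algebra mul gam.
Hypothesis mulC : commutative mul.
Hypothesis mulA : associative mul.
Hypothesis bX : basis_of fullv X.

Definition struct_mx (i : 'I_n) : 'M[R]_n :=
  \matrix_(j, k) coord X k (mul X`_i X`_j).

Definition vec_of (x : 'rV[R]_n) : A := \sum_i x 0 i *: X`_i.

Lemma coord_vec_of x k : coord X k (vec_of x) = x 0 k.
Proof.
rewrite /vec_of linear_sum (bigD1 k)//= big1 => [|i /negbTE ik].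
  by rewrite addr0 linearZ /= coord_free ?eqxx ?mulr1// (basis_free bX).
by rewrite linearZ /= coord_free ?(basis_free bX)// ik mulr0.
Qed.

Lemma vec_of_coord v : v = vec_of (\row_k coord X k v).
Proof.
rewrite {1}(coord_basis bX (memvf v)).
by apply: eq_bigr => i _; rewrite mxE.
Qed.

Lemma vec_of_inj : injective vec_of.
Proof.
by move=> x y E; apply/rowP => k; rewrite -!coord_vec_of E.
Qed.

Lemma vec_of_delta i : vec_of (delta_mx 0 i) = X`_i.
Proof.
rewrite /vec_of (bigD1 i)//= big1 => [|j /negbTE ji].
  by rewrite mxE !eqxx scale1r addr0.
by rewrite mxE ji andbF scale0r.
Qed.

Lemma vec_of_mul x y : mul (vec_of x) (vec_of y) = vec_of (y *m mx_comb struct_mx x).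
Proof.
have [[linr linl] _ _ _ _] := metA.
pose L u : {linear A -> A} := HB.pack (mul u) (GRing.isLinear.Build _ _ _ _ _ (linr u)).
pose L' v : {linear A -> A} := HB.pack (mul^~ v) (GRing.isLinear.Build _ _ _ _ _ (linl v)).
rewrite [LHS]vec_of_coord; congr vec_of; apply/rowP => k; rewrite mxE.
rewrite -[mul _ _]/(L' (vec_of y) (vec_of x)) {2}/vec_of !linear_sum.
rewrite summxE; apply: eq_bigr => i _.
rewrite !linearZ_LR /= [RHS]mxE; congr (_ * _).
rewrite -[mul _ _]/(L X`_i (vec_of y)) {1}/vec_of !linear_sum mxE.
by apply: eq_bigr => j _; rewrite !linearZ_LR /= mxE.
Qed.

Lemma vec_of_gam x y :
  gam (vec_of x) (vec_of y) = (x *m gram_of gam X *m y^T) 0 0.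
Proof.
have [_ [linr linl] _ _ _] := metA.
pose L u : {linear A -> R^o} := HB.pack (gam u) (GRing.isLinear.Build _ _ _ _ _ (linr u)).
pose L' v : {linear A -> R^o} := HB.pack (gam^~ v) (GRing.isLinear.Build _ _ _ _ _ (linl v)).
rewrite -[gam _ _]/(L (vec_of x) (vec_of y)) {2}/vec_of linear_sum mxE.
apply: eq_bigr => j _; rewrite linearZ_LR [y^T _ _]mxE /= mulrC; congr (_ * _).
rewrite -[gam _ _]/(L' X`_j (vec_of x)) {1}/vec_of linear_sum mxE.
by apply: eq_bigr => i _; rewrite linearZ_LR /= mxE.
Qed.

(** The multiplications commute by associativity and commutativity together; their self-adjointness
    is the invariance of [gam]. *)
Lemma flat_data_struct : flat_data struct_mx (gram_of gam X).
Proof.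
have [_ _ symg _ inv] := metA; split.
- move=> a b; apply/row_matrixP => i; rewrite !rowE; apply: vec_of_inj.
  rewrite !mulmxA -(mx_comb_delta struct_mx a) -(mx_comb_delta struct_mx b).
  by rewrite -!vec_of_mul !mulA (mulC (vec_of (delta_mx 0 a))).
- by move=> a b c; rewrite !mxE mulC.
- by apply/matrixP => a b; rewrite !mxE symg.
- move=> a; apply/matrixP => b c.
  transitivity (gam (mul X`_a X`_b) X`_c).
    rewrite -!vec_of_delta vec_of_mul vec_of_gam mx_comb_delta.
    by rewrite -!mulmxA trmx_delta -colE -rowE !mxE; apply: eq_bigr => d _; rewrite !mxE.
  rewrite mulC inv -!vec_of_delta vec_of_mul vec_of_gam mx_comb_delta.
  rewrite trmx_mul trmx_delta -!mulmxA -rowE -colE !mxE.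
  by apply: eq_bigr => d _; rewrite !mxE.
Qed.

Lemma gram_of_unit : gram_of gam X \in unitmx.
Proof.
rewrite -row_free_unit -kermx_eq0; apply/eqP/row_matrixP => i.
rewrite row0; set x := row i _; have xG : x *m gram_of gam X = 0.
  by rewrite -row_mul mulmx_ker row0.
have [_ _ _ nd _] := metA.
apply: vec_of_inj; rewrite [RHS](_ : _ = 0); last first.
  by rewrite /vec_of big1// => k _; rewrite mxE scale0r.
apply: nd => v; rewrite (vec_of_coord v) vec_of_gam xG mul0mx mxE.
by [].
Qed.

End CoordinateAlgebra.

(** * Traces and nilpotency *)

Section TraceNilpotent.
Context {F : fieldType}.

Lemma expr_mul_swap m n (P : 'M[F]_(m, n)) (Q : 'M[F]_(n, m)) k :
  (Q *m P) ^+ k.+1 = Q *m (P *m Q) ^+ k *m P.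
Proof.
elim: k => [|k IH]; first by rewrite expr1 expr0 mulmx1.
by rewrite exprS IH -mulmxE [in RHS]exprS -mulmxE !mulmxA.
Qed.

(* A factorisation [N = P *m Q] through the rank of [N] reduces the statement to
   the smaller matrix [Q *m P]. *)
Lemma nilpotent_mxtrace n (N : 'M[F]_n) k : N ^+ k = 0 -> \tr N = 0.
Proof.
have [m] := ubnP n; elim: m n N k => // m IH n N k nm Nk.
have [uN|/negP uN] := boolP (N \in unitmx).
  case: n N nm Nk uN => [|n] N nm Nk uN; first by rewrite /mxtrace big_ord0.
  have := unitrX k uN; rewrite Nk unitr0.
  by [].
rewrite -(mulmx_base N) mxtrace_mulC; apply: (IH _ _ k.+1).
  rewrite ltnS in nm; apply: leq_trans nm; rewrite ltn_neqAle rank_leq_row andbT.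
  by apply/negP => /eqP rN; apply: uN; rewrite -row_free_unit /row_free rN.
by rewrite expr_mul_swap mulmx_base Nk mulmx0 mul0mx.
Qed.

(** Converse by induction on the size. A singular N = P Q is replaced by the smaller Q P, whose
    powers have the same traces; an invertible N has size 0. *)
Lemma mxtrace_nilpotent n (N : 'M[F]_n) : [pchar F] =i pred0 ->
  (forall k, \tr (N ^+ k.+1) = 0) -> exists k, N ^+ k = 0.
Proof.
move=> pF; have [m] := ubnP n; elim: m n N => // m IH n N nm tN.
have [uN|/negP uN] := boolP (N \in unitmx).
  case: n N nm tN uN => [|n] N nm tN uN.
    by exists 0%N; apply/matrixP => -[].
  (* Taking traces in the characteristic equation gives [n * \det N = 0]. *)
  have /(congr1 mxtrace) := Cayley_Hamilton N.
  have -> : char_poly N = \sum_(i < n.+2) (char_poly N)`_i *: 'X^i.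
    by rewrite -[LHS]coefK poly_def size_char_poly.
  rewrite linear_sum /= linear_sum big_ord_recl.
  rewrite big1 => [|i _]; last first.
    by rewrite linearZ rmorphXn /= horner_mx_X linearZ /= tN mulr0.
  rewrite addr0 linear0 linearZ rmorphXn /= expr0 linearZ /= mxtrace1.
  rewrite char_poly_det => /eqP.
  rewrite !mulf_eq0 signr_eq0 (pcharf0P _).1//=.
  by rewrite unitmxE unitfE in uN; rewrite (negbTE uN).
have [||k Nk] := IH _ (row_base N *m col_base N).
- rewrite ltnS in nm; apply: leq_trans nm; rewrite ltn_neqAle rank_leq_row andbT.
  by apply/negP => /eqP rN; apply: uN; rewrite -row_free_unit /row_free rN.
- by move=> k; rewrite expr_mul_swap -mulmxA mxtrace_mulC -mulmxA mulmx_base mulmxE -exprSr.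
exists k.+1; rewrite -{1}(mulmx_base N) expr_mul_swap Nk.
by rewrite mulmx0 mul0mx.
Qed.

End TraceNilpotent.

Section CommutingNilpotents.
Context {R : realType} {n : nat}.
Variable C : 'I_n -> 'M[R]_n.
Hypothesis CC : forall a b, C a *m C b = C b *m C a.

Let word (s : seq 'I_n) : 'M[R]_n := foldr (fun a M => C a *m M) 1%:M s.
Definition mx_comb_word (vs : seq 'rV[R]_n) : 'M[R]_n :=
  foldr (fun v M => mx_comb C v *m M) 1%:M vs.

Let CX a b k : C a ^+ k *m C b = C b *m C a ^+ k.
Proof.
by rewrite !mulmxE; apply/commr_sym/commrX; rewrite /GRing.comm -!mulmxE.
Qed.

(** The exponent k collects the letters a already moved to the front of the word. *)
Let word_eq0 N a s k : C a ^+ N = 0 -> (N <= count_mem a s + k)%N ->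
  C a ^+ k *m word s = 0.
Proof.
move=> CN; elim: s k => [|b s IH] k /=.
  by rewrite add0n => /subnK <-; rewrite exprD CN mulr0 mul0mx.
have [->|ba] := eqVneq b a; rewrite ?add1n ?add0n.
  by rewrite addSnnS mulmxA mulmxE -exprSr; exact: IH.
by move=> H; rewrite mulmxA CX -mulmxA IH// mulmx0.
Qed.

Let size_count (s : seq 'I_n) : size s = (\sum_a count_mem a s)%N.
Proof.
elim: s => /= [|b s ->]; first by rewrite big1.
rewrite big_split /= -add1n; congr (_ + _)%N.
by rewrite (bigD1 b)//= eqxx big1 // => a /negbTE ab; rewrite eq_sym ab.
Qed.

(** Pigeonhole: a word with more than [n * N] letters contains one of the n letters at least N
    times. *)
Let long_word N s : (forall a, C a ^+ N = 0) -> (n * N < size s)%N -> word s = 0.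
Proof.
move=> CN sN; suff /existsP[a aN] : [exists a, N <= count_mem a s]%N.
  have := @word_eq0 N a s 0%N (CN a); rewrite addn0 => /(_ aN).
  by rewrite expr0 mul1mx.
apply: contraLR sN; rewrite negb_exists -leqNgt => /forallP sN.
rewrite size_count -[X in (X * _)%N]card_ord -sum_nat_const.
by apply: leq_sum => a _; have := sN a; rewrite -ltnNge => /ltnW.
Qed.

Lemma mx_comb_word_eq0 N vs : (forall a, C a ^+ N = 0) ->
  (n * N < size vs)%N -> mx_comb_word vs = 0.
Proof.
(* [s] records the basis indices chosen in the factors already expanded; the length of the word and
   the number of remaining factors have a constant sum. *)
move=> CN; suff H s : (n * N < size s + size vs)%N -> word s *m mx_comb_word vs = 0.
  by move=> vN; rewrite -[LHS]mul1mx; exact: (H [::]).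
elim: vs s => [|v vs IH] s /=.
  by rewrite addn0 mulmx1; exact: long_word.
move=> sN; rewrite mulmxA mulmx_sumr mulmx_suml big1// => a _.
have -> : word s *m (v 0 a *: C a) = v 0 a *: word (rcons s a).
  rewrite -scalemxAr; congr (_ *: _); elim: s {sN} => /= [|b s IHs].
    by rewrite mul1mx mulmx1.
  by rewrite -mulmxA IHs.
by rewrite -scalemxAl IH ?scaler0// size_rcons addSnnS.
Qed.

Lemma mx_comb_word_cat s t :
  mx_comb_word (s ++ t) = mx_comb_word s *m mx_comb_word t.
Proof. by elim: s => [|v s IH] /=; rewrite ?mul1mx// IH mulmxA. Qed.

End CommutingNilpotents.

Section NilpotentAlgebra.
Context {R : realType} {A : vectType R} {n : nat}.
Variables (mul : A -> A -> A) (C : 'I_n -> 'M[R]_n) (G : 'M[R]_n).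
Variable pt : 'rV[R]_n -> A.
Hypothesis Cg : flat_data C G.
Hypothesis mulE : forall x y, mul (pt x) (pt y) = pt (y *m mx_comb C x).
Hypothesis pt_inj : injective pt.
Hypothesis pt_surj : forall v, exists x, v = pt x.
Hypothesis pt0 : pt 0 = 0.

Let CC a b : C a *m C b = C b *m C a. Proof. by have [] := Cg. Qed.

(** Associativity in operator form: [struct_mul] extended bilinearly. *)
Lemma mx_combM u v : mx_comb C (v *m mx_comb C u) = mx_comb C v *m mx_comb C u.
Proof.
have lC := mx_comb_linear C.
pose L : {linear 'rV[R]_n -> 'M[R]_n} := HB.pack (mx_comb C)
  (GRing.isLinear.Build _ _ _ _ _ lC).
rewrite mulmx_sumr -[LHS]/(L _) linear_sum [in RHS]mulmx_sumr.
apply: eq_bigr => a _; rewrite -!scalemxAr linearZ_LR; congr (_ *: _).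
rewrite {1}(row_sum_delta v) mulmx_suml linear_sum mulmx_suml.
apply: eq_bigr => b _; rewrite -!scalemxAl linearZ_LR; congr (_ *: _).
rewrite /= -rowE CC -(struct_mul Cg); apply: eq_bigr => d _.
by rewrite mxE; have [_ -> _ _] := Cg.
Qed.

Let mx_combX v k : exists w, mx_comb C v ^+ k.+1 = mx_comb C w.
Proof.
elim: k => [|k [w IH]]; first by exists v; rewrite expr1.
by exists (v *m mx_comb C w); rewrite exprS IH mx_combM.
Qed.

Let mx_comb_mul_word w vs :
  mx_comb C (w *m mx_comb_word C vs) = mx_comb C w *m mx_comb_word C vs.
Proof.
elim: vs w => /= [|v vs IH] w; first by rewrite !mulmx1.
by rewrite !mulmxA IH mx_combM.
Qed.

(** Any bracketing flattens, by associativity and commutativity, to one vector followed by m - 1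
    multiplications. *)
Let productE m x : is_product mul m x -> exists w vs,
  x = pt (w *m mx_comb_word C vs) /\ (size vs).+1 = m.
Proof.
elim=> [u|p q u u' _ [v [vs [-> <-]]] _ [w [ws [-> <-]]]].
  by have [w ->] := pt_surj u; exists w, [::]; rewrite mulmx1.
exists w, (ws ++ v :: vs); split; last by rewrite size_cat /= addnC addSn addnS.
by rewrite mulE mx_comb_word_cat /= mx_comb_mul_word !mulmxA.
Qed.

Let product_pow x v k : is_product mul k.+1 (pt (x *m mx_comb C v ^+ k)).
Proof.
elim: k => [|k IH]; first by rewrite expr0 mulmx1; exact: Product1.
rewrite exprSr -mulmxE mulmxA -mulE -(addn1 k.+1) addnC.
exact: ProductM (Product1 _ _) IH.
Qed.

Lemma nilpotent_algebraP :
  nilpotent_algebra mul <-> forall a, \tr (C a) = 0.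
Proof.
split=> [[m m0 mul0] a|tr0].
  (* A vector and m - 1 multiplications make m factors. *)
  apply: (@nilpotent_mxtrace _ _ _ m.-1); rewrite -(mx_comb_delta C a).
  apply/row_matrixP => i; rewrite row0 rowE; apply: pt_inj; rewrite pt0.
  apply: mul0; rewrite -[X in is_product _ X _](prednK m0).
  exact: product_pow.
have nil a : exists k, C a ^+ k = 0.
  apply: mxtrace_nilpotent => [|k]; first exact: pchar_num.
  rewrite -mx_comb_delta; have [w ->] := mx_combX (delta_mx 0 a) k.
  by rewrite linear_sum big1// => b _; rewrite linearZ /= tr0 mulr0.
have [k Ck] := choice nil; pose N := \max_a k a.
have CN a : C a ^+ N = 0.
  have kN : (k a <= N)%N by exact: (leq_bigmax (F := k) a).
  by rewrite -(subnK kN) exprD Ck mulr0.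
(* Such a product involves [n * N + 1] multiplications, one more than the bound of
   [mx_comb_word_eq0]. *)
exists (n * N).+2 => // x /productE[w [vs [-> /eqP]]].
rewrite eqSS => /eqP sv; rewrite (mx_comb_word_eq0 CC CN) ?mulmx0 ?pt0//.
by rewrite sv.
Qed.

End NilpotentAlgebra.

(** * The determinant of the Hessian *)

Section HessianDeterminant.
Context {R : realType} {n : nat}.

Lemma hessian_congr (U : set 'rV[R]_n) (F G : 'rV[R]_n -> R) x :
  open U -> (forall y, U y -> F y = G y) -> U x -> hessian F x = hessian G x.
Proof.
move=> oU FG Ux; have pdFG j y : U y -> pd j F y = pd j G y.
  move=> Uy; apply: near_eq_derive.
  by apply: filterS (open_nbhs_nbhs (conj oU Uy)) => z; exact: FG.
apply/matrixP => i j; rewrite [LHS]mxE [RHS]mxE; apply: near_eq_derive.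
by apply: filterS (open_nbhs_nbhs (conj oU Ux)) => z; exact: pdFG.
Qed.

Variables (C : 'I_n -> 'M[R]_n) (gam : 'M[R]_n) (f0 : R) (w0 : 'cV[R]_n).
Variable x0 : 'rV[R]_n.
Hypothesis Cg : flat_data C gam.
Hypothesis uH : hess_at C gam w0 \in unitmx.
Let G x := sol C gam f0 w0 (x - x0).

Let shift : exists f1 w1, [/\ G = sol C gam f1 w1,
  sol_grad C gam f1 w1 x0 = w0 &
  forall x, hess_at C gam (sol_grad C gam f1 w1 x) \in unitmx].
Proof.
have [f1 [w1 [E1 E2]]] := sol_shift Cg f0 w0 x0.
exists f1, w1; split; first by apply/funext => x; exact: E1.
  by rewrite -E2 subrr sol_grad0.
by move=> x; rewrite -E2; exact: hess_unit.
Qed.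

Lemma det_hessian_sol x : (forall a, \tr (C a) = 0) ->
  \det (hessian G x) = \det (hess_at C gam w0).
Proof.
move=> tr0; have [f1 [w1 [-> E _]]] := shift; rewrite (hessian_sol Cg) -E.
pose d y := \det (hess_at C gam (sol_grad C gam f1 w1 y)).
have D y v := derive_det_hess Cg f1 w1 y v.
apply: (@derive_cst_ball R 'rV[R]_n d x0 (`|x0 - x| + 1)).
- by move=> y _; have [] := D y 0.
- move=> y _ v; have [_ ->] := D y v; rewrite [\tr _](_ : _ = 0) ?mulr0 ?mul0r//.
  by rewrite linear_sum big1// => a _; rewrite linearZ /= tr0 mulr0.
- by rewrite -ball_normE /= ltrDl.
Qed.

(** The square of the determinant is 1 on [W], which disposes of the absolute value. Its derivative,
    -4 tr(C_a) times the square, must vanish. *)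
Lemma det_hessian_trace (W : set 'rV[R]_n) x1 : open W -> W x1 ->
  (forall x, W x -> `|\det (hessian G x)| = 1) -> forall a, \tr (C a) = 0.
Proof.
have [f1 [w1 [-> _ u]]] := shift => oW Wx1 W1 a.
pose d y := \det (hess_at C gam (sol_grad C gam f1 w1 y)).
have [dd Dd] := derive_det_hess Cg f1 w1 x1 (delta_mx 0 a).
have dx1 : d x1 != 0 by have := u x1; rewrite unitmxE unitfE.
have : 'D_(delta_mx 0 a) (d * d) x1 = 0.
  transitivity ('D_(delta_mx 0 a : 'rV[R]_n) (cst (1 : R)) x1); last exact: derive_cst.
  apply: near_eq_derive; apply: filterS (open_nbhs_nbhs (conj oW Wx1)) => y Wy.
  have := W1 y Wy; rewrite (hessian_sol Cg) -/(d y) => dy.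
  by rewrite -[LHS]/(d y * d y) -expr2 -real_normK ?num_real// dy expr1n.
rewrite deriveM; [|exact: diff_derivable|exact: diff_derivable].
have -> : 'D_(delta_mx 0 a) d x1 = -2 * \tr (C a) * d x1.
  by rewrite -(mx_comb_delta C a); exact: Dd.
move=> /eqP; rewrite -mulr2n mulrn_eq0 /= /GRing.scale /= !mulf_eq0.
by rewrite (negbTE dx1) orbF /= oppr_eq0 pnatr_eq0 /= => /eqP.
Qed.

End HessianDeterminant.

(** * Manifolds *)

Section Charts.
Context {R : realType} {M : topologicalType} {n : nat}.
Variables (c : chart R M n).
Hypothesis cc : is_chart c.

Lemma chart_preimage_open O :
  open O -> open (chart_dom c `&` chart_map c @^-1` O).
Proof.
have [od _ cm _ _] := cc; move: O; apply/(continuous_inP _ od).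
by rewrite -continuous_open_subspace.
Qed.

Lemma chart_image_open W :
  open W -> open (chart_img c `&` chart_inv c @^-1` W).
Proof.
have [_ oi _ ci _] := cc; move: W; apply/(continuous_inP _ oi).
by rewrite -continuous_open_subspace.
Qed.

Lemma chart_imgP u : chart_img c u ->
  chart_dom c (chart_inv c u) /\ chart_map c (chart_inv c u) = u.
Proof. by have [_ _ _ _ K] := cc; case=> p dp <-; rewrite K. Qed.

Lemma chart_imageE (T : Type) (h : M -> T) W (U : set 'rV[R]_n) :
  h @` (chart_dom c `&` chart_map c @^-1` U `&` W) =
  (h \o chart_inv c) @` (chart_img c `&` chart_inv c @^-1` W `&` U).
Proof.
have [_ _ _ _ K] := cc; apply/seteqP; split=> x /=.
  move=> [p [[dp Up] Wp] <-]; exists (chart_map c p); last by rewrite K.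
  by split=> //; split; [exists p|rewrite /preimage /= K].
move=> [u [[iu Wu] Uu] <-]; have [du E] := chart_imgP iu.
by exists (chart_inv c u) => //; split=> //; split=> //; rewrite /preimage /= E.
Qed.

End Charts.

Section GlobalStructure.
Context {R : realType} {n : nat} {M : topologicalType}.
Variables (atlas : set (chart R M n)) (f : M -> 'rV[R]_(n + 1)).
Variable xi : 'rV[R]_(n + 1).
Hypothesis smM : smooth_manifold atlas.
Hypothesis grf : graph_immersion atlas f xi.
Hypothesis ndf : nondegenerate_immersion atlas f xi.
Hypothesis parf : parallel_K atlas f xi.
Variables (o : 'rV[R]_(n + 1)) (B : 'M[R]_(n, n + 1)).
Hypothesis uB : col_mx B xi \in unitmx.

Let phi p := hproj o B xi (f p).
Let psi p := vproj o B xi (f p).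

Let cchart c : atlas c -> is_chart c.
Proof. by have [_ _ [H _ _]] := smM; exact: H. Qed.

Let oimg c : atlas c -> open (chart_img c).
Proof. by move=> /cchart[]. Qed.

Let immf c : atlas c ->
  forall u, chart_img c u -> immersed_at (f \o chart_inv c) u.
Proof. by move=> /grf[_ H] u /H[]. Qed.

Let trf c : atlas c ->
  forall u, chart_img c u -> transversal_at (f \o chart_inv c) xi u.
Proof. by move=> /grf[_ H] u /H[]. Qed.

(** By transversality. This projection along [xi] is the map into the domain of the extended
    graph. *)
Lemma local_diffeo_hproj : local_diffeo atlas phi.
Proof.
move=> c ac; have [sf _] := grf ac; split.
  by apply: smooth_hproj; [exact: oimg|exact: sf].
move=> x ix.
exact: (hproj_jacobian_unit (oimg ac) sf (immf ac) (trf ac) o uB ix).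
Qed.

Lemma local_graph y c : atlas c -> chart_dom c y ->
  exists (C : 'I_n -> 'M[R]_n) (gam : 'M[R]_n) (w0 : 'cV[R]_n) (e : R),
    let u0 := chart_map c y in
    let J := tangent_frame f c y in
    let J0 := horizontal_part J B xi in
    [/\ 0 < e, set_inj (ball u0 e) (phi \o chart_inv c),
        forall U, open U -> U `<=` ball u0 e ->
          open ((phi \o chart_inv c) @` U),
        forall q, chart_dom c q -> ball u0 e (chart_map c q) ->
          psi q = sol C gam (psi y) w0 (phi q - phi y) &
        [/\ flat_data C gam, hess_at C gam w0 \in unitmx,
            hess_at C gam w0 = gram_in (tangent_gram f xi c y) J B xi,
            forall a, C a = invmx J0 *m
              mx_comb (fun i => diff_mx (f \o chart_inv c) xi i (chart_map c y))
                (row a (invmx J0)) *m J0 &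
            w0 = invmx J0 *m rsubmx (J *m invmx (col_mx B xi))]].
Proof.
move=> ac dy; have [sf _] := grf ac; have [_ _ _ _ K] := cchart ac.
set u0 := chart_map c y; have iu0 : chart_img c u0 by exists y.
have [C [gam [w0 [e1 [e10 B1 Cg E [EC Ew EF]]]]]] :=
  local_structure (oimg ac) sf (immf ac) (trf ac) (ndf ac) (parf ac) o uB iu0.
have ul : 'J (phi \o chart_inv c) u0 \in unitmx.
  exact: (local_diffeo_hproj ac).2.
have [e2 e20 [B2 inj2 op2]] :=
  inverse_function (oimg ac) (local_diffeo_hproj ac).1 iu0 ul.
have sub1 : ball u0 (Num.min e1 e2) `<=` ball u0 e1.
  by apply: le_ball; rewrite ge_min lexx.
have sub2 : ball u0 (Num.min e1 e2) `<=` ball u0 e2.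
  by apply: le_ball; rewrite ge_min lexx orbT.
exists C, gam, w0, (Num.min e1 e2); split.
- by rewrite lt_min e10.
- by move=> u v; rewrite !inE => /sub2 Bu /sub2 Bv; apply: inj2; rewrite inE.
- by move=> U oU UB; apply: op2 => // u /UB /sub2.
- move=> q dq /sub1 /EF /=; rewrite /u0 !K//.
split=> //; rewrite E.
have uJ : horizontal_part (tangent_frame f c y) B xi \in unitmx.
  rewrite (horizontal_part_unit uB) unitmx_col_mx.
  by apply/andP; split; [exact: (immf ac iu0)|exact: (trf ac iu0)].
rewrite /gram_in !unitmx_mul unitmx_tr unitmx_inv uJ /= andbT.
exact: (ndf ac iu0).
Qed.

(** The neighbourhood is shrunk to a chart ball on which the projection is injective and open; its
    projection serves as V. *)
Lemma represented_nearI y (N : set M) (F : 'rV[R]_n -> R) :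
  open N -> N y -> (forall q, N q -> psi q = F (phi q)) ->
  exists V, [/\ open V, V (phi y) & represented_near f xi o B y V F].
Proof.
move=> oN Ny NF; have [_ _ [_ cov _]] := smM; have [c ac dy] := cov y.
have [C [gam [w0 [e [e0 inj op _ _]]]]] := local_graph ac dy.
have [_ _ _ _ K] := cchart ac.
have oBa : open (ball (chart_map c y) e) by exact: ball_open.
pose U := chart_dom c `&` chart_map c @^-1` (ball (chart_map c y) e) `&` N.
have Uy : U y by split=> //; split=> //; exact: ballxx.
exists (phi @` U); split; last exists U; [| |split].
- rewrite chart_imageE; last exact: cchart.
  apply: op; last by move=> u [].
  by apply: openI => //; apply: chart_image_open => //; exact: cchart.
- by exists y.
- by apply: openI => //; apply: chart_preimage_open => //; exact: cchart.
- exact: Uy.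
- move=> p q; rewrite !inE => -[[dp bp] _] [[dq bq] _] E.
  rewrite -(K p dp) -(K q dq); congr chart_inv.
  apply: inj; rewrite ?inE//=.
  by rewrite !K// /phi E.
- have E q : U q -> f q = graph_in o B xi F (phi q).
    by move=> [_ Nq]; apply: (graph_in_proj uB); exact: NF.
  apply/seteqP; split=> x /=.
    by move=> [q Uq <-]; exists (phi q); [exists q|rewrite E].
  by move=> [_ [q Uq <-] <-]; exists q => //; rewrite E.
Qed.

Lemma represented_nearE y V F : represented_near f xi o B y V F ->
  exists2 U : set M, open U /\ U y &
    forall q, U q -> V (phi q) /\ psi q = F (phi q).
Proof.
move=> [U [oU Uy _ E]]; exists U => // q Uq.
have : (f @` U) (f q) by exists q.
rewrite E => -[x Vx Ex]; rewrite /phi /psi -Ex hproj_graph_in//.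
by rewrite vproj_graph_in.
Qed.

Lemma hproj_open_image (N : set M) y : open N -> N y ->
  exists2 W, open W /\ W (phi y) & W `<=` phi @` N.
Proof.
move=> oN Ny; have [_ _ [_ cov _]] := smM; have [c ac dy] := cov y.
have [C [gam [w0 [e [e0 inj op _ _]]]]] := local_graph ac dy.
have oBa : open (ball (chart_map c y) e) by exact: ball_open.
exists (phi @` (chart_dom c `&`
  chart_map c @^-1` (ball (chart_map c y) e) `&` N)); last first.
  by move=> _ [q [_ Nq] <-]; exists q.
split; last by exists y => //; split=> //; split=> //; exact: ballxx.
rewrite chart_imageE; last exact: cchart.
apply: op; last by move=> u [].
by apply: openI => //; apply: chart_image_open => //; exact: cchart.
Qed.

Lemma global_graph y (C : 'I_n -> 'M[R]_n) gam f0 w0 x0 (N : set M) :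
  connected [set: M] -> flat_data C gam -> hess_at C gam w0 \in unitmx ->
  open N -> N y -> (forall q, N q -> psi q = sol C gam f0 w0 (phi q - x0)) ->
  forall p, psi p = sol C gam f0 w0 (phi p - x0).
Proof.
move=> cM Cg uH oN Ny NF.
pose Gr q := psi q = sol C gam f0 w0 (phi q - x0).
(* [S] is closed because two local solutions which agree on an open set agree
   everywhere. *)
pose S : set M := [set p | exists2 U : set M, open U /\ U p & U `<=` Gr].
suff ST : S = setT.
  by move=> p; have [U [_ Up] /(_ p Up)] : S p by rewrite ST.
apply: cM.
- by exists y, N.
- exists S; last by rewrite setTI.
  rewrite openE => p [U [oU Up] UG]; apply: filterS (open_nbhs_nbhs (conj oU Up)).
  by move=> q Uq; exists U.
exists S; last by rewrite setTI.
move=> p clp; have [_ _ [_ cov _]] := smM; have [c ac dp] := cov p.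
have [C' [gam' [w0' [e [e0 _ _ EF [Cg' _ _ _ _]]]]]] := local_graph ac dp.
pose U := chart_dom c `&` chart_map c @^-1` (ball (chart_map c p) e).
have oU : open U by apply: chart_preimage_open; [exact: cchart|exact: ball_open].
have Up : U p by split=> //; exact: ballxx.
(* Near q both the given solution and the local one at p describe f; their agreement on an open set
   of projections extends to the whole space, hence to all of [U]. *)
have [q [[U' [oU' U'q] U'G] Uq]] := clp U (open_nbhs_nbhs (conj oU Up)).
have [W [oW Wq] WU] := hproj_open_image (openI oU oU') (conj Uq U'q).
exists U => // z Uz; rewrite /Gr EF; [|exact: Uz.1|exact: Uz.2].
apply/esym; apply: (sol_rigid Cg Cg' oW Wq uH) => x /WU[z' [Uz' U'z'] <-].
by rewrite -(U'G z' U'z') EF; [|exact: Uz'.1|exact: Uz'.2].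
Qed.

End GlobalStructure.

Lemma mxtrace_mx_comb {R : realType} {n m : nat} (K : 'I_n -> 'M[R]_m) v :
  \tr (mx_comb K v) = \sum_i v 0 i * \tr (K i).
Proof. by rewrite linear_sum; apply: eq_bigr => i _; rewrite linearZ. Qed.

(** The column of traces is a covector: a change of frame multiplies it by an invertible matrix. *)
Lemma mxtrace_conj_eq0 {R : realType} {n : nat} (K : 'I_n -> 'M[R]_n) J :
  J \in unitmx ->
  (forall a, \tr (invmx J *m mx_comb K (row a (invmx J)) *m J) = 0) <->
  (forall i, \tr (K i) = 0).
Proof.
move=> uJ; have E a : \tr (invmx J *m mx_comb K (row a (invmx J)) *m J) =
    (invmx J *m \col_i \tr (K i)) a 0.
  rewrite mxtrace_mulC mulmxA mulmxV// mul1mx mxtrace_mx_comb mxE.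
  by apply: eq_bigr => i _; rewrite !mxE.
split=> [H i|H a]; last first.
  rewrite E (_ : \col_i _ = 0) ?mulmx0 ?mxE//.
  by apply/colP => i; rewrite !mxE.
have : invmx J *m \col_i \tr (K i) = 0.
  by apply/colP => a; rewrite -E H mxE.
move=> /(congr1 (mulmx J)); rewrite mulKVmx// mulmx0 => /colP/(_ i).
by rewrite !mxE.
Qed.

Lemma smooth_subset (R : realType) (V W : normedModType R) (U U' : set V)
  (f : V -> W) : U `<=` U' -> smooth_on U' f -> smooth_on U f.
Proof.
move=> UU sf k; move: (sf k); elim: k f {sf} => /= [f cf x /UU|k IH f [df Df]].
  exact: cf.
by split=> [x /UU|v]; [exact: df|exact: IH].
Qed.

Section GlobalGraphs.
Context {R : realType} {n : nat}.
Variables (o : 'rV[R]_(n + 1)) (B : 'M[R]_(n, n + 1)) (xi : 'rV[R]_(n + 1)).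
Hypothesis uB : col_mx B xi \in unitmx.

(** The projection along [xi] is a continuous left inverse. *)
Lemma embedding_graph_in F : smooth_on setT F -> embedding (graph_in o B xi F).
Proof.
move=> sF; split.
- by move=> x; apply: (smooth_continuous (smooth_graph_in o B xi sF)).
- by move=> x y E; rewrite -(hproj_graph_in o uB F x) E hproj_graph_in.
move=> U oU; have ch : continuous (hproj o B xi).
  have /= s := smooth_hproj o B xi openT (smooth_id setT).
  by move=> x; apply: (smooth_continuous s).
exists (hproj o B xi @^-1` U); first by move/continuousP : ch; exact.
apply/seteqP; split=> p /=.
  move=> [x Ux <-]; split; first by exists x.
  by rewrite /preimage /= hproj_graph_in.
move=> [[x _ <-]]; rewrite /preimage /= hproj_graph_in// => Ux.
by exists x.
Qed.

Variables (C : 'I_n -> 'M[R]_n) (gam : 'M[R]_n) (f0 : R) (w0 : 'cV[R]_n).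
Variable x0 : 'rV[R]_n.
Hypothesis Cg : flat_data C gam.
Hypothesis uH : hess_at C gam w0 \in unitmx.
Let g := graph_in o B xi (fun x => sol C gam f0 w0 (x - x0)).

Lemma graph_immersion_sol : graph_immersion (std_atlas R n) g xi.
Proof.
have sF := smooth_sol_shift f0 x0 Cg uH.
move=> _ ->; split.
  apply: smooth_subset (@subsetT _ _) _; exact: smooth_graph_in.
by move=> x _; exact: graph_in_immersed.
Qed.

Lemma nondegenerate_sol : nondegenerate_immersion (std_atlas R n) g xi.
Proof. by move=> _ -> x _; exact: aff_form_sol_unit. Qed.

Lemma parallel_K_sol : parallel_K (std_atlas R n) g xi.
Proof. by move=> _ -> x _ l i j k; exact: nabla_K_sol. Qed.

End GlobalGraphs.

(** * The tangent algebra and the four assertions *)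

Section TangentAlgebra.
Context {R : realType} {n : nat} {M : topologicalType}.
Variables (atlas : set (chart R M n)) (f : M -> 'rV[R]_(n + 1)).
Variables (xi : 'rV[R]_(n + 1)) (y : M) (c : chart R M n).

Definition tangent_alg i := diff_mx (f \o chart_inv c) xi i (chart_map c y).

Lemma tangent_mulE :
  tangent_mul f xi c y = fun u v => v *m mx_comb tangent_alg u.
Proof.
apply/funext => u; apply/funext => v; apply/rowP => k; rewrite !mxE.
rewrite exchange_big; apply: eq_bigr => j _; rewrite summxE mulr_sumr.
apply: eq_bigr => i _.
have -> : (u 0 i *: tangent_alg i) j k = u 0 i *
    difference_tensor (f \o chart_inv c) xi i j k (chart_map c y).
  by rewrite [LHS]mxE [tangent_alg i j k]mxE.
by rewrite mulrCA mulrA.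
Qed.

Hypothesis smM : smooth_manifold atlas.
Hypothesis grf : graph_immersion atlas f xi.
Hypothesis ndf : nondegenerate_immersion atlas f xi.
Hypothesis parf : parallel_K atlas f xi.
Hypotheses (ac : atlas c) (dy : chart_dom c y).
Let J := tangent_frame f c y.
Let G := tangent_gram f xi c y.

Lemma tangent_frame_unit : col_mx J xi \in unitmx.
Proof.
rewrite unitmx_col_mx; have [_ H] := grf ac.
by apply/andP; apply: H; exists y.
Qed.

Let uJ := tangent_frame_unit.

Let horizontal_part1 : horizontal_part J J xi = 1%:M.
Proof. by rewrite /horizontal_part (B_frame uJ) row_mxKl. Qed.

(** With origin [f y] and the tangent frame as B, the horizontal part is the identity and value and
    gradient vanish at y. So C and [gam] are the tangent algebra and h_y themselves, without change
    of frame. *)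
Lemma tangent_graph : flat_data tangent_alg G /\ exists2 e : R, 0 < e &
  forall q, chart_dom c q -> ball (chart_map c y) e (chart_map c q) ->
    vproj (f y) J xi (f q) = sol tangent_alg G 0 0 (hproj (f y) J xi (f q)).
Proof.
have [C [gam [w0 [e [e0 _ _ EF [Cg _ EG EC Ew]]]]]] :=
  local_graph smM grf ndf parf (f y) uJ ac dy.
rewrite -/J horizontal_part1 invmx1 in EC Ew.
have {}Ew : w0 = 0 by rewrite Ew mul1mx (B_frame uJ) row_mxKr.
have {}EC : C = tangent_alg.
  apply/funext => a; rewrite EC mul1mx mulmx1 row1 mx_comb_delta.
  by [].
have {}EG : gam = G.
  rewrite -(hess_at0 C gam) -Ew EG /gram_in -/J horizontal_part1 invmx1.
  by rewrite trmx1 mul1mx mulmx1.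
rewrite -EC -EG -Ew; split=> //; exists e => // q dq Bq.
rewrite EF//; congr sol; first by rewrite /vproj subrr mul0mx !mxE.
by rewrite [X in _ - X]/hproj subrr mul0mx raddf0 subr0.
Qed.

Lemma tangent_gram_unit : G \in unitmx.
Proof. by apply: (ndf ac); exists y. Qed.

End TangentAlgebra.

Section ParallelImmersions.
Context {R : realType} {n : nat} {M : topologicalType}.
Variables (atlas : set (chart R M n)) (f : M -> 'rV[R]_(n + 1)).
Variables (xi : 'rV[R]_(n + 1)) (y : M) (c : chart R M n).
Hypothesis smM : smooth_manifold atlas.
Hypothesis grf : graph_immersion atlas f xi.
Hypothesis ndf : nondegenerate_immersion atlas f xi.
Hypothesis parf : parallel_K atlas f xi.
Hypotheses (ac : atlas c) (dy : chart_dom c y).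

Theorem local_representation :
  let mul := tangent_mul f xi c y in
  let gam := tangent_form f xi c y in
  [/\ metrised_algebra mul gam, commutative mul, associative mul,
      forall x, cvgn (potential_partial_sum mul gam x) &
      exists V : set 'rV[R]_n, [/\ open V, V 0 &
        represented_near f xi (f y) (tangent_frame f c y) y V
          (potential mul gam)]].
Proof.
move=> mul gam; rewrite /mul tangent_mulE.
have [Cg [e e0 EF]] := tangent_graph smM grf ndf parf ac dy.
have uG := tangent_gram_unit ndf ac dy.
have uJ := tangent_frame_unit grf ac dy.
pose mulC (u v : 'rV[R]_n) := v *m mx_comb (tangent_alg f xi y c) u.
have pot x : potential_partial_sum mulC gam x @ \oo -->
    sol (tangent_alg f xi y c) (tangent_gram f xi c y) 0 0 x.
  exact: (@potential_partial_sum_cvg R _ n mulC gam _ _ id Cg).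
split.
- exact: (flat_metrised Cg uG).
- exact: (flat_mulC Cg).
- exact: (flat_mulA Cg).
- by move=> x; apply/cvg_ex; eexists; exact: pot.
pose N := chart_dom c `&` chart_map c @^-1` ball (chart_map c y) e.
have [||q [dq Bq]|V [oV Vy rV]] := represented_nearI smM grf ndf parf (o := f y) uJ
    (y := y) (N := N) (F := potential mulC gam).
- apply: chart_preimage_open; last exact: ball_open.
  by have [_ _ [H _ _]] := smM; exact: H.
- by split=> //; exact: ballxx.
- by rewrite EF//; apply/esym/cvg_lim => //; exact: pot.
exists V; split=> //.
by move: Vy; rewrite /hproj subrr mul0mx raddf0.
Qed.

Theorem global_extension : connected [set: M] ->
  exists (o : 'rV[R]_(n + 1)) (B : 'M[R]_(n, n + 1)) (F : 'rV[R]_n -> R),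
    col_mx B xi \in unitmx /\
    let fext := graph_in o B xi F in
    [/\ graph_immersion (std_atlas R n) fext xi,
        embedding fext,
        nondegenerate_immersion (std_atlas R n) fext xi,
        parallel_K (std_atlas R n) fext xi &
        exists2 iota : M -> 'rV[R]_n,
          local_diffeo atlas iota & forall p, f p = fext (iota p)].
Proof.
move=> cM; have [Cg [e e0 EF]] := tangent_graph smM grf ndf parf ac dy.
have uG := tangent_gram_unit ndf ac dy.
have uJ := tangent_frame_unit grf ac dy.
set C := tangent_alg f xi y c in Cg EF; set G := tangent_gram f xi c y in Cg EF uG.
have uH : hess_at C G 0 \in unitmx by rewrite hess_at0.
(* The term [x - 0] matches the lemmas on solutions with an arbitrary centre. *)
exists (f y), (tangent_frame f c y), (fun x => sol C G 0 0 (x - 0)).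
split; [exact: uJ|split].
- exact: graph_immersion_sol.
- apply: embedding_graph_in => //; exact: smooth_sol_shift.
- exact: nondegenerate_sol.
- exact: parallel_K_sol.
exists (fun p => hproj (f y) (tangent_frame f c y) xi (f p)).
  exact: local_diffeo_hproj.
move=> p; apply: (graph_in_proj uJ).
pose N := chart_dom c `&` chart_map c @^-1` ball (chart_map c y) e.
apply: (global_graph smM grf ndf parf uJ (y := y) (N := N)) => //.
- apply: chart_preimage_open; last exact: ball_open.
  by have [_ _ [H _ _]] := smM; exact: H.
- by split=> //; exact: ballxx.
- by move=> q [dq Bq]; rewrite subr0; exact: EF.
Qed.

Variables (o : 'rV[R]_(n + 1)) (B : 'M[R]_(n, n + 1)).

(** The volume is measured in coordinates (o, B, xi) unrelated to the tangent frame. The determinant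
    is therefore computed from the local graph in these coordinates, and its traces are carried back
    to the tangent algebra by [mxtrace_conj_eq0]. *)
Theorem improper_affine_sphereP : connected [set: M] ->
  col_mx B xi \in unitmx ->
  improper_affine_sphere f xi o B <->
  `|\det (gram_in (tangent_gram f xi c y) (tangent_frame f c y) B xi)| = 1
  /\ nilpotent_algebra (tangent_mul f xi c y).
Proof.
move=> cM uB; have [Cg0 _] := tangent_graph smM grf ndf parf ac dy.
have [C [gam [w0 [e [e0 _ _ EF [Cg uH EG EC _]]]]]] :=
  local_graph smM grf ndf parf o uB ac dy.
have uJ0 : horizontal_part (tangent_frame f c y) B xi \in unitmx.
  by rewrite horizontal_part_unit//; exact: (tangent_frame_unit grf ac dy).
have nilC : nilpotent_algebra (tangent_mul f xi c y) <-> forall a, \tr (C a) = 0.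
  rewrite tangent_mulE.
  apply: iff_trans (@nilpotent_algebraP R _ n _ _ _ id Cg0 _ _ _ _) _ => //.
    by move=> v; exists v.
  apply: iff_trans (iff_sym (mxtrace_conj_eq0 (tangent_alg f xi y c) uJ0)) _.
  by split=> H a; [rewrite EC|rewrite -EC]; exact: H.
rewrite nilC -EG.
pose N := chart_dom c `&` chart_map c @^-1` ball (chart_map c y) e.
have oN : open N.
  apply: chart_preimage_open; last exact: ball_open.
  by have [_ _ [H _ _]] := smM; exact: H.
have Ny : N y by split=> //; exact: ballxx.
have NF q : N q -> vproj o B xi (f q) = sol C gam (vproj o B xi (f y)) w0
    (hproj o B xi (f q) - hproj o B xi (f y)) by case=> dq Bq; exact: EF.
split=> [imp|[d1 tr0] p].
  have [V [F [oV sF rF F1]]] := imp y.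
  have [U [oU Uy] UF] := represented_nearE uB rF.
  have [W [oW Wy] WU] := hproj_open_image smM grf ndf parf o uB (openI oN oU) (conj Ny Uy).
  (* The function supplied by the definition is unknown, but it agrees with the solution on an open
     set of projections, which suffices for second derivatives. *)
  have WF x : W x -> V x /\ F x = sol C gam (vproj o B xi (f y)) w0
      (x - hproj o B xi (f y)).
    by move=> /WU[q [Nq Uq] <-]; have [Vq <-] := UF q Uq; split=> //; exact: NF.
  have H1 x : W x -> `|\det (hessian (fun x => sol C gam (vproj o B xi (f y)) w0
      (x - hproj o B xi (f y))) x)| = 1.
    move=> Wx; apply: (etrans _ (F1 x (WF x Wx).1)).
    apply: (congr1 (fun H => `|\det H|)).
    by apply: (hessian_congr oW _ Wx) => z /WF[_ ->].
  have tr0 := det_hessian_trace Cg uH oW Wy H1; split=> //.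
  rewrite -(H1 _ Wy); congr `|_|; apply/esym.
  exact: (det_hessian_sol _ _ Cg uH _ tr0).
(* The traces vanish for the algebra at y; connectedness makes one and the same solution describe f
   near every p. *)
have glob := global_graph smM grf ndf parf uB cM Cg uH oN Ny NF.
pose F x := sol C gam (vproj o B xi (f y)) w0 (x - hproj o B xi (f y)).
have [V [oV _ rV]] := represented_nearI smM grf ndf parf uB openT
  (I : [set: M] p) (F := F) (fun q _ => glob q).
exists V, F; split; [exact: oV| |exact: rV|].
  by apply: smooth_subset (@subsetT _ _) _; exact: smooth_sol_shift.
by move=> x _; rewrite det_hessian_sol.
Qed.

End ParallelImmersions.

Section AlgebraGraphs.
Context {R : realType} {A : vectType R} {n : nat}.
Variables (mul : A -> A -> A) (gam : A -> A -> R) (X : n.-tuple A).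
Hypothesis metA : metrised_algebra mul gam.
Hypothesis mulC : commutative mul.
Hypothesis mulA : associative mul.
Hypothesis bX : basis_of fullv X.
Let f := graph_map (potential_in mul gam X).
Let C := struct_mx mul X.
Let G := gram_of gam X.
Let Cg : flat_data C G. Proof. exact: flat_data_struct. Qed.
Let uH : hess_at C G 0 \in unitmx.
Proof. by rewrite hess_at0; exact: (gram_of_unit metA bX). Qed.

Lemma horizontal_vertical_unit : col_mx (horizontal R n) (vertical R n) \in unitmx.
Proof.
rewrite -[col_mx _ _]/(block_mx _ _ _ _) -scalar_mx_block.
exact: unitmx1.
Qed.

Let pot x : potential_partial_sum mul gam (vec_of X x) @ \oo --> sol C G 0 0 x.
Proof.
exact: (potential_partial_sum_cvg Cg (vec_of_mul metA bX) (vec_of_gam X metA)).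
Qed.

Let potE : potential_in mul gam X = fun x => sol C G 0 0 (x - 0).
Proof. by apply/funext => x; rewrite subr0; apply/cvg_lim => //; exact: pot. Qed.

Lemma graph_mapE (F : 'rV[R]_n -> R) :
  graph_map F = graph_in 0 (horizontal R n) (vertical R n) F.
Proof.
apply/funext => x; rewrite /graph_in add0r mul_mx_row mulmx1 mulmx0.
by rewrite scale_row_mx scaler0 scale_scalar_mx mulr1 add_row_mx addr0 add0r.
Qed.

Theorem potential_graph :
  let xi := vertical R n in
  [/\ forall x, cvgn (potential_partial_sum mul gam x),
      graph_immersion (std_atlas R n) f xi,
      nondegenerate_immersion (std_atlas R n) f xi,
      parallel_K (std_atlas R n) f xi &
      forall i j k,
        difference_tensor f xi i j k 0 = coord X k (mul X`_i X`_j)].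
Proof.
move=> xi; rewrite /f graph_mapE potE; have uB := horizontal_vertical_unit.
split.
- move=> x; rewrite (vec_of_coord bX x); apply/cvg_ex; eexists; exact: pot.
- exact: graph_immersion_sol.
- exact: nondegenerate_sol.
- exact: parallel_K_sol.
- by move=> i j k; rewrite difference_tensor_sol// mxE.
Qed.

Theorem improper_potential_graphP :
  improper_affine_sphere f (vertical R n) 0 (horizontal R n) <->
  `|\det (gram_of gam X)| = 1 /\ nilpotent_algebra mul.
Proof.
have uB := horizontal_vertical_unit.
have -> : nilpotent_algebra mul <-> forall a, \tr (C a) = 0.
  apply: (nilpotent_algebraP Cg (vec_of_mul metA bX) (vec_of_inj bX)).
    by move=> v; eexists; exact: (vec_of_coord bX v).
  by rewrite /vec_of big1// => i _; rewrite mxE scale0r.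
rewrite -/G -(hess_at0 C G) /f graph_mapE potE.
split=> [imp|[d1 tr0] y].
  have [V [F [oV sF rF F1]]] := imp 0.
  have [U [oU U0] UF] := represented_nearE uB rF.
  have {}UF x : U x -> V x /\ F x = sol C G 0 0 (x - 0).
    by move=> /UF; rewrite hproj_graph_in// vproj_graph_in// => -[Vx <-].
  have H1 x : U x -> `|\det (hessian (fun x => sol C G 0 0 (x - 0)) x)| = 1.
    move=> Ux; apply: (etrans _ (F1 x (UF x Ux).1)).
    apply: (congr1 (fun H => `|\det H|)).
    by apply: (hessian_congr oU _ Ux) => z /UF[_ ->].
  have tr0 := det_hessian_trace Cg uH oU U0 H1; split=> //.
  rewrite -(H1 _ U0); congr `|_|; apply/esym.
  exact: (det_hessian_sol _ _ Cg uH _ tr0).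
exists setT; eexists; split; [exact: openT|exact: (smooth_sol_shift 0 0 Cg uH)| |].
  exists setT; split; [exact: openT|exact: I| |by []].
  move=> x z _ _ E.
  by rewrite -(hproj_graph_in 0 uB (fun x => sol C G 0 0 (x - 0)) x) E hproj_graph_in.
by move=> x _; rewrite det_hessian_sol.
Qed.

End AlgebraGraphs.

Theorem theorem6p2 (R : realType) :
  [/\
   forall (n : nat) (M : topologicalType) (atlas : set (chart R M n))
     (f : M -> 'rV[R]_(n + 1)) (xi : 'rV[R]_(n + 1)) (y : M) (c : chart R M n),
     smooth_manifold atlas -> graph_immersion atlas f xi ->
     nondegenerate_immersion atlas f xi -> parallel_K atlas f xi ->
     atlas c -> chart_dom c y ->
     let mul := tangent_mul f xi c y in
     let gam := tangent_form f xi c y in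
     [/\ metrised_algebra mul gam, commutative mul, associative mul,
         forall x, cvgn (potential_partial_sum mul gam x) &
         exists V : set 'rV[R]_n, [/\ open V, V 0 &
           represented_near f xi (f y) (tangent_frame f c y) y V
             (potential mul gam)]],
   forall (A : vectType R) (mul : A -> A -> A) (gam : A -> A -> R)
     (n : nat) (X : n.-tuple A),
     metrised_algebra mul gam -> commutative mul -> associative mul ->
     basis_of fullv X ->
     let f := graph_map (potential_in mul gam X) in
     let xi := vertical R n in
     [/\ forall x, cvgn (potential_partial_sum mul gam x),
         graph_immersion (std_atlas R n) f xi,
         nondegenerate_immersion (std_atlas R n) f xi,
         parallel_K (std_atlas R n) f xi &
         forall i j k,
           difference_tensor f xi i j k 0 = coord X k (mul X`_i X`_j)],
   forall (n : nat) (M : topologicalType) (atlas : set (chart R M n))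
     (f : M -> 'rV[R]_(n + 1)) (xi : 'rV[R]_(n + 1)),
     smooth_manifold atlas -> [set: M] !=set0 -> connected [set: M] ->
     graph_immersion atlas f xi ->
     nondegenerate_immersion atlas f xi -> parallel_K atlas f xi ->
     exists (o : 'rV[R]_(n + 1)) (B : 'M[R]_(n, n + 1)) (F : 'rV[R]_n -> R),
       col_mx B xi \in unitmx /\
       let fext := graph_in o B xi F in
       [/\ graph_immersion (std_atlas R n) fext xi,
           embedding fext,
           nondegenerate_immersion (std_atlas R n) fext xi,
           parallel_K (std_atlas R n) fext xi &
           exists2 iota : M -> 'rV[R]_n,
             local_diffeo atlas iota & forall p, f p = fext (iota p)] &
   (forall (n : nat) (M : topologicalType) (atlas : set (chart R M n))
      (f : M -> 'rV[R]_(n + 1)) (xi : 'rV[R]_(n + 1)) (y : M) (c : chart R M n)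
      (o : 'rV[R]_(n + 1)) (B : 'M[R]_(n, n + 1)),
      smooth_manifold atlas -> connected [set: M] ->
      graph_immersion atlas f xi ->
      nondegenerate_immersion atlas f xi -> parallel_K atlas f xi ->
      atlas c -> chart_dom c y -> col_mx B xi \in unitmx ->
      improper_affine_sphere f xi o B <->
      `|\det (gram_in (tangent_gram f xi c y) (tangent_frame f c y) B xi)| = 1
      /\ nilpotent_algebra (tangent_mul f xi c y)) /\
   (forall (A : vectType R) (mul : A -> A -> A) (gam : A -> A -> R)
      (n : nat) (X : n.-tuple A),
      metrised_algebra mul gam -> commutative mul -> associative mul ->
      basis_of fullv X ->
      improper_affine_sphere (graph_map (potential_in mul gam X)) (vertical R n)
        0 (horizontal R n) <->
      `|\det (gram_of gam X)| = 1 /\ nilpotent_algebra mul)].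
Proof.
split.
- move=> n M atlas f xi y c smM grf ndf parf ac dy.
  exact: (local_representation smM grf ndf parf ac dy).
- move=> A mul gam n X metA mulC mulA bX; exact: potential_graph.
- move=> n M atlas f xi smM [y _] cM grf ndf parf.
  have [_ _ [_ cov _]] := smM; have [c ac dy] := cov y.
  exact: (global_extension smM grf ndf parf ac dy cM).
split.
- move=> n M atlas f xi y c o B smM cM grf ndf parf ac dy uB.
  exact: (improper_affine_sphereP smM grf ndf parf ac dy o cM uB).
- move=> A mul gam n X metA mulC mulA bX; exact: improper_potential_graphP.
Qed.
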